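(* Let $\underline{B}$ be an additive category. The following assumptions on $\underline{B}$ are equivalent. (1) $\underline{B}$ is weakly idempotent complete. (2) There exists a triangulated category $\underline{C}$ such that $\underline{B}$ is a weakly retraction-closed subcategory of $\underline{C}$. (3) $\underline{B}$ is equivalent to the heart of a weight structure (on some triangulated category). (4) $\underline{B}$ is equivalent to the heart of a bounded weight structure. (5) $\underline{B}$ is equivalent to the heart $\underline{Hw}_{st}^b$ of the stupid weight structure $w_{st}^b$ on the bounded homotopy category $K^b(\underline{B})$. (6) For any additive category $\underline{B}''$ such that the canonical embedding $\underline{B}''\to \operatorname{wKar}(\underline{B}'')$ factors through a fully faithful functor $\underline{B}\to \operatorname{wKar}(\underline{B}'')$, and any triangulated category $\underline{C}$ in which $\underline{B}''$ is a connective subcategory, there exists a unique weight structure $w$ on the triangulated subcategory $\underline{D}$ of $\underline{C}$ strongly generated by $\underline{B}''$ such that the heart $\underline{Hw}$ is naturally equivalent to $\underline{B}$, that is, $\underline{Hw}$ contains $\underline{B}''$ and the embedding $\underline{B}''\to \underline{Hw}$ factors through an equivalence of $\underline{B}$ with $\underline{Hw}$.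
   Context: All categories and functors are additive; subcategories are full. Factorizations of functors are understood up to isomorphism of functors. An additive category $\underline{B}$ is weakly idempotent complete if every split monomorphism $i:X\to Y$ in $\underline{B}$ (i.e. $p\circ i=\operatorname{id}_X$ for some $p\in\underline{B}(Y,X)$) is isomorphic to the monomorphism $\operatorname{id}_X\bigoplus 0: X\to X\bigoplus Z$ for some object $Z$ of $\underline{B}$. For a full additive subcategory $\underline{A}'$ of an additive category $\underline{A}$, the weak retraction-closure $\operatorname{wKar}_{\underline{A}}(\underline{A}')$ is the full subcategory of $\underline{A}$ whose objects are those $Z\in\operatorname{Obj}\underline{A}$ for which there exist $X,Y\in \operatorname{Obj}\underline{A}'$ with $X\bigoplus Z\cong Y$. The subcategory $\underline{A}'$ is weakly retraction-closed in $\underline{A}$ if $\operatorname{wKar}_{\underline{A}}(\underline{A}')=\underline{A}'$. The idempotent completion $\operatorname{Kar}(\underline{A})$ has as objects the pairs $(B,p)$ with $B\in\operatorname{Obj}\underline{A}$, $p\in\underline{A}(B,B)$, $p^2=p$, and morphisms $\operatorname{Kar}(\underline{A})((X,p),(X',p'))=\{f\in\underline{A}(X,X'): p'\circ f=f\circ p=f\}$; $\underline{A}$ is fully embedded into it by $B\mapsto (B,\operatorname{id}_B)$. Put $\operatorname{wKar}(\underline{A})=\operatorname{wKar}_{\operatorname{Kar}(\underline{A})}(\underline{A})$; $\underline{A}$ embeds canonically into it. A weight structure $w$ on a triangulated category $\underline{C}$ is a pair $(\underline{C}_{w\le 0},\underline{C}_{w\ge 0})$ of classes of objects of $\underline{C}$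 such that: (i) both classes contain all $\underline{C}$-retracts of their elements ($X$ is a retract of $Y$ if $\operatorname{id}_X$ factors through $Y$); (ii) $\underline{C}_{w\le 0}\subset \underline{C}_{w\le 0}[1]$ and $\underline{C}_{w\ge 0}[1]\subset \underline{C}_{w\ge 0}$; (iii) $\underline{C}(X,Y)=\{0\}$ for all $X\in\underline{C}_{w\le 0}$, $Y\in \underline{C}_{w\ge 0}[1]$; (iv) for any $M\in\operatorname{Obj}\underline{C}$ there is a distinguished triangle $L_wM\to M\to R_wM\to L_wM[1]$ with $L_wM\in\underline{C}_{w\le 0}$ and $R_wM\in\underline{C}_{w\ge 0}[1]$. The heart $\underline{Hw}$ of $w$ is the full subcategory of $\underline{C}$ with the class of objects $\underline{C}_{w\le 0}\cap\underline{C}_{w\ge 0}$. With $\underline{C}_{w\ge i}=\underline{C}_{w\ge 0}[i]$ and $\underline{C}_{w\le i}=\underline{C}_{w\le 0}[i]$, $w$ is bounded if $\operatorname{Obj}\underline{C}=\bigcup_{i\in\mathbb{Z}}\underline{C}_{w\ge i}=\bigcup_{i\in\mathbb{Z}}\underline{C}_{w\le i}$. The stupid weight structure $w_{st}$ on the homotopy category $K(\underline{B})$ of cohomological complexes: $K(\underline{B})_{w_{st}\le 0}$ (resp. $K(\underline{B})_{w_{st}\ge 0}$) is the class of complexes homotopy equivalent to complexes concentrated in degrees $\ge 0$ (resp. $\le 0$). The weight structure $w_{st}^b$ on the subcategory $K^b(\underline{B})$ of bounded complexes is the restriction of $w_{st}$, i.e. it is given by the intersections of these two classes with $\operatorname{Obj}K^b(\underline{B})$.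 A full subcategory $\underline{H}\subset\underline{C}$ of a triangulated category is connective (in $\underline{C}$) if $\underline{C}(X,Y[i])=\{0\}$ for all $X,Y\in\operatorname{Obj}\underline{H}$ and $i>0$. The subcategory of $\underline{C}$ strongly generated by $\underline{H}$ is the smallest strictly full triangulated subcategory of $\underline{C}$ containing $\underline{H}$. *)

(* Defs.v *)
From HB Require Import structures.
From mathcomp Require Import all_boot all_order all_algebra.
From mathcomp Require Import boolp.

Set Implicit Arguments.
Unset Strict Implicit.
Unset Printing Implicit Defensive.

Import Order.TTheory GRing.Theory Num.Theory.
Local Open Scope ring_scope.
Local Open Scope quotient_scope.

Reserved Notation "g \oc f" (at level 40, left associativity).
Reserved Notation "G \oF F" (at level 40, left associativity).

(* Composition is written in the usual order: g \oc f is "f, then g". *)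
Record precat := Precat {
  obj :> Type;
  hom : obj -> obj -> zmodType;
  idc : forall X, hom X X;
  comp : forall X Y Z, hom Y Z -> hom X Y -> hom X Z;
  comp1c : forall X Y (f : hom X Y), comp (idc Y) f = f;
  compc1 : forall X Y (f : hom X Y), comp f (idc X) = f;
  compA : forall X Y Z T (h : hom Z T) (g : hom Y Z) (f : hom X Y),
    comp h (comp g f) = comp (comp h g) f;
  compDl : forall X Y Z (g g' : hom Y Z) (f : hom X Y),
    comp (g + g') f = comp g f + comp g' f;
  compDr : forall X Y Z (g : hom Y Z) (f f' : hom X Y),
    comp g (f + f') = comp g f + comp g f'
}.
Arguments hom {p} X Y.
Arguments idc {p} X.
Arguments comp {p X Y Z} g f.
Notation "g \oc f" := (comp g f) : ring_scope.

Section PrecatTheory.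
Variable C : precat.
Implicit Types X Y Z W : C.

Lemma comp0c X Y Z (f : hom X Y) : (0 : hom Y Z) \oc f = 0.
Proof. by apply: (addrI (0 \oc f)); rewrite -compDl !addr0. Qed.

Lemma compc0 X Y Z (g : hom Y Z) : g \oc (0 : hom X Y) = 0.
Proof. by apply: (addrI (g \oc 0)); rewrite -compDr !addr0. Qed.

Lemma compNl X Y Z (g : hom Y Z) (f : hom X Y) : (- g) \oc f = - (g \oc f).
Proof. by apply: (addrI (g \oc f)); rewrite -compDl !subrr comp0c. Qed.

Lemma compNr X Y Z (g : hom Y Z) (f : hom X Y) : g \oc (- f) = - (g \oc f).
Proof. by apply: (addrI (g \oc f)); rewrite -compDr !subrr compc0. Qed.

Lemma compBl X Y Z (g g' : hom Y Z) (f : hom X Y) :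
  (g - g') \oc f = g \oc f - g' \oc f.
Proof. by rewrite compDl compNl. Qed.

Lemma compBr X Y Z (g : hom Y Z) (f f' : hom X Y) :
  g \oc (f - f') = g \oc f - g \oc f'.
Proof. by rewrite compDr compNr. Qed.

Definition is_iso X Y (f : hom X Y) : Prop :=
  exists g : hom Y X, g \oc f = idc X /\ f \oc g = idc Y.

Definition isomorphic X Y : Prop := exists f : hom X Y, is_iso f.

Definition is_zero_obj Z : Prop :=
  (forall X (f : hom X Z), f = 0) /\ (forall X (f : hom Z X), f = 0).

Definition is_biproduct X Y W
    (i1 : hom X W) (i2 : hom Y W) (p1 : hom W X) (p2 : hom W Y) : Prop :=
  [/\ p1 \oc i1 = idc X, p2 \oc i2 = idc Y, p1 \oc i2 = 0, p2 \oc i1 = 0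
    & i1 \oc p1 + i2 \oc p2 = idc W].

Definition direct_sum X Y W : Prop :=
  exists (i1 : hom X W) (i2 : hom Y W) (p1 : hom W X) (p2 : hom W Y),
    is_biproduct i1 i2 p1 p2.

Definition retract_of X Y : Prop :=
  exists (i : hom X Y) (p : hom Y X), p \oc i = idc X.

Definition is_additive : Prop :=
  (exists Z, is_zero_obj Z) /\ (forall X Y, exists W, direct_sum X Y W).

Definition arrow_iso X Y X' Y' (f : hom X Y) (f' : hom X' Y') : Prop :=
  exists (a : hom X X') (b : hom Y Y'),
    [/\ is_iso a, is_iso b & b \oc f = f' \oc a].

(* In a biproduct W of X and Z, the injection i1 of X is the morphism
   id_X (+) 0 : X -> X (+) Z. *)
Definition weakly_idempotent_complete : Prop :=
  forall X Y (i : hom X Y) (p : hom Y X), p \oc i = idc X ->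
  exists Z W (i1 : hom X W) (i2 : hom Z W) (p1 : hom W X) (p2 : hom W Z),
    is_biproduct i1 i2 p1 p2 /\ arrow_iso i i1.

Definition wKar_class (P : C -> Prop) (Z : C) : Prop :=
  exists X Y, [/\ P X, P Y & exists2 W, direct_sum X Z W & isomorphic W Y].

Definition weakly_retraction_closed (P : C -> Prop) : Prop :=
  forall Z, wKar_class P Z <-> P Z.

End PrecatTheory.

Record addcat := Addcat {
  addcat_precat :> precat;
  addcatP : is_additive addcat_precat
}.

Record functor (C D : precat) := Functor {
  fobj :> C -> D;
  fmap : forall X Y : C, hom X Y -> hom (fobj X) (fobj Y);
  fmap1 : forall X, fmap (idc X) = idc (fobj X);
  fmapM : forall X Y Z (g : hom Y Z) (f : hom X Y),
    fmap (g \oc f) = fmap g \oc fmap f;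
  fmapD : forall X Y (f g : hom X Y), fmap (f + g) = fmap f + fmap g
}.
Arguments fmap {C D} F {X Y} f : rename.

Lemma fmap0 (C D : precat) (F : functor C D) (X Y : C) :
  fmap F (0 : hom X Y) = 0.
Proof. by apply: (addrI (fmap F 0)); rewrite -fmapD !addr0. Qed.

Lemma fmapN (C D : precat) (F : functor C D) (X Y : C) (f : hom X Y) :
  fmap F (- f) = - fmap F f.
Proof. by apply: (addrI (fmap F f)); rewrite -fmapD !subrr fmap0. Qed.

Definition functor_id (C : precat) : functor C C :=
  @Functor C C id (fun _ _ f => f) (fun _ => erefl)
    (fun _ _ _ _ _ => erefl) (fun _ _ _ _ => erefl).

Section FunctorComp.
Variables (A B C : precat) (G : functor B C) (F : functor A B).

Fact functor_comp1 (X : A) : fmap G (fmap F (idc X)) = idc (G (F X)).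
Proof. by rewrite !fmap1. Qed.

Fact functor_compM (X Y Z : A) (g : hom Y Z) (f : hom X Y) :
  fmap G (fmap F (g \oc f)) = fmap G (fmap F g) \oc fmap G (fmap F f).
Proof. by rewrite !fmapM. Qed.

Fact functor_compD (X Y : A) (f g : hom X Y) :
  fmap G (fmap F (f + g)) = fmap G (fmap F f) + fmap G (fmap F g).
Proof. by rewrite !fmapD. Qed.

Definition functor_comp : functor A C :=
  @Functor A C (fun X => G (F X)) (fun X Y f => fmap G (fmap F f))
    functor_comp1 functor_compM functor_compD.

End FunctorComp.
Notation "G \oF F" := (functor_comp G F) : ring_scope.

Section FunctorProperties.
Variables C D : precat.
Implicit Types F G : functor C D.

Definition nat_iso F G : Prop :=
  exists eta : forall X, hom (F X) (G X),
    (forall X, is_iso (eta X)) /\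
    (forall X Y (f : hom X Y), eta Y \oc fmap F f = fmap G f \oc eta X).

Definition fully_faithful F : Prop :=
  forall X Y : C, bijective (fun f : hom X Y => fmap F f).

(* F identifies C with a full subcategory of D (namely with the one on the
   class of objects [obj_image F]). *)
Definition full_embedding F : Prop := fully_faithful F /\ injective F.

Definition obj_image F (Y : D) : Prop := exists X : C, Y = F X.

End FunctorProperties.

Definition is_equivalence (C D : precat) (F : functor C D) : Prop :=
  exists G : functor D C,
    nat_iso (G \oF F) (functor_id C) /\ nat_iso (F \oF G) (functor_id D).

Definition equivalent (C D : precat) : Prop :=
  exists F : functor C D, is_equivalence F.

Definition full_sub (C : precat) (P : C -> Prop) : precat :=
  @Precat {X : C | P X} (fun X Y => hom (sval X) (sval Y))
    (fun X => idc (sval X)) (fun X Y Z g f => g \oc f)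
    (fun X Y f => comp1c f) (fun X Y f => compc1 f)
    (fun X Y Z T h g f => compA h g f)
    (fun X Y Z g g' f => compDl g g' f) (fun X Y Z g f f' => compDr g f f').

Definition corestrict (A C : precat) (P : C -> Prop) (F : functor A C)
    (PF : forall X, P (F X)) : functor A (full_sub P) :=
  @Functor A (full_sub P) (fun X => exist P (F X) (PF X))
    (fun X Y f => fmap F f) (fun X => fmap1 F X)
    (fun X Y Z g f => fmapM F g f) (fun X Y f g => fmapD F f g).

Section Kar.
Variable C : precat.

Record karObj := KarObj {
  kar_obj : C;
  kar_idem : hom kar_obj kar_obj;
  kar_idemP : kar_idem \oc kar_idem = kar_idem
}.

Section KarHom.
Variables X Y : karObj.

Definition kar_pred : {pred hom (kar_obj X) (kar_obj Y)} :=
  fun f => (kar_idem Y \oc f == f) && (f \oc kar_idem X == f).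

Fact kar_pred_zmod : zmod_closed kar_pred.
Proof.
split=> [|f g]; rewrite !unfold_in /kar_pred /=.
  by rewrite compc0 comp0c !eqxx.
move=> /andP[/eqP f1 /eqP f2] /andP[/eqP g1 /eqP g2].
by rewrite compBr compBl f1 f2 g1 g2 !eqxx.
Qed.
HB.instance Definition _ :=
  GRing.isZmodClosed.Build _ kar_pred kar_pred_zmod.

Record karHom := KarHom {
  kar_val :> hom (kar_obj X) (kar_obj Y);
  _ : kar_val \in kar_pred
}.
HB.instance Definition _ := [isSub for kar_val].
HB.instance Definition _ := [Choice of karHom by <:].
HB.instance Definition _ := [SubChoice_isSubZmodule of karHom by <:].

End KarHom.

Fact kar_idP (X : karObj) : kar_idem X \in @kar_pred X X.
Proof. by rewrite unfold_in /kar_pred kar_idemP !eqxx. Qed.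

Fact kar_compP (X Y Z : karObj) (g : karHom Y Z) (f : karHom X Y) :
  kar_val g \oc kar_val f \in @kar_pred X Z.
Proof.
have /andP[/eqP g1 _] := valP g; have /andP[_ /eqP f2] := valP f.
by rewrite unfold_in /kar_pred compA g1 -compA f2 !eqxx.
Qed.

Definition kar_id (X : karObj) : karHom X X := KarHom (kar_idP X).
Definition kar_comp (X Y Z : karObj) (g : karHom Y Z) (f : karHom X Y) :
  karHom X Z := KarHom (kar_compP g f).

Fact kar_comp1c X Y (f : karHom X Y) : kar_comp (kar_id Y) f = f.
Proof. by apply: val_inj; have /andP[/eqP] := valP f. Qed.

Fact kar_compc1 X Y (f : karHom X Y) : kar_comp f (kar_id X) = f.
Proof. by apply: val_inj; have /andP[_ /eqP] := valP f. Qed.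

Fact kar_compA X Y Z T (h : karHom Z T) (g : karHom Y Z) (f : karHom X Y) :
  kar_comp h (kar_comp g f) = kar_comp (kar_comp h g) f.
Proof. by apply: val_inj; rewrite /= compA. Qed.

Fact kar_compDl X Y Z (g g' : karHom Y Z) (f : karHom X Y) :
  kar_comp (g + g') f = kar_comp g f + kar_comp g' f.
Proof. by apply: val_inj; rewrite /= compDl. Qed.

Fact kar_compDr X Y Z (g : karHom Y Z) (f f' : karHom X Y) :
  kar_comp g (f + f') = kar_comp g f + kar_comp g f'.
Proof. by apply: val_inj; rewrite /= compDr. Qed.

Definition Kar : precat :=
  @Precat karObj (fun X Y => karHom X Y) kar_id kar_comp
    kar_comp1c kar_compc1 kar_compA kar_compDl kar_compDr.

Definition kar_embed_obj (X : C) : Kar := KarObj (comp1c (idc X)).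

Fact kar_embedP (X Y : C) (f : hom X Y) :
  f \in @kar_pred (kar_embed_obj X) (kar_embed_obj Y).
Proof. by rewrite unfold_in /kar_pred /= comp1c compc1 !eqxx. Qed.

Definition kar_embed_map (X Y : C) (f : hom X Y) :
  hom (kar_embed_obj X) (kar_embed_obj Y) := KarHom (kar_embedP f).

Fact kar_embed1 X : kar_embed_map (idc X) = idc (kar_embed_obj X).
Proof. exact: val_inj. Qed.

Fact kar_embedM X Y Z (g : hom Y Z) (f : hom X Y) :
  kar_embed_map (g \oc f) = kar_embed_map g \oc kar_embed_map f.
Proof. exact: val_inj. Qed.

Fact kar_embedD X Y (f g : hom X Y) :
  kar_embed_map (f + g) = kar_embed_map f + kar_embed_map g.
Proof. exact: val_inj. Qed.

Definition kar_embed : functor C Kar :=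
  Functor kar_embed1 kar_embedM kar_embedD.

End Kar.

Definition wKar (A : precat) : precat :=
  full_sub (wKar_class (obj_image (kar_embed A))).

Fact kar_embed_wKar (A : addcat) (X : A) :
  wKar_class (obj_image (kar_embed A)) (kar_embed A X).
Proof.
have [[Z [Z0 Z0']] _] := addcatP A.
exists (kar_embed A Z), (kar_embed A X); split; first by exists Z.
  by exists X.
exists (kar_embed A X); last first.
  by exists (idc _), (idc _); rewrite comp1c.
exists 0, (idc _), 0, (idc _); split; rewrite ?comp1c ?compc1 ?comp0c ?add0r //.
by apply: val_inj => /=; rewrite (Z0 _ (idc Z)).
Qed.

Definition wKar_embed (A : addcat) : functor A (wKar A) :=
  corestrict (@kar_embed_wKar A).

(* The shift is an autoequivalence with quasi-inverse [unshift].  The octahedral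
   axiom TR4 is in Verdier's form. *)
Record tricat := Tricat {
  tri_addcat :> addcat;
  shift : functor tri_addcat tri_addcat;
  unshift : functor tri_addcat tri_addcat;
  shiftK : nat_iso (unshift \oF shift) (functor_id tri_addcat);
  unshiftK : nat_iso (shift \oF unshift) (functor_id tri_addcat);
  dist : forall X Y Z : tri_addcat,
    hom X Y -> hom Y Z -> hom Z (shift X) -> Prop;
  dist_iso : forall (X Y Z X' Y' Z' : tri_addcat)
    (f : hom X Y) (g : hom Y Z) (h : hom Z (shift X))
    (f' : hom X' Y') (g' : hom Y' Z') (h' : hom Z' (shift X'))
    (a : hom X X') (b : hom Y Y') (c : hom Z Z'),
    is_iso a -> is_iso b -> is_iso c ->
    b \oc f = f' \oc a -> c \oc g = g' \oc b -> fmap shift a \oc h = h' \oc c ->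
    dist f g h -> dist f' g' h';
  dist_id : forall X Z : tri_addcat, is_zero_obj Z ->
    dist (idc X) (0 : hom X Z) (0 : hom Z (shift X));
  dist_cone : forall (X Y : tri_addcat) (f : hom X Y),
    exists Z (g : hom Y Z) (h : hom Z (shift X)), dist f g h;
  dist_rot : forall (X Y Z : tri_addcat)
    (f : hom X Y) (g : hom Y Z) (h : hom Z (shift X)),
    dist f g h <-> dist g h (- fmap shift f);
  dist_morph : forall (X Y Z X' Y' Z' : tri_addcat)
    (f : hom X Y) (g : hom Y Z) (h : hom Z (shift X))
    (f' : hom X' Y') (g' : hom Y' Z') (h' : hom Z' (shift X'))
    (a : hom X X') (b : hom Y Y'),
    dist f g h -> dist f' g' h' -> b \oc f = f' \oc a ->
    exists c : hom Z Z', c \oc g = g' \oc b /\ fmap shift a \oc h = h' \oc c;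
  dist_octa : forall (X Y Z X' Y' Z' : tri_addcat)
    (f : hom X Y) (f' : hom Y Z') (f'' : hom Z' (shift X))
    (g : hom Y Z) (g' : hom Z X') (g'' : hom X' (shift Y))
    (h' : hom Z Y') (h'' : hom Y' (shift X)),
    dist f f' f'' -> dist g g' g'' -> dist (g \oc f) h' h'' ->
    exists (u : hom Z' Y') (v : hom Y' X'),
      [/\ dist u v (fmap shift f' \oc g''),
          u \oc f' = h' \oc g, h'' \oc u = f'',
          v \oc h' = g' & g'' \oc v = fmap shift f \oc h'']
}.
Arguments shift {t}.
Arguments unshift {t}.
Arguments dist {t X Y Z} f g h.

(* M[i] *)
Definition shiftz (C : tricat) (i : int) (M : C) : C :=
  match i with
  | Posz n => iter n (shift : C -> C) M
  | Negz n => iter n.+1 (unshift : C -> C) M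
  end.

(* P[i], for a class of objects P; closing it under isomorphisms is needed since
   the shift is only an autoequivalence. *)
Definition shift_class (C : tricat) (P : C -> Prop) (i : int) (X : C) : Prop :=
  exists2 Y, P Y & isomorphic X (shiftz i Y).

Definition connective (C : tricat) (P : C -> Prop) : Prop :=
  forall X Y : C, P X -> P Y ->
  forall i : int, 0 < i -> forall f : hom X (shiftz i Y), f = 0.

(* Strictly full triangulated subcategories.  The shifts act both ways, so by
   rotation closure under cones gives closure under any third vertex. *)
Record is_tri_sub (C : tricat) (P : C -> Prop) : Prop := IsTriSub {
  tri_sub_iso : forall X Y : C, isomorphic X Y -> P X -> P Y;
  tri_sub_zero : exists2 Z : C, is_zero_obj Z & P Z;
  tri_sub_sum : forall X Y W : C, direct_sum X Y W -> P X -> P Y -> P W;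
  tri_sub_shift : forall X : C, P X -> P (shift X);
  tri_sub_unshift : forall X : C, P X -> P (unshift X);
  tri_sub_cone : forall (X Y Z : C)
    (f : hom X Y) (g : hom Y Z) (h : hom Z (shift X)),
    dist f g h -> P X -> P Y -> P Z
}.

Section TriSub.
Variables (C : tricat) (P : C -> Prop) (triP : is_tri_sub P).
Let D := full_sub P.

Fact full_sub_additive : is_additive D.
Proof.
split=> [|X Y].
  have [Z [Z0 Z0'] PZ] := tri_sub_zero triP.
  by exists (exist _ Z PZ); split=> X f; [apply: Z0 | apply: Z0'].
have [W sW] := (addcatP C).2 (sval X) (sval Y).
by exists (exist _ W (tri_sub_sum triP sW (svalP X) (svalP Y))).
Qed.

Definition sub_addcat : addcat := Addcat full_sub_additive.

Definition restrict_endo (F : functor C C) (PF : forall X, P X -> P (F X)) :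
    functor D D :=
  @Functor D D (fun X => exist P (F (sval X)) (PF _ (svalP X)))
    (fun X Y f => fmap F (f : hom (sval X) (sval Y)))
    (fun X => fmap1 F (sval X))
    (fun X Y Z g f => @fmapM _ _ F (sval X) (sval Y) (sval Z) g f)
    (fun X Y f g => @fmapD _ _ F (sval X) (sval Y) f g).

Definition sub_shift : functor sub_addcat sub_addcat :=
  restrict_endo (tri_sub_shift triP).
Definition sub_unshift : functor sub_addcat sub_addcat :=
  restrict_endo (tri_sub_unshift triP).

Fact sub_shiftK : nat_iso (sub_unshift \oF sub_shift) (functor_id sub_addcat).
Proof.
have [eta [iso_eta nat_eta]] := shiftK C.
exists (fun X => eta (sval X)); split=> [X | X Y f]; first exact: iso_eta.
exact: (nat_eta (sval X) (sval Y)).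
Qed.

Fact sub_unshiftK : nat_iso (sub_shift \oF sub_unshift) (functor_id sub_addcat).
Proof.
have [eta [iso_eta nat_eta]] := unshiftK C.
exists (fun X => eta (sval X)); split=> [X | X Y f]; first exact: iso_eta.
exact: (nat_eta (sval X) (sval Y)).
Qed.

Definition sub_dist (X Y Z : sub_addcat)
    (f : hom X Y) (g : hom Y Z) (h : hom Z (sub_shift X)) : Prop :=
  @dist C (sval X) (sval Y) (sval Z) f g h.

Fact sub_zero (Z : sub_addcat) : is_zero_obj Z -> is_zero_obj (sval Z).
Proof.
move=> [Z0 _]; have id0 : idc (sval Z) = 0 := Z0 Z (idc Z).
by split=> X f; [rewrite -[f]comp1c id0 comp0c | rewrite -[f]compc1 id0 compc0].
Qed.

Definition tri_sub : tricat.
Proof.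
refine (@Tricat sub_addcat sub_shift sub_unshift sub_shiftK sub_unshiftK
  sub_dist _ _ _ _ _ _).
- move=> X Y Z X' Y' Z' f g h f' g' h' a b c.
  exact: (@dist_iso C (sval X) (sval Y) (sval Z)
                      (sval X') (sval Y') (sval Z')).
- move=> X Z Z0; exact: (@dist_id C (sval X) (sval Z) (sub_zero Z0)).
- move=> X Y f.
  have [Z [g [h fgh]]] := @dist_cone C (sval X) (sval Y) f.
  exists (exist _ Z (tri_sub_cone triP fgh (svalP X) (svalP Y))).
  by exists g, h.
- move=> X Y Z f g h; exact: (@dist_rot C (sval X) (sval Y) (sval Z)).
- move=> X Y Z X' Y' Z' f g h f' g' h' a b.
  exact: (@dist_morph C (sval X) (sval Y) (sval Z)
                        (sval X') (sval Y') (sval Z')).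
- move=> X Y Z X' Y' Z' f f' f'' g g' g'' h' h''.
  exact: (@dist_octa C (sval X) (sval Y) (sval Z)
                       (sval X') (sval Y') (sval Z')).
Defined.

End TriSub.

Section StronglyGenerated.
Variables (C : tricat) (H : C -> Prop).

(* The intersection of all strictly full triangulated subcategories that
   contain H. *)
Definition strong_gen_class (X : C) : Prop :=
  forall P : C -> Prop, is_tri_sub P -> (forall Y, H Y -> P Y) -> P X.

Fact strong_gen_tri_sub : is_tri_sub strong_gen_class.
Proof.
split.
- move=> X Y XY gX P triP HP.
  by apply: (tri_sub_iso triP XY); apply: gX.
- have [Z Z0] := (addcatP C).1; exists Z => // P triP HP.
  have [T [T0 T0'] PT] := tri_sub_zero triP.
  apply: tri_sub_iso PT => //; exists 0, 0; split.
    by rewrite comp0c (T0 _ (idc T)).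
  by rewrite comp0c (Z0.1 _ (idc Z)).
- move=> X Y W sW gX gY P triP HP.
  by apply: (tri_sub_sum triP sW); [apply: gX | apply: gY].
- by move=> X gX P triP HP; apply: (tri_sub_shift triP); apply: gX.
- by move=> X gX P triP HP; apply: (tri_sub_unshift triP); apply: gX.
- move=> X Y Z f g h fgh gX gY P triP HP.
  by apply: (tri_sub_cone triP fgh); [apply: gX | apply: gY].
Qed.

Definition strongly_generated : tricat := tri_sub strong_gen_tri_sub.

Fact strong_gen_sub (X : C) : H X -> strong_gen_class X.
Proof. by move=> HX P _; apply. Qed.

End StronglyGenerated.

Fact strong_gen_image (A : precat) (C : tricat) (J : functor A C) (X : A) :
  strong_gen_class (obj_image J) (J X).
Proof. by apply: strong_gen_sub; exists X. Qed.

Definition strong_gen_embed (A : precat) (C : tricat) (J : functor A C) :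
    functor A (strongly_generated (obj_image J)) :=
  corestrict (@strong_gen_image A C J).

Record weight_classes (C : precat) := WeightClasses {
  w_le0 : C -> Prop;
  w_ge0 : C -> Prop
}.

Definition retract_closed (C : precat) (P : C -> Prop) : Prop :=
  forall X Y : C, retract_of X Y -> P Y -> P X.

Definition heart_class (C : precat) (w : weight_classes C) (X : C) : Prop :=
  w_le0 w X /\ w_ge0 w X.

Definition heart (C : precat) (w : weight_classes C) : precat :=
  full_sub (heart_class w).

Section WeightStructure.
Variables (C : tricat) (w : weight_classes C).

Record is_weight_structure : Prop := IsWeightStructure {
  le0_retract : retract_closed (w_le0 w);
  ge0_retract : retract_closed (w_ge0 w);
  le0_shift : forall X : C, w_le0 w X -> shift_class (w_le0 w) 1 X;
  ge0_shift : forall X : C, shift_class (w_ge0 w) 1 X -> w_ge0 w X;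
  w_orth : forall X Y : C, w_le0 w X -> shift_class (w_ge0 w) 1 Y ->
    forall f : hom X Y, f = 0;
  w_dec : forall M : C,
    exists (L R : C) (f : hom L M) (g : hom M R) (h : hom R (shift L)),
      [/\ dist f g h, w_le0 w L & shift_class (w_ge0 w) 1 R]
}.

Definition w_bounded : Prop :=
  (forall X : C, exists i : int, shift_class (w_ge0 w) i X) /\
  (forall X : C, exists i : int, shift_class (w_le0 w) i X).

End WeightStructure.

Section Complexes.
Variable B : precat.

Record complex := Complex {
  cx_obj :> int -> B;
  cx_d : forall n : int, hom (cx_obj n) (cx_obj (n + 1));
  cx_dd : forall n : int, cx_d (n + 1) \oc cx_d n = 0
}.

Section ChainMaps.
Variables X Y : complex.

Definition graded_hom := forall n : int, hom (X n) (Y n).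
HB.instance Definition _ := gen_eqMixin graded_hom.
HB.instance Definition _ := gen_choiceMixin graded_hom.

Definition graded_zero : graded_hom := fun=> 0.
Definition graded_opp (f : graded_hom) : graded_hom := fun n => - f n.
Definition graded_add (f g : graded_hom) : graded_hom := fun n => f n + g n.

Fact graded_addA : associative graded_add.
Proof. by move=> f g h; apply: functional_extensionality_dep => n; apply: addrA. Qed.
Fact graded_addC : commutative graded_add.
Proof. by move=> f g; apply: functional_extensionality_dep => n; apply: addrC. Qed.
Fact graded_add0 : left_id graded_zero graded_add.
Proof. by move=> f; apply: functional_extensionality_dep => n; apply: add0r. Qed.
Fact graded_addN : left_inverse graded_zero graded_opp graded_add.
Proof. by move=> f; apply: functional_extensionality_dep => n; apply: addNr. Qed.
HB.instance Definition _ := GRing.isZmodule.Build graded_hom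
  graded_addA graded_addC graded_add0 graded_addN.

Definition chain_pred : {pred graded_hom} :=
  fun f => `[< forall n, f (n + 1) \oc cx_d X n = cx_d Y n \oc f n >].

Fact chain_pred_zmod : zmod_closed chain_pred.
Proof.
split=> [|f g]; first by apply/asboolP => n; rewrite comp0c compc0.
move=> /asboolP fd /asboolP gd; apply/asboolP => n.
by rewrite compBl compBr fd gd.
Qed.
HB.instance Definition _ :=
  GRing.isZmodClosed.Build _ chain_pred chain_pred_zmod.

Record chain_map := ChainMap {
  chain_val :> graded_hom;
  _ : chain_val \in chain_pred
}.
HB.instance Definition _ := [isSub for chain_val].
HB.instance Definition _ := [Choice of chain_map by <:].
HB.instance Definition _ := [SubChoice_isSubZmodule of chain_map by <:].

Lemma chain_mapP (f : chain_map) n :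
  chain_val f (n + 1) \oc cx_d X n = cx_d Y n \oc chain_val f n.
Proof. by have /asboolP := valP f; apply. Qed.

(* A homotopy is indexed by its target degree: s n : X^{n+1} -> Y^n. *)
Definition null_homotopic : {pred chain_map} :=
  fun f => `[< exists s : forall n : int, hom (X (n + 1)) (Y n),
    forall n, chain_val f (n + 1) =
              cx_d Y n \oc s n + s (n + 1) \oc cx_d X (n + 1) >].

Fact null_homotopic_zmod : zmod_closed null_homotopic.
Proof.
split=> [|f g].
  apply/asboolP; exists (fun=> 0) => n.
  by rewrite comp0c compc0 addr0.
move=> /asboolP[s fs] /asboolP[t gt]; apply/asboolP.
exists (fun n => s n - t n) => n.
rewrite compBl compBr addrACA -opprD -fs -gt //.
Qed.
HB.instance Definition _ :=
  GRing.isZmodClosed.Build _ null_homotopic null_homotopic_zmod.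

Definition htpy_hom := {ideal_quot null_homotopic}.
HB.instance Definition _ := GRing.Zmodule.on htpy_hom.

Definition htpy_class (f : chain_map) : htpy_hom := \pi_htpy_hom f.

Lemma htpy_classP (f g : chain_map) :
  htpy_class f = htpy_class g <-> f - g \in null_homotopic.
Proof.
rewrite /htpy_class; split.
  by move=> fg; rewrite Quotient.idealrBE; apply/eqP.
by rewrite Quotient.idealrBE => /eqP.
Qed.

Lemma htpy_classD (f g : chain_map) :
  htpy_class (f + g) = htpy_class f + htpy_class g.
Proof. by rewrite /htpy_class raddfD. Qed.

Lemma htpy_reprK (f : htpy_hom) : htpy_class (repr f) = f.
Proof. exact: reprK. Qed.

End ChainMaps.

Section ChainComp.
Variables X Y Z : complex.

Fact chain_compP (g : chain_map Y Z) (f : chain_map X Y) :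
  (fun n => chain_val g n \oc chain_val f n) \in @chain_pred X Z.
Proof.
apply/asboolP => n /=.
by rewrite -compA chain_mapP [LHS]compA chain_mapP -compA.
Qed.

Definition chain_comp (g : chain_map Y Z) (f : chain_map X Y) :
  chain_map X Z := ChainMap (chain_compP g f).

Lemma chain_compDl (g g' : chain_map Y Z) (f : chain_map X Y) :
  chain_comp (g + g') f = chain_comp g f + chain_comp g' f.
Proof.
apply: val_inj; apply: functional_extensionality_dep => n /=.
by rewrite compDl.
Qed.

Lemma chain_compDr (g : chain_map Y Z) (f f' : chain_map X Y) :
  chain_comp g (f + f') = chain_comp g f + chain_comp g f'.
Proof.
apply: val_inj; apply: functional_extensionality_dep => n /=.
by rewrite compDr.
Qed.

Lemma chain_compBl (g g' : chain_map Y Z) (f : chain_map X Y) :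
  chain_comp (g - g') f = chain_comp g f - chain_comp g' f.
Proof.
apply: val_inj; apply: functional_extensionality_dep => n /=.
by rewrite compBl.
Qed.

Lemma chain_compBr (g : chain_map Y Z) (f f' : chain_map X Y) :
  chain_comp g (f - f') = chain_comp g f - chain_comp g f'.
Proof.
apply: val_inj; apply: functional_extensionality_dep => n /=.
by rewrite compBr.
Qed.

Lemma null_homotopic_compl (g : chain_map Y Z) (f : chain_map X Y) :
  f \in @null_homotopic X Y -> chain_comp g f \in @null_homotopic X Z.
Proof.
move=> /asboolP[s fs]; apply/asboolP.
exists (fun n => chain_val g n \oc s n) => n /=.
by rewrite fs compDr !compA chain_mapP.
Qed.

Lemma null_homotopic_compr (g : chain_map Y Z) (f : chain_map X Y) :
  g \in @null_homotopic Y Z -> chain_comp g f \in @null_homotopic X Z.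
Proof.
move=> /asboolP[s gs]; apply/asboolP.
exists (fun n => s n \oc chain_val f (n + 1)) => n /=.
by rewrite gs compDl -!compA -chain_mapP.
Qed.

Definition htpy_comp (g : htpy_hom Y Z) (f : htpy_hom X Y) : htpy_hom X Z :=
  htpy_class (chain_comp (repr g) (repr f)).

Lemma htpy_compE (g : chain_map Y Z) (f : chain_map X Y) :
  htpy_comp (htpy_class g) (htpy_class f) = htpy_class (chain_comp g f).
Proof.
apply/htpy_classP; set g' := repr _; set f' := repr _.
have gg' : g' - g \in @null_homotopic Y Z by apply/htpy_classP/htpy_reprK.
have ff' : f' - f \in @null_homotopic X Y by apply/htpy_classP/htpy_reprK.
rewrite -(subrK (chain_comp g' f) (chain_comp g' f')) -addrA.
rewrite -chain_compBr -chain_compBl rpredD //.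
  exact: null_homotopic_compl.
exact: null_homotopic_compr.
Qed.

End ChainComp.

Fact chain_idP (X : complex) : (fun n => idc (X n)) \in @chain_pred X X.
Proof. by apply/asboolP => n; rewrite comp1c compc1. Qed.

Definition chain_id (X : complex) : chain_map X X := ChainMap (chain_idP X).

Definition htpy_id (X : complex) : htpy_hom X X := htpy_class (chain_id X).

Fact htpy_comp1c X Y (f : htpy_hom X Y) : htpy_comp (htpy_id Y) f = f.
Proof.
rewrite -[f]htpy_reprK htpy_compE; congr htpy_class.
apply: val_inj; apply: functional_extensionality_dep => n.
exact: comp1c.
Qed.

Fact htpy_compc1 X Y (f : htpy_hom X Y) : htpy_comp f (htpy_id X) = f.
Proof.
rewrite -[f]htpy_reprK htpy_compE; congr htpy_class.
apply: val_inj; apply: functional_extensionality_dep => n.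
exact: compc1.
Qed.

Fact htpy_compA X Y Z T
    (h : htpy_hom Z T) (g : htpy_hom Y Z) (f : htpy_hom X Y) :
  htpy_comp h (htpy_comp g f) = htpy_comp (htpy_comp h g) f.
Proof.
rewrite -[h]htpy_reprK -[g]htpy_reprK -[f]htpy_reprK !htpy_compE.
congr htpy_class; apply: val_inj.
by apply: functional_extensionality_dep => n; apply: compA.
Qed.

Fact htpy_compDl X Y Z (g g' : htpy_hom Y Z) (f : htpy_hom X Y) :
  htpy_comp (g + g') f = htpy_comp g f + htpy_comp g' f.
Proof.
rewrite -[g]htpy_reprK -[g']htpy_reprK -[f]htpy_reprK.
by rewrite -htpy_classD !htpy_compE chain_compDl htpy_classD.
Qed.

Fact htpy_compDr X Y Z (g : htpy_hom Y Z) (f f' : htpy_hom X Y) :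
  htpy_comp g (f + f') = htpy_comp g f + htpy_comp g f'.
Proof.
rewrite -[g]htpy_reprK -[f]htpy_reprK -[f']htpy_reprK.
by rewrite -htpy_classD !htpy_compE chain_compDr htpy_classD.
Qed.

Definition K : precat :=
  @Precat complex (fun X Y => htpy_hom X Y) htpy_id htpy_comp
    htpy_comp1c htpy_compc1 htpy_compA htpy_compDl htpy_compDr.

Definition bounded_complex (X : K) : Prop :=
  exists a b : int, forall n, (n < a) || (b < n) -> is_zero_obj (cx_obj X n).

Definition Kb : precat := full_sub bounded_complex.

(* Complexes are cohomological, and homotopy equivalence of complexes is
   isomorphism in K.  The classes on Kb are the restrictions of those on K: the
   complex Y need not be bounded. *)
Definition wst : weight_classes K := {|
  w_le0 := fun X : K => exists2 Y : K, isomorphic X Y &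
    forall n, n < 0 -> is_zero_obj (cx_obj Y n);
  w_ge0 := fun X : K => exists2 Y : K, isomorphic X Y &
    forall n, 0 < n -> is_zero_obj (cx_obj Y n)
|}.

Definition wst_b : weight_classes Kb := {|
  w_le0 := fun X : Kb => w_le0 wst (sval X);
  w_ge0 := fun X : Kb => w_ge0 wst (sval X)
|}.

End Complexes.

(* Main.v *)
(* The implications out of (1) rest on one theorem: a connective additive
   subcategory H of a triangulated category D that it strongly generates is
   contained in the heart of a unique weight structure on D, whose heart is
   wKar_D(H).  Its two classes are the orthogonals of H[i], i > 0, and H[i],
   i < 0.  Writing P * Q for the extensions of Q by P, the octahedral axiom makes
   * associative, and Q * P is contained in P * Q as soon as Hom(P, Q[1]) = 0;
   so every object lies in H[-n] * ... * H[n], which yields the weight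
   decompositions.  For M in the heart the map from the lowest layer of such a
   filtration (or to the highest) vanishes, and the resulting splitting lets one
   shorten the filtration until M lies in H * H[1], that is, M (+) h1 = h0.

   To apply it to B one needs B connective in some triangulated category.  Instead
   of K^b(B) we use a category of complexes in which an object is a single object
   of B with a differential and a family of endomorphisms recording the grading.

   For K^b(B) itself, a bounded complex in the heart is contractible outside
   degree 0; weak idempotent completeness splits, one degree after the other, the
   idempotents given by the contraction.  Conversely the complement of a split
   monomorphism X -> Y between complexes is both the cone of X -> Y and the
   shifted cone of a retraction Y -> X, whence it stays in the heart. *)

From HB Require Import structures.
From mathcomp Require Import all_boot all_order all_algebra.
From mathcomp Require Import boolp zify.
Require Import Defs.

Set Implicit Arguments.
Unset Strict Implicit.
Unset Printing Implicit Defensive.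

Import Order.TTheory GRing.Theory Num.Theory.
Local Open Scope ring_scope.
Local Open Scope quotient_scope.

(** * Linear identities in abelian groups, by reflection *)

(** The existence statements ask for a triangulated category made from [B] alone, so one has to be
    built with all its axioms, and so does the test case by which the last statement implies the
    first. Over families indexed by integers the octahedron would have to be checked through casts
    between degrees such as [n + 1 - 1] and [n - 1 + 1]; with a single object and operators on it,
    each axiom is an identity between maps of [B], settled by rewriting and [zmod_eq]. Of this
    category only one thing matters: [B] embeds in it fully faithfully and connectively. A second
    obstacle is strictness: the embedding must be injective on objects and its image closed under
    isomorphism. This forces a passage to an equivalent category, along which the triangulated
    structure is carried. The heart of [K^b(B)] is handled without triangles, since its two classes
    mention only isomorphism in [K(B)]; homotopies are written out instead. Weak idempotent
    completeness does not split arbitrary idempotents. What it offers is that [id - e] splits once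
    [e] does, and every argument is arranged to need no more. *)

Inductive zexpr := ZZero | ZVar of nat | ZAdd of zexpr & zexpr | ZOpp of zexpr.

Section ZmodReflection.
Variable V : zmodType.
Implicit Types (env : seq V) (s t : seq int).

Fixpoint zeval env e : V :=
  match e with
  | ZZero => 0
  | ZVar n => nth 0 env n
  | ZAdd e1 e2 => zeval env e1 + zeval env e2
  | ZOpp e1 => - zeval env e1
  end.

Fixpoint zcoef_add s t : seq int :=
  match s, t with
  | [::], _ => t
  | _, [::] => s
  | a :: s', b :: t' => (a + b) :: zcoef_add s' t'
  end.

Fixpoint zcoef e : seq int :=
  match e with
  | ZZero => [::]
  | ZVar n => ncons n 0 [:: 1]
  | ZAdd e1 e2 => zcoef_add (zcoef e1) (zcoef e2)
  | ZOpp e1 => map -%R (zcoef e1)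
  end.

Fixpoint zlin env s : V :=
  match s with
  | [::] => 0
  | a :: s' => head 0 env *~ a + zlin (behead env) s'
  end.

Lemma zlin_add env s t : zlin env (zcoef_add s t) = zlin env s + zlin env t.
Proof.
elim: s t env => [|a s IHs] [|b t] env /=; rewrite ?add0r ?addr0 //.
by rewrite IHs mulrzDr addrACA.
Qed.

Lemma zlin_opp env s : zlin env (map -%R s) = - zlin env s.
Proof.
elim: s env => [|a s IHs] env /=; first by rewrite oppr0.
by rewrite IHs mulrNz opprD.
Qed.

Lemma zlin_var env n : zlin env (ncons n 0 [:: 1]) = nth 0 env n.
Proof.
elim: n env => [|n IHn] [|x env] //=.
- by rewrite mul0rz addr0.
- by rewrite mulr1z addr0.
- by rewrite IHn mulr0z add0r nth_nil.
by rewrite IHn mulr0z add0r.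
Qed.

Lemma zevalE env e : zeval env e = zlin env (zcoef e).
Proof.
elim: e env => [|n|e1 IH1 e2 IH2|e1 IH1] env //=.
- by rewrite zlin_var.
- by rewrite zlin_add IH1 IH2.
by rewrite zlin_opp IH1.
Qed.

Lemma zlin0 env s : all (eq_op 0) s -> zlin env s = 0.
Proof.
elim: s env => [|a s IHs] env //= /andP[/eqP<- /IHs->].
by rewrite mulr0z addr0.
Qed.

(** For reified expressions the hypothesis computes to [true], so [isT] proves it. *)
Lemma zmod_reflect env e1 e2 :
  all (eq_op 0) (zcoef (ZAdd e1 (ZOpp e2))) -> zeval env e1 = zeval env e2.
Proof.
by move=> /(@zlin0 env); rewrite -zevalE /= => /eqP; rewrite subr_eq0 => /eqP.
Qed.

End ZmodReflection.

(* Atoms are compared up to conversion: the same degree [n + 1] occurs with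
   different canonical instances. *)
Ltac zmod_index x env :=
  match env with
  | ?y :: _ => let _ := match constr:(tt) with _ => unify x y end in
               constr:(0%N)
  | _ :: ?env' => let n := zmod_index x env' in constr:(S n)
  end.

Ltac zmod_env env t :=
  lazymatch t with
  | (?a + ?b)%R => let env1 := zmod_env env a in zmod_env env1 b
  | (- ?a)%R => zmod_env env a
  | 0%R => env
  | ?x => match env with
          | _ => let _ := zmod_index x env in env
          | _ => constr:(x :: env)
          end
  end.

Ltac zmod_reify env t :=
  lazymatch t with
  | (?a + ?b)%R => let e1 := zmod_reify env a in
                   let e2 := zmod_reify env b in constr:(ZAdd e1 e2)
  | (- ?a)%R => let e1 := zmod_reify env a in constr:(ZOpp e1)
  | 0%R => constr:(ZZero)
  | ?x => let n := zmod_index x env in constr:(ZVar n)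
  end.

Ltac zmod_eq :=
  lazymatch goal with
  | |- @eq ?T ?a ?b =>
    let env0 := zmod_env (@nil T) a in
    let env := zmod_env env0 b in
    let e1 := zmod_reify env a in
    let e2 := zmod_reify env b in
    exact: (@zmod_reflect _ env e1 e2 isT)
  end.

(** * Isomorphisms, biproducts and equivalences *)

Section Precategory.
Variable C : precat.
Implicit Types X Y Z W : C.

(** Once [compA] has associated composites to the left, [g \oc f] is no longer a subterm of
    [h \oc g \oc f]; this form lets an equation on [g \oc f] act there. The variant [comp_eqlr]
    leaves [h] free, so that it can enter a tuple of rewrite rules. *)
Lemma comp_eql X Y Z W (h : hom Z W) (g : hom Y Z) (f : hom X Y) (k : hom X Z) :
  g \oc f = k -> h \oc g \oc f = h \oc k.
Proof. by move=> <-; rewrite compA. Qed.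

Lemma comp_eqlr X Y Z (g : hom Y Z) (f : hom X Y) (k : hom X Z) :
  g \oc f = k -> forall W (h : hom Z W), h \oc g \oc f = h \oc k.
Proof. by move=> e W h; apply: comp_eql. Qed.

Lemma is_iso_id X : is_iso (idc X).
Proof. by exists (idc X); rewrite comp1c. Qed.

Lemma is_iso_comp X Y Z (g : hom Y Z) (f : hom X Y) :
  is_iso g -> is_iso f -> is_iso (g \oc f).
Proof.
move=> [g' [g'g gg']] [f' [f'f ff']]; exists (f' \oc g'); split.
  by rewrite !compA (comp_eql _ g'g) compc1.
by rewrite !compA (comp_eql _ ff') compc1.
Qed.

Lemma is_iso_of_LR X Y (f : hom X Y) (g g' : hom Y X) :
  g \oc f = idc X -> f \oc g' = idc Y -> is_iso f.
Proof.
move=> gf fg'; exists g; split=> //.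
suff -> : g = g' by [].
by rewrite -[g]compc1 -fg' compA gf comp1c.
Qed.

Lemma isomorphic_refl X : isomorphic X X.
Proof. by exists (idc X); apply: is_iso_id. Qed.

Lemma isomorphic_sym X Y : isomorphic X Y -> isomorphic Y X.
Proof. by move=> [f [g [gf fg]]]; exists g, f. Qed.

Lemma isomorphic_trans Y X Z :
  isomorphic X Y -> isomorphic Y Z -> isomorphic X Z.
Proof. by move=> [f fi] [g gi]; exists (g \oc f); apply: is_iso_comp. Qed.

Lemma zero_objP Z : is_zero_obj Z <-> idc Z = 0.
Proof.
split=> [[Z0 _] | Z0]; first exact: Z0.
by split=> X f; [rewrite -[f]comp1c Z0 comp0c | rewrite -[f]compc1 Z0 compc0].
Qed.

Lemma zero_obj_retract X Z (i : hom X Z) (p : hom Z X) :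
  p \oc i = idc X -> is_zero_obj Z -> is_zero_obj X.
Proof. by move=> pi [Z0 _]; apply/zero_objP; rewrite -pi (Z0 _ i) compc0. Qed.

Lemma zero_obj_split0 X W (i : hom W X) (p : hom X W) :
  p \oc i = idc W -> i \oc p = 0 -> is_zero_obj W.
Proof.
move=> pi ip; apply/zero_objP.
by rewrite -[idc W]comp1c -pi compA -(compA p) ip compc0 comp0c.
Qed.

Lemma zero_obj_isomorphic X Y :
  is_zero_obj X -> is_zero_obj Y -> isomorphic X Y.
Proof.
move=> /zero_objP X0 /zero_objP Y0; exists 0, 0.
by rewrite !comp0c X0 Y0.
Qed.

(** [Z] and [Z'] are both cokernels of [i], so the retractions [r] and [r'] may differ. *)
Lemma is_biproduct_unique X Z Z' Y (i : hom X Y)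
    (j : hom Z Y) (r : hom Y X) (q : hom Y Z)
    (j' : hom Z' Y) (r' : hom Y X) (q' : hom Y Z') :
  is_biproduct i j r q -> is_biproduct i j' r' q' -> isomorphic Z Z'.
Proof.
move=> [ri qj rj qi eY] [ri' qj' rj' qi' eY'].
have e : i \oc r = idc Y - j \oc q by rewrite -eY addrK.
have e' : j' \oc q' = idc Y - i \oc r' by rewrite -eY' addrC addKr.
exists (q' \oc j), (q \oc j'); split.
  rewrite !compA (comp_eql _ e') compBr compBl compc1 qj.
  by rewrite (compA q) qi !comp0c subr0.
have {}e : j \oc q = idc Y - i \oc r by rewrite -eY addrC addKr.
rewrite !compA (comp_eql _ e) compBr compBl compc1 qj'.
by rewrite (compA q') qi' !comp0c subr0.
Qed.

(** The cokernel [q] depends on [i] alone. Only the section [j] must be corrected, by its component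
    along [i], to land in the kernel of the new retraction. *)
Lemma is_biproduct_retraction X Z Y (i : hom X Y)
    (j : hom Z Y) (r : hom Y X) (q : hom Y Z) (p : hom Y X) :
  is_biproduct i j r q -> p \oc i = idc X ->
  is_biproduct i (j - i \oc p \oc j) p q.
Proof.
move=> [ri qj rj qi eY] pi; split=> //.
- by rewrite compBr qj !compA qi !comp0c subr0.
- by rewrite compBr !compA pi comp1c subrr.
have e : j \oc q = idc Y - i \oc r by rewrite -eY addrC addKr.
rewrite compBl -[_ \oc j \oc q]compA e !compBr !compc1 !compA (comp_eql _ pi).
rewrite compc1; zmod_eq.
Qed.

Lemma is_biproduct_iso X Z Y Y' (i : hom X Y) (j : hom Z Y)
    (r : hom Y X) (q : hom Y Z) (b : hom Y Y') (b' : hom Y' Y) :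
  is_biproduct i j r q -> b' \oc b = idc Y -> b \oc b' = idc Y' ->
  is_biproduct (b \oc i) (b \oc j) (r \oc b') (q \oc b').
Proof.
move=> [ri qj rj qi eY] b'b bb'.
split; rewrite !compA ?(comp_eql _ b'b) ?compc1 //.
by rewrite -bb' -[b in RHS]compc1 -eY compDr compDl !compA.
Qed.

Lemma is_biproduct_iso1 X X' Z Y (i : hom X Y) (j : hom Z Y)
    (r : hom Y X) (q : hom Y Z) (b : hom X X') (b' : hom X' X) :
  is_biproduct i j r q -> b' \oc b = idc X -> b \oc b' = idc X' ->
  is_biproduct (i \oc b') j (b \oc r) q.
Proof.
move=> [ri qj rj qi eY] b'b bb'; split=> //.
- by rewrite !compA (comp_eql _ ri) compc1.
- by rewrite -compA rj compc0.
- by rewrite compA qi comp0c.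
by rewrite !compA (comp_eql _ b'b) compc1.
Qed.

Lemma is_biproductC X Z Y (i : hom X Y) (j : hom Z Y)
    (r : hom Y X) (q : hom Y Z) :
  is_biproduct i j r q -> is_biproduct j i q r.
Proof. by move=> [ri qj rj qi eY]; split=> //; rewrite addrC. Qed.

Lemma direct_sum_iso X Y W W' :
  direct_sum X Y W -> isomorphic W W' -> direct_sum X Y W'.
Proof.
move=> [i [j [r [q bp]]]] [b [b' [b'b bb']]].
by exists (b \oc i), (b \oc j), (r \oc b'), (q \oc b'); apply: is_biproduct_iso.
Qed.

Lemma direct_sum_iso1 X X' Y W :
  direct_sum X Y W -> isomorphic X X' -> direct_sum X' Y W.
Proof.
move=> [i [j [r [q bp]]]] [b [b' [b'b bb']]].
by exists (i \oc b'), j, (b \oc r), q; apply: is_biproduct_iso1.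
Qed.

Lemma direct_sumC X Y W : direct_sum X Y W -> direct_sum Y X W.
Proof.
by move=> [i [j [r [q /is_biproductC bp]]]]; exists j, i, q, r.
Qed.

Lemma wKar_classP (P : C -> Prop) Z :
  wKar_class P Z <-> exists X Y, [/\ P X, P Y & direct_sum X Z Y].
Proof.
split=> [[X [Y [PX PY [W s WY]]]] | [X [Y [PX PY s]]]].
  by exists X, Y; split=> //; apply: direct_sum_iso WY.
by exists X, Y; split=> //; exists Y => //; apply: isomorphic_refl.
Qed.

(** The definition gives a biproduct only up to isomorphism of arrows and with its own retraction.
    Transport along the isomorphisms and [is_biproduct_retraction] bring back the given [i] and
    [p]. *)
Lemma wicP : weakly_idempotent_complete C <->
  (forall X Y (i : hom X Y) (p : hom Y X), p \oc i = idc X ->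
   exists Z (j : hom Z Y) (q : hom Y Z), is_biproduct i j p q).
Proof.
split=> wic X Y i p pi; last first.
  have [Z [j [q bp]]] := wic X Y i p pi.
  exists Z, Y, i, j, p, q; split=> //.
  by exists (idc X), (idc Y); rewrite comp1c compc1; split=> //; apply: is_iso_id.
have [Z [W [i1 [i2 [p1 [p2 [bp [a [b [[a' [a'a aa']] [b' [b'b bb']] e]]]]]]]]]] :=
  wic X Y i p pi.
have bp' := is_biproduct_iso (is_biproduct_iso1 bp aa' a'a) bb' b'b.
have e' : b' \oc (i1 \oc a) = i by rewrite -e compA b'b comp1c.
rewrite e' in bp'.
by exists Z; do 2 eexists; apply: is_biproduct_retraction bp' pi.
Qed.

Definition idem_splits X (e : hom X X) : Prop :=
  exists W (i : hom W X) (p : hom X W), p \oc i = idc W /\ i \oc p = e.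

(** A splitting of [e] includes a split monomorphism [i], whose complement is the image of
    [idc X - e]. *)
Lemma idem_splits_compl X (e : hom X X) :
  weakly_idempotent_complete C -> idem_splits e -> idem_splits (idc X - e).
Proof.
move=> /wicP wic [W [i [p [pi ip]]]].
have [Z [j [q [_ qj _ _ eX]]]] := wic _ _ i p pi.
by exists Z, j, q; rewrite -eX -ip addrC addKr.
Qed.

(** The maps [b] and [a] identify the images of [a \oc b] and [b \oc a]. In a contracted complex
    this moves a splitting from one degree to the next. *)
Lemma idem_splits_swap X Y (a : hom X Y) (b : hom Y X) :
  idem_splits (a \oc b) -> b \oc a \oc b \oc a = b \oc a ->
  idem_splits (b \oc a).
Proof.
move=> [W [i [p [pi ip]]]] ba; exists W, (b \oc i), (p \oc a); split.
  rewrite !compA -(compA p) -ip compA (comp_eql _ pi) compc1.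
  exact: pi.
by rewrite !compA -(compA b) ip !compA.
Qed.

Lemma idem_splits0 X : is_additive C -> idem_splits (0 : hom X X).
Proof.
move=> [[Z /zero_objP Z0] _]; exists Z, 0, 0.
by rewrite compc0 comp0c Z0.
Qed.

End Precategory.

Section Functors.
Variables C D : precat.
Variable F : functor C D.

Definition faithful : Prop := forall X Y : C, injective (fmap F : hom X Y -> _).
Definition full : Prop :=
  forall (X Y : C) (g : hom (F X) (F Y)), exists f : hom X Y, fmap F f = g.
Definition essentially_surjective : Prop :=
  forall Y : D, exists X : C, isomorphic (F X) Y.

Lemma fmapB (X Y : C) (f g : hom X Y) : fmap F (f - g) = fmap F f - fmap F g.
Proof. by rewrite fmapD fmapN. Qed.

Lemma fully_faithfulP : fully_faithful F <-> faithful /\ full.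
Proof.
split=> [ff | [fa fu] X Y].
  split=> X Y; have [g gK Kg] := ff X Y; first exact: (can_inj gK).
  by move=> h; exists (g h); apply: Kg.
exists (fun g => projT1 (cid (fu X Y g))) => [f|g]; last first.
  exact: projT2 (cid (fu X Y g)).
by apply: fa; exact: projT2 (cid (fu X Y (fmap F f))).
Qed.

Lemma fmap_iso (X Y : C) (f : hom X Y) : is_iso f -> is_iso (fmap F f).
Proof.
by move=> [g [gf fg]]; exists (fmap F g); rewrite -!fmapM gf fg !fmap1.
Qed.

Lemma fmap_isomorphic (X Y : C) : isomorphic X Y -> isomorphic (F X) (F Y).
Proof. by move=> [f fi]; exists (fmap F f); apply: fmap_iso. Qed.

Lemma fmap_zero_obj (Z : C) : is_zero_obj Z -> is_zero_obj (F Z).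
Proof.
by move=> /zero_objP Z0; apply/zero_objP; rewrite -fmap1 Z0 fmap0.
Qed.

Lemma fmap_biproduct (X Z Y : C) (i : hom X Y) (j : hom Z Y)
    (r : hom Y X) (q : hom Y Z) : is_biproduct i j r q ->
  is_biproduct (fmap F i) (fmap F j) (fmap F r) (fmap F q).
Proof.
move=> [ri qj rj qi eY].
by split; rewrite -!fmapM -?fmapD ?(ri, qj, rj, qi, eY) ?fmap1 ?fmap0.
Qed.

Lemma fmap_direct_sum (X Y W : C) :
  direct_sum X Y W -> direct_sum (F X) (F Y) (F W).
Proof.
move=> [i [j [r [q bp]]]].
by exists (fmap F i), (fmap F j), (fmap F r), (fmap F q); apply: fmap_biproduct.
Qed.

Lemma ff_iso_reflect (X Y : C) (f : hom X Y) :
  faithful -> full -> is_iso (fmap F f) -> is_iso f.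
Proof.
move=> fa fu [g [gf fg]]; have [h hg] := fu _ _ g.
by exists h; split; apply: fa; rewrite fmapM hg ?gf ?fg fmap1.
Qed.

Lemma ff_isomorphic_reflect (X Y : C) :
  faithful -> full -> isomorphic (F X) (F Y) -> isomorphic X Y.
Proof.
move=> fa fu [f fi]; have [g gf] := fu _ _ f.
by exists g; apply: ff_iso_reflect => //; rewrite gf.
Qed.

Lemma is_equivalenceP :
  is_equivalence F <-> [/\ faithful, full & essentially_surjective].
Proof.
split=> [[G [[eta [eta_i eta_n]] [eps [eps_i eps_n]]]] | [fa fu es]].
  have fa : faithful.
    move=> X Y f g fg.
    have [eX' [eXK KeX]] := eta_i X.
    rewrite -[f]compc1 -[g]compc1 -KeX !compA.
    have /= := eta_n _ _ f; have /= := eta_n _ _ g.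
    by rewrite fg => <- <-.
  have faG (X Y : D) : injective (fmap G : hom X Y -> _).
    move=> f g fg.
    have [eX' [eXK KeX]] := eps_i X.
    rewrite -[f]compc1 -[g]compc1 -KeX !compA.
    have /= := eps_n _ _ f; have /= := eps_n _ _ g.
    by rewrite fg => <- <-.
  split=> [// | X Y g | Y]; last by exists (G Y), (eps Y); apply: eps_i.
  have [a [aX Xa]] := eta_i X; have [b [bY Yb]] := eta_i Y.
  (* After [G] is applied, the equation is the naturality of [eta] at this candidate, with [eta Y]
     cancelled. *)
  exists (eta Y \oc fmap G g \oc a); apply: faG.
  have /= e := eta_n _ _ (eta Y \oc fmap G g \oc a).
  have {}e := congr1 (comp b) e; move: e.
  by rewrite !compA bY !comp1c -[_ \oc eta X]compA aX compc1.
pose G Y := projT1 (cid (es Y)).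
pose eps Y : hom (F (G Y)) Y := projT1 (cid (projT2 (cid (es Y)))).
have eps_iso Y : is_iso (eps Y) := projT2 (cid (projT2 (cid (es Y)))).
pose eps' Y := projT1 (cid (eps_iso Y)).
have epsK Y : eps' Y \oc eps Y = idc _ := (projT2 (cid (eps_iso Y))).1.
have Keps Y : eps Y \oc eps' Y = idc _ := (projT2 (cid (eps_iso Y))).2.
pose Gm X Y (f : hom X Y) : hom (G X) (G Y) :=
  projT1 (cid (fu _ _ (eps' Y \oc f \oc eps X))).
have GmE X Y (f : hom X Y) : fmap F (Gm _ _ f) = eps' Y \oc f \oc eps X.
  exact: projT2 (cid (fu _ _ (eps' Y \oc f \oc eps X))).
have Gm1 X : Gm _ _ (idc X) = idc (G X).
  by apply: fa; rewrite GmE compc1 epsK fmap1.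
have GmM X Y Z (g : hom Y Z) (f : hom X Y) :
    Gm _ _ (g \oc f) = Gm _ _ g \oc Gm _ _ f.
  by apply: fa; rewrite fmapM !GmE !compA (comp_eql _ (Keps _)) compc1.
have GmD X Y (f g : hom X Y) : Gm _ _ (f + g) = Gm _ _ f + Gm _ _ g.
  by apply: fa; rewrite fmapD !GmE compDr compDl.
exists (Functor Gm1 GmM GmD); split; last first.
  exists eps; split=> // X Y f /=.
  by rewrite GmE !compA Keps comp1c.
pose eta X : hom (G (F X)) X := projT1 (cid (fu _ _ (eps (F X)))).
have etaE X : fmap F (eta X) = eps (F X) := projT2 (cid (fu _ _ (eps (F X)))).
exists eta; split=> [X | X Y f /=].
  by apply: ff_iso_reflect => //; rewrite etaE; apply: eps_iso.
by apply: fa; rewrite !fmapM !etaE GmE !compA Keps comp1c.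
Qed.

End Functors.

Lemma wic_equivalent (C D : precat) :
  equivalent C D -> weakly_idempotent_complete D -> weakly_idempotent_complete C.
Proof.
move=> [F /is_equivalenceP[fa fu es]] /wicP wic; apply/wicP => X Y i p pi.
have [|Z' [j' [q' bp]]] := wic _ _ (fmap F i) (fmap F p).
  by rewrite -fmapM pi fmap1.
have [Z [b' [b [bb' b'b]]]] := es Z'.
have [r' q'j rj q'i eY] := is_biproductC (is_biproduct_iso1 (is_biproductC bp) b'b bb').
have [j jE] := fu _ _ (j' \oc b'); have [q qE] := fu _ _ (b \oc q').
exists Z, j, q; split=> //; apply: fa.
- by rewrite fmapM jE qE fmap1.
- by rewrite fmapM jE fmap0.
- by rewrite fmapM qE fmap0.
by rewrite fmapD !fmapM jE qE fmap1.
Qed.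

Lemma functor_comp_faithful (A B C : precat) (G : functor B C) (F : functor A B) :
  faithful G -> faithful F -> faithful (G \oF F).
Proof. by move=> fG fF X Y f g /= /fG /fF. Qed.

Lemma functor_comp_full (A B C : precat) (G : functor B C) (F : functor A B) :
  full G -> full F -> full (G \oF F).
Proof.
move=> fG fF X Y h; have [g <-] := fG _ _ h; have [f <-] := fF _ _ g.
by exists f.
Qed.

Lemma nat_iso_comp (A B C : precat) (G : functor B C) (F F' : functor A B) :
  nat_iso F F' -> nat_iso (G \oF F) (G \oF F').
Proof.
move=> [eta [eta_i eta_n]]; exists (fun X => fmap G (eta X)); split=> [X | X Y f].
  by apply: (@fmap_iso _ _ G); apply: eta_i.
by rewrite /= -!fmapM eta_n.
Qed.

Lemma nat_iso_trans (A B : precat) (G F H : functor A B) :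
  nat_iso F G -> nat_iso G H -> nat_iso F H.
Proof.
move=> [a [ai an]] [b [bi bn]]; exists (fun X => b X \oc a X).
split=> [X | X Y f]; first exact: is_iso_comp.
by rewrite -compA an !compA bn.
Qed.

Lemma nat_iso_isomorphic (A B : precat) (F G : functor A B) (X : A) :
  nat_iso F G -> isomorphic (F X) (G X).
Proof. by move=> [a [ai _]]; exists (a X). Qed.

(** * Triangulated categories *)

Section FiveLemma.
Variables (T : precat) (S : functor T T).
Variable tri : forall X Y Z : T, hom X Y -> hom Y Z -> hom Z (S X) -> Prop.
Hypothesis tri_morph : forall (X Y Z X' Y' Z' : T)
    (f : hom X Y) (g : hom Y Z) (h : hom Z (S X))
    (f' : hom X' Y') (g' : hom Y' Z') (h' : hom Z' (S X'))
    (a : hom X X') (b : hom Y Y'),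
  tri f g h -> tri f' g' h' -> b \oc f = f' \oc a ->
  exists c : hom Z Z', c \oc g = g' \oc b /\ fmap S a \oc h = h' \oc c.
Hypothesis tri_colift : forall (X Y Z W : T)
    (f : hom X Y) (g : hom Y Z) (h : hom Z (S X)) (u : hom Z W),
  tri f g h -> u \oc g = 0 -> exists v, v \oc h = u.

(* If [t = c - id] kills [g] and is killed by [h], then [t] factors through [h],
   so [t^2 = 0]. *)
Lemma tri_endo_iso (X Y Z : T) (f : hom X Y) (g : hom Y Z) (h : hom Z (S X))
    (c : hom Z Z) :
  tri f g h -> c \oc g = g -> h \oc c = h -> is_iso c.
Proof.
move=> fgh cg hc; pose t := c - idc Z.
have [v vh] : exists v, v \oc h = t.
  by apply: tri_colift fgh _; rewrite compBl cg comp1c subrr.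
have tt : t \oc t = 0.
  by rewrite -{1}vh -compA compBr hc compc1 subrr compc0.
have -> : c = idc Z + t by rewrite addrC subrK.
clearbody t.
exists (idc Z - t); rewrite !compDl !compDr !compNl !compNr tt.
by rewrite !comp1c !compc1; split; zmod_eq.
Qed.

(** The induced maps [c] and [c'] need not be inverse to each other, but both composites fix the
    neighbouring maps and are isomorphisms by [tri_endo_iso]. The triangles are kept abstract
    because the lemma also serves [gk_dist] before the axioms of a triangulated category are
    available for it. *)
Lemma tri_iso3 (X Y Z X' Y' Z' : T)
    (f : hom X Y) (g : hom Y Z) (h : hom Z (S X))
    (f' : hom X' Y') (g' : hom Y' Z') (h' : hom Z' (S X'))
    (a : hom X X') (b : hom Y Y') :
  tri f g h -> tri f' g' h' -> is_iso a -> is_iso b -> b \oc f = f' \oc a ->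
  exists c : hom Z Z',
    [/\ is_iso c, c \oc g = g' \oc b & fmap S a \oc h = h' \oc c].
Proof.
move=> d d' [a' [a'a aa']] [b' [b'b bb']] e.
have [c [cg hc]] := tri_morph d d' e.
have e' : b' \oc f' = f \oc a'.
  rewrite -[f']compc1 -aa' !compA -[b' \oc f' \oc a]compA -e !compA b'b.
  by rewrite comp1c.
have [c' [cg' hc']] := tri_morph d' d e'.
exists c; split=> //.
have [k [k1 k2]] : is_iso (c' \oc c).
  apply: tri_endo_iso d _ _.
    by rewrite -compA cg compA cg' -compA b'b compc1.
  by rewrite compA -hc' -compA -hc compA -fmapM a'a fmap1 comp1c.
have [l [l1 l2]] : is_iso (c \oc c').
  apply: tri_endo_iso d' _ _.
    by rewrite -compA cg' compA cg -compA bb' compc1.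
  by rewrite compA -hc -compA -hc' compA -fmapM aa' fmap1 comp1c.
by apply: (@is_iso_of_LR _ _ _ _ (k \oc c') (c' \oc l)); rewrite -?compA // compA.
Qed.

End FiveLemma.

Section Triangulated.
Variable C : tricat.
Implicit Types X Y Z W M N : C.

Lemma shift_equivalence : is_equivalence (@shift C).
Proof. by exists unshift; split; [apply: shiftK | apply: unshiftK]. Qed.

Lemma shift_faithful : faithful (@shift C).
Proof. by have /is_equivalenceP[] := shift_equivalence. Qed.

Lemma shift_full : full (@shift C).
Proof. by have /is_equivalenceP[] := shift_equivalence. Qed.

Lemma unshift_equivalence : is_equivalence (@unshift C).
Proof. by exists shift; split; [apply: unshiftK | apply: shiftK]. Qed.

Lemma unshift_faithful : faithful (@unshift C).
Proof. by have /is_equivalenceP[] := unshift_equivalence. Qed.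

Lemma shift_unshift_iso X : isomorphic (shift (unshift X)) X.
Proof. exact: (nat_iso_isomorphic X (unshiftK C)). Qed.

Lemma unshift_shift_iso X : isomorphic (unshift (shift X)) X.
Proof. exact: (nat_iso_isomorphic X (shiftK C)). Qed.

Lemma zero_obj_exists : exists Z : C, is_zero_obj Z.
Proof. exact: (addcatP C).1. Qed.

Section Triangle.
Variables (X Y Z : C) (f : hom X Y) (g : hom Y Z) (h : hom Z (shift X)).
Hypothesis fgh : dist f g h.

Lemma dist_rot1 : dist g h (- fmap shift f).
Proof. exact: (dist_rot f g h).1 fgh. Qed.

Lemma dist_comp0 : g \oc f = 0.
Proof.
have [O O0] := zero_obj_exists.
have [|c [<- _]] := dist_morph (a := idc X) (b := f) (dist_id X O0) fgh _.
  by [].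
by rewrite compc0.
Qed.

(** The morphism axiom produces only the third component. Applied to the rotated triangle [W -> 0 ->
    W[1]] it yields the lift after one shift, which full faithfulness removes. *)
Lemma dist_lift W (u : hom W Y) : g \oc u = 0 -> exists v, f \oc v = u.
Proof.
move=> gu; have [O O0] := zero_obj_exists.
have /dist_rot d := dist_id W O0.
have [|c [_ e]] := dist_morph (a := u) (b := 0) d dist_rot1 _.
  by rewrite gu comp0c.
have [v vE] := shift_full c; exists v; apply: shift_faithful.
move: e; rewrite fmap1 compNr compc1 compNl => /oppr_inj ->.
by rewrite fmapM vE.
Qed.

Lemma dist_colift W (u : hom Y W) : u \oc f = 0 -> exists v, v \oc g = u.
Proof.
move=> uf; have [O O0] := zero_obj_exists.
have d : dist (0 : hom O W) (idc W) 0.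
  apply/dist_rot; rewrite fmap0 oppr0.
  by apply: dist_id; apply: fmap_zero_obj.
have [|c [e _]] := dist_morph (a := 0) (b := u) fgh d _.
  by rewrite uf compc0.
by exists c; rewrite e comp1c.
Qed.

End Triangle.

Lemma dist_rot2 X Y Z (f : hom X Y) (g : hom Y Z) (h : hom Z (shift X)) :
  dist f g h -> dist h (- fmap shift f) (- fmap shift g).
Proof. by move=> /dist_rot1/dist_rot1. Qed.

Lemma dist_zero_left Z W : is_zero_obj Z -> dist (0 : hom Z W) (idc W) 0.
Proof.
move=> Z0; apply/dist_rot; rewrite fmap0 oppr0.
by apply: dist_id; apply: fmap_zero_obj.
Qed.

Lemma dist_iso3 X Y Z X' Y' Z'
    (f : hom X Y) (g : hom Y Z) (h : hom Z (shift X))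
    (f' : hom X' Y') (g' : hom Y' Z') (h' : hom Z' (shift X'))
    (a : hom X X') (b : hom Y Y') :
  dist f g h -> dist f' g' h' -> is_iso a -> is_iso b -> b \oc f = f' \oc a ->
  exists c : hom Z Z',
    [/\ is_iso c, c \oc g = g' \oc b & fmap shift a \oc h = h' \oc c].
Proof.
apply: tri_iso3; first exact: dist_morph.
by move=> X0 Y0 Z0 W f0 g0 h0 u d; apply: (dist_colift (dist_rot1 d)).
Qed.

Lemma dist_cone_unique X Y Z X' Y' Z'
    (f : hom X Y) (g : hom Y Z) (h : hom Z (shift X))
    (f' : hom X' Y') (g' : hom Y' Z') (h' : hom Z' (shift X'))
    (a : hom X X') (b : hom Y Y') :
  dist f g h -> dist f' g' h' -> is_iso a -> is_iso b -> b \oc f = f' \oc a ->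
  isomorphic Z Z'.
Proof. by move=> d d' ai bi /(dist_iso3 d d' ai bi)[c []]; exists c. Qed.

Lemma dist_isoE X Y Z X' Y' Z'
    (f : hom X Y) (g : hom Y Z) (h : hom Z (shift X))
    (a : hom X' X) (b : hom Y' Y) (c : hom Z' Z) (a' : hom X X')
    (b' : hom Y Y') (c' : hom Z Z') :
  a \oc a' = idc X -> a' \oc a = idc X' ->
  b \oc b' = idc Y -> b' \oc b = idc Y' ->
  c \oc c' = idc Z -> c' \oc c = idc Z' ->
  dist f g h ->
  dist (b' \oc f \oc a) (c' \oc g \oc b) (fmap shift a' \oc h \oc c).
Proof.
move=> aa' a'a bb' b'b cc' c'c; apply: (dist_iso (a := a') (b := b') (c := c')).
- by exists a.
- by exists b.
- by exists c.
- by rewrite (comp_eql _ aa') compc1.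
- by rewrite (comp_eql _ bb') compc1.
by rewrite (comp_eql _ cc') compc1.
Qed.

Lemma dist_negl X Y Z (f : hom X Y) (g : hom Y Z) (h : hom Z (shift X)) :
  dist f g h -> dist (- f) (- g) h.
Proof.
move=> d; have NN W : (- idc W) \oc (- idc W) = idc W.
  by rewrite compNl compNr compc1 opprK.
have := dist_isoE (comp1c _) (comp1c _) (NN Y) (NN Y) (comp1c _) (comp1c _) d.
by rewrite fmap1 !comp1c !compc1 compNl comp1c compNr compc1.
Qed.

(** Three rotations put a sign on each of the three maps; [- idc] on the middle vertex removes two
    of them, and one has to stay. *)
Lemma dist_shift X Y Z (f : hom X Y) (g : hom Y Z) (h : hom Z (shift X)) :
  dist f g h <-> dist (fmap shift f) (fmap shift g) (- fmap shift h).
Proof.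
split=> [/dist_rot2/dist_rot1/dist_negl|/dist_negl d]; first by rewrite !opprK.
by do 3 apply/dist_rot.
Qed.

Lemma dist_cocone Y Z (g : hom Y Z) :
  exists X (f : hom X Y) (h : hom Z (shift X)), dist f g h.
Proof.
have [W [k [l d]]] := dist_cone g.
have [e [e' [e'e ee']]] := shift_unshift_iso W.
have [f fE] := shift_full (- (l \oc e)).
exists (unshift W), f, (e' \oc k); apply/dist_rot.
have := dist_isoE (comp1c _) (comp1c _) (comp1c _) (comp1c _) ee' e'e d.
by rewrite fmap1 !comp1c !compc1 fE opprK.
Qed.

Lemma dist_split X Y Z (f : hom X Y) (g : hom Y Z) :
  dist f g 0 -> exists (j : hom Z Y) (r : hom Y X), is_biproduct f j r g.
Proof.
move=> d.
have [j gj] : exists j, g \oc j = idc Z.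
  by apply: (dist_lift (dist_rot1 d)); rewrite comp0c.
have gf := dist_comp0 d.
have [r fr] : exists r, f \oc r = idc Y - j \oc g.
  by apply: (dist_lift d); rewrite compBr compA gj comp1c compc1 subrr.
(* [f] is a monomorphism: a map killed by [f] factors, after a shift, through the connecting map,
   which is zero. *)
have f_mono W (t : hom W X) : f \oc t = 0 -> t = 0.
  move=> ft; apply: shift_faithful; rewrite fmap0.
  have [|v <-] := dist_lift (dist_rot2 d) (u := fmap shift t).
    by rewrite compNl -fmapM ft fmap0 oppr0.
  by rewrite comp0c.
exists j, r; split=> //; last by rewrite fr subrK.
- apply/eqP; rewrite -subr_eq0; apply/eqP/f_mono.
  by rewrite compBr compA fr compBl comp1c compc1 -compA gf compc0 subr0 subrr.
by apply: f_mono; rewrite compA fr compBl comp1c -compA gj compc1 subrr.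
Qed.

(** Triangulated categories are weakly idempotent complete: [i[1]] kills the connecting map [h] of
    the cone of [i] and has a left inverse, so [h = 0]. *)
Lemma split_mono_biproduct X Y (i : hom X Y) (p : hom Y X) :
  p \oc i = idc X ->
  exists Z (j : hom Z Y) (q : hom Y Z), dist i q 0 /\ is_biproduct i j p q.
Proof.
move=> pi; have [Z [q [h d]]] := dist_cone i.
have h0 : h = 0.
  have := dist_comp0 (dist_rot1 (dist_rot1 d)); rewrite compNl => e.
  rewrite -[h]comp1c -fmap1 -pi fmapM -compA.
  by move/eqP: e; rewrite oppr_eq0 => /eqP->; rewrite compc0.
subst h; have [j [r bp]] := dist_split d.
by do 3 eexists; split; [exact: d | apply: is_biproduct_retraction bp pi].
Qed.

Lemma biproduct_dist X Z Y (i : hom X Y) (j : hom Z Y) (r : hom Y X)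
    (q : hom Y Z) : is_biproduct i j r q -> dist i q 0.
Proof.
move=> bp; have [ri qj rj qi eY] := bp.
have [Z' [j' [q' [d bp']]]] := split_mono_biproduct ri.
have [_ qj' rj' qi' eY'] := bp'.
have e : j \oc q = idc Y - i \oc r by rewrite -eY addrC addKr.
have e' : j' \oc q' = idc Y - i \oc r by rewrite -eY' addrC addKr.
have c'c : q' \oc j \oc (q \oc j') = idc Z'.
  by rewrite !compA (comp_eql _ e) compBr compc1 compBl qj' !compA qi' !comp0c subr0.
have cc' : q \oc j' \oc (q' \oc j) = idc Z.
  by rewrite !compA (comp_eql _ e') compBr compc1 compBl qj !compA qi !comp0c subr0.
have := dist_isoE (comp1c _) (comp1c _) (comp1c _) (comp1c _) c'c cc' d.
rewrite fmap1 !comp1c !compc1 comp0c.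
by rewrite (comp_eql _ e') compBr compA qi comp0c subr0 compc1.
Qed.

Definition star (P Q : C -> Prop) (M : C) : Prop :=
  exists X Z (f : hom X M) (g : hom M Z) (h : hom Z (shift X)),
    [/\ P X, Q Z & dist f g h].

Lemma star_sub (P P' Q Q' : C -> Prop) M :
  (forall X, P X -> P' X) -> (forall X, Q X -> Q' X) ->
  star P Q M -> star P' Q' M.
Proof.
move=> PP QQ [X [Z [f [g [h [PX QZ d]]]]]].
by exists X, Z, f, g, h; split; [apply: PP | apply: QQ |].
Qed.

Lemma star_iso (P Q : C -> Prop) M M' :
  isomorphic M M' -> star P Q M -> star P Q M'.
Proof.
move=> [b [b' [b'b bb']]] [X [Z [f [g [h [PX QZ d]]]]]].
have := dist_isoE (comp1c _) (comp1c _) b'b bb' (comp1c _) (comp1c _) d.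
by rewrite fmap1 !comp1c !compc1 => d'; exists X, Z; do 3 eexists; split; eauto.
Qed.

Lemma star_assoc1 (P Q R : C -> Prop) M :
  star (star P Q) R M -> star P (star Q R) M.
Proof.
move=> [A [r [g [g' [g'' [[p [q [f [f' [f'' [Pp Qq df]]]]]] Rr dg]]]]]].
have [N [h' [h'' dh]]] := dist_cone (g \oc f).
have [u [v [d _ _ _ _]]] := dist_octa df dg dh.
exists p, N, (g \oc f), h', h''; split=> //.
by exists q, r, u, v, (fmap shift f' \oc g'').
Qed.

(** The composite to which the octahedron is applied is [M -> N -> r], made of second maps. Hence
    all triangles are rotated once, and the resulting triangle on [p[1]], [A[1]], [q[1]] is shifted
    back. *)
Lemma star_assoc2 (P Q R : C -> Prop) M :
  star P (star Q R) M -> star (star P Q) R M.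
Proof.
move=> [p [N [f [f' [f'' [Pp [q [r [g [g' [g'' [Qq Rr dg]]]]]] df]]]]]].
have [A [k [l dk]]] := dist_cocone (g' \oc f').
have [u [v [d _ _ _ _]]] := dist_octa (dist_rot1 df) (dist_rot1 dg) (dist_rot1 dk).
have [u' u'E] := shift_full u; have [v' v'E] := shift_full v.
exists A, r, k, (g' \oc f'), l; split=> //.
pose w := fmap shift f'' \oc (- fmap shift g).
have [w' w'E] := shift_full w.
exists p, q, u', v', (- w'); split=> //; apply/dist_shift.
by rewrite u'E v'E fmapN opprK w'E.
Qed.

(** The connecting map vanishes, so [M] is a direct sum, whose summands can be taken in either
    order. *)
Lemma star_swap (P Q : C -> Prop) M :
  (forall p q (f : hom p (shift q)), P p -> Q q -> f = 0) ->
  star Q P M -> star P Q M.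
Proof.
move=> orth [q [p [f [g [h [Qq Pp d]]]]]].
have h0 := orth p q h Pp Qq; subst h.
have [j [r bp]] := dist_split d.
by exists p, q, j, r, 0; split=> //; apply: biproduct_dist (is_biproductC bp).
Qed.

(** [P * Q * P * Q] is contained in [P * P * Q * Q] by swapping the two middle factors; the first
    two and the last two then merge. *)
Lemma star_ext (P Q : C -> Prop) M :
  (forall N, star P P N -> P N) -> (forall N, star Q Q N -> Q N) ->
  (forall p q (f : hom p (shift q)), P p -> Q q -> f = 0) ->
  star (star P Q) (star P Q) M -> star P Q M.
Proof.
move=> PP QQ orth /star_assoc1 h.
have {}h : star P (star P (star Q Q)) M.
  apply: star_sub h => // X /star_assoc2 h; apply: star_assoc1.
  by apply: star_sub h => // Y; apply: star_swap.
by move/star_assoc2: h; apply: star_sub => X; [apply: PP | apply: QQ].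
Qed.

End Triangulated.

(** * Weight structures *)

Lemma int_shift_ind (P : int -> Prop) :
  P 0 -> (forall i, P i -> P (i + 1)) -> (forall i, P i -> P (i - 1)) ->
  forall i, P i.
Proof.
move=> P0 PS Pp; elim/int_rect=> // n Pn.
  by rewrite -addn1 PoszD; apply: PS.
by rewrite -addn1 PoszD opprD; apply: Pp.
Qed.

(** * Shifted classes of objects and extension closures *)

Section ShiftClasses.
Variable C : tricat.
Implicit Types (X Y Z W M N : C) (P Q : C -> Prop) (i j k : int).

Lemma shiftzS i X : isomorphic (shiftz (i + 1) X) (shift (shiftz i X)).
Proof.
case: i => [n|[|n]].
- by rewrite -PoszD addn1; apply: isomorphic_refl.
- by apply: isomorphic_sym; apply: shift_unshift_iso.
have -> : (Negz n.+1 + 1 = Negz n)%R by lia.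
by apply: isomorphic_sym; apply: (shift_unshift_iso (iter n.+1 unshift X)).
Qed.

Lemma shift_class_iso P i X Y :
  isomorphic X Y -> shift_class P i X -> shift_class P i Y.
Proof.
move=> XY [Z PZ XZ]; exists Z => //.
exact: isomorphic_trans (isomorphic_sym XY) XZ.
Qed.

Lemma shift_class_shift P i X :
  shift_class P i X -> shift_class P (i + 1) (shift X).
Proof.
move=> [Z PZ XZ]; exists Z => //.
apply: isomorphic_trans (isomorphic_sym (shiftzS i Z)).
exact: fmap_isomorphic.
Qed.

Lemma shift_class_unshift P i X :
  shift_class P i X -> shift_class P (i - 1) (unshift X).
Proof.
move=> [Z PZ XZ]; exists Z => //.
apply: isomorphic_trans (fmap_isomorphic unshift XZ) _.
have := shiftzS (i - 1) Z; rewrite subrK => /(fmap_isomorphic unshift) e.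
exact: isomorphic_trans e (unshift_shift_iso _).
Qed.

Lemma shift_class_shift_inv P i X :
  shift_class P (i + 1) (shift X) -> shift_class P i X.
Proof.
move/shift_class_unshift; rewrite addrK; apply: shift_class_iso.
exact: unshift_shift_iso.
Qed.

Lemma shift_class_unshift_inv P i X :
  shift_class P (i - 1) (unshift X) -> shift_class P i X.
Proof.
move/shift_class_shift; rewrite subrK; apply: shift_class_iso.
exact: shift_unshift_iso.
Qed.

Lemma shift_class_incl P X : P X -> shift_class P 0 X.
Proof. by move=> PX; exists X => //; apply: isomorphic_refl. Qed.

Lemma shift_class1 P X : P X -> shift_class P 1 (shift X).
Proof. by move=> PX; exists X => //; apply: isomorphic_refl. Qed.

Inductive ext_closure P : C -> Prop :=
  | ext_incl X of P X : ext_closure P X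
  | ext_dist X Y Z (f : hom X Y) (g : hom Y Z) (h : hom Z (shift X)) of
      dist f g h & ext_closure P X & ext_closure P Z : ext_closure P Y.

Lemma ext_closure_iso P M M' :
  (forall X Y, isomorphic X Y -> P X -> P Y) ->
  isomorphic M M' -> ext_closure P M -> ext_closure P M'.
Proof.
move=> Piso MM' eM; case: eM M' MM' => [X PX | X Y Z f g h d eX eZ] M' MM'.
  by apply: ext_incl; apply: Piso PX.
have : star (ext_closure P) (ext_closure P) M'.
  by apply: star_iso MM' _; exists X, Z, f, g, h.
by move=> [X' [Z' [f' [g' [h' [eX' eZ' d']]]]]]; apply: ext_dist d' eX' eZ'.
Qed.

Lemma ext_closure_star P M :
  star (ext_closure P) (ext_closure P) M -> ext_closure P M.
Proof. by move=> [X [Z [f [g [h [eX eZ d]]]]]]; apply: ext_dist d eX eZ. Qed.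

Lemma ext_closure_sub P Q M :
  (forall X, P X -> Q X) -> ext_closure P M -> ext_closure Q M.
Proof.
move=> PQ; elim=> [X PX | X Y Z f g h d _ eX _ eZ].
  by apply: ext_incl; apply: PQ.
exact: ext_dist d eX eZ.
Qed.

End ShiftClasses.

(** * The weight structure of a connective generating subcategory *)

Section Connective.
Variables (C : tricat) (H : C -> Prop).
Implicit Types (X Y Z W M N : C) (i j k a b c : int).
Hypothesis H_conn : connective H.
Hypothesis H_zero : exists2 Z : C, is_zero_obj Z & H Z.
Hypothesis H_sum : forall X Y W, H X -> H Y -> direct_sum X Y W ->
  exists2 W', H W' & isomorphic W W'.
Hypothesis H_gen : forall P, is_tri_sub P -> (forall X, H X -> P X) ->
  forall X, P X.

Notation HS := (shift_class H).

Lemma shifted_orth i j X Y (f : hom X Y) : i < j -> HS i X -> HS j Y -> f = 0.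
Proof.
elim/int_shift_ind: i j X Y f => [|i IHi|i IHi] j X Y f ij hX hY.
- have [X0 HX0 [a [a' [a'a aa']]]] := hX.
  have [Y0 HY0 [b [b' [b'b bb']]]] := hY.
  have := H_conn HX0 HY0 ij (b \oc f \oc a').
  move=> e; rewrite -[f]comp1c -[f]compc1 -a'a -b'b !compA.
  rewrite -[b' \oc b \oc f \oc a']compA -compA compA -!(compA b').
  by rewrite [b \oc _]compA e !(comp0c, compc0).
- apply: unshift_faithful; rewrite fmap0; apply: (IHi (j - 1)).
  + by lia.
  + by move/shift_class_unshift: hX; rewrite addrK.
  + exact: shift_class_unshift.
apply: shift_faithful; rewrite fmap0; apply: (IHi (j + 1)).
- by lia.
- by move/shift_class_shift: hX; rewrite subrK.
exact: shift_class_shift.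
Qed.

Lemma shifted_zero i Z : is_zero_obj Z -> HS i Z.
Proof.
elim/int_shift_ind: i Z => [|i IHi|i IHi] Z Z0.
- have [Z' Z0' HZ'] := H_zero; apply: shift_class_iso (shift_class_incl HZ').
  exact: zero_obj_isomorphic.
- by apply: shift_class_unshift_inv; rewrite addrK; apply/IHi/fmap_zero_obj.
by apply: shift_class_shift_inv; rewrite subrK; apply/IHi/fmap_zero_obj.
Qed.

Lemma shifted_sum i X Y W : HS i X -> HS i Y -> direct_sum X Y W -> HS i W.
Proof.
elim/int_shift_ind: i X Y W => [|i IHi|i IHi] X Y W.
- move=> [X0 HX0 XX0] [Y0 HY0 YY0] s.
  have {}s := direct_sum_iso1 s XX0.
  have {}s := direct_sumC (direct_sum_iso1 (direct_sumC s) YY0).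
  by have [W' HW' WW'] := H_sum HX0 HY0 s; exists W'.
- move=> /shift_class_unshift hX /shift_class_unshift hY.
  rewrite addrK in hX hY; move/(fmap_direct_sum unshift)/(IHi _ _ _ hX hY) => h.
  by apply: shift_class_unshift_inv; rewrite addrK.
move=> /shift_class_shift hX /shift_class_shift hY.
rewrite subrK in hX hY; move/(fmap_direct_sum shift)/(IHi _ _ _ hX hY) => h.
by apply: shift_class_shift_inv; rewrite subrK.
Qed.

(** Candidates for [w >= i] and, below, [w <= i]. Orthogonality is stated for every [i] so that
    bounds are compared without shifting objects; [ge_class_shift_class] and [le_class_shift_class]
    return to shifts of the classes for 0. *)
Definition ge_class i M : Prop :=
  forall k Y (f : hom Y M), k < i -> HS k Y -> f = 0.
Definition le_class i M : Prop :=
  forall k Y (f : hom M Y), i < k -> HS k Y -> f = 0.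

Lemma ge_class_retract i X M : retract_of X M -> ge_class i M -> ge_class i X.
Proof.
move=> [s [p ps]] geM k Y f ki hY.
by rewrite -[f]comp1c -ps -compA (geM _ _ (s \oc f) ki hY) compc0.
Qed.

Lemma le_class_retract i X M : retract_of X M -> le_class i M -> le_class i X.
Proof.
move=> [s [p ps]] leM k Y f ik hY.
by rewrite -[f]compc1 -ps compA (leM _ _ (f \oc p) ik hY) comp0c.
Qed.

Lemma isomorphic_retract X Y : isomorphic X Y -> retract_of X Y.
Proof. by move=> [s [p [ps _]]]; exists s, p. Qed.

Lemma ge_class_iso i X Y : isomorphic X Y -> ge_class i X -> ge_class i Y.
Proof. by move=> /isomorphic_sym/isomorphic_retract; apply: ge_class_retract. Qed.

Lemma le_class_iso i X Y : isomorphic X Y -> le_class i X -> le_class i Y.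
Proof. by move=> /isomorphic_sym/isomorphic_retract; apply: le_class_retract. Qed.

Lemma ge_class_shift i X : ge_class i X -> ge_class (i + 1) (shift X).
Proof.
move=> geX k Y f ki hY; apply: unshift_faithful; rewrite fmap0.
have := ge_class_iso (isomorphic_sym (unshift_shift_iso X)) geX.
by apply; last exact: shift_class_unshift hY; lia.
Qed.

Lemma le_class_shift i X : le_class i X -> le_class (i + 1) (shift X).
Proof.
move=> leX k Y f ki hY; apply: unshift_faithful; rewrite fmap0.
have := le_class_iso (isomorphic_sym (unshift_shift_iso X)) leX.
by apply; last exact: shift_class_unshift hY; lia.
Qed.

Lemma ge_class_unshift i X : ge_class i X -> ge_class (i - 1) (unshift X).
Proof.
move=> geX k Y f ki hY; apply: shift_faithful; rewrite fmap0.
have := ge_class_iso (isomorphic_sym (shift_unshift_iso X)) geX.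
by apply; last exact: shift_class_shift hY; lia.
Qed.

Lemma le_class_unshift i X : le_class i X -> le_class (i - 1) (unshift X).
Proof.
move=> leX k Y f ki hY; apply: shift_faithful; rewrite fmap0.
have := le_class_iso (isomorphic_sym (shift_unshift_iso X)) leX.
by apply; last exact: shift_class_shift hY; lia.
Qed.

Lemma ge_class_shift_class i X : ge_class i X -> shift_class (ge_class 0) i X.
Proof.
elim/int_shift_ind: i X => [|i IHi|i IHi] X geX.
- exact: shift_class_incl.
- apply: shift_class_unshift_inv; rewrite addrK; apply: IHi.
  by move/ge_class_unshift: geX; rewrite addrK.
apply: shift_class_shift_inv; rewrite subrK; apply: IHi.
by move/ge_class_shift: geX; rewrite subrK.
Qed.

Lemma le_class_shift_class i X : le_class i X -> shift_class (le_class 0) i X.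
Proof.
elim/int_shift_ind: i X => [|i IHi|i IHi] X leX.
- exact: shift_class_incl.
- apply: shift_class_unshift_inv; rewrite addrK; apply: IHi.
  by move/le_class_unshift: leX; rewrite addrK.
apply: shift_class_shift_inv; rewrite subrK; apply: IHi.
by move/le_class_shift: leX; rewrite subrK.
Qed.

Lemma shift_class_ge_class X : shift_class (ge_class 0) 1 X -> ge_class 1 X.
Proof.
move=> [Y geY XY]; apply: ge_class_iso (isomorphic_sym XY) _.
by rewrite -[1]add0r; apply: ge_class_shift.
Qed.

(** The layers may occur in any order, which makes closure under extensions immediate;
    [window_filter] sorts them afterwards. *)
Definition window a b : C -> Prop :=
  ext_closure (fun X => exists2 i, (a <= i <= b)%R & HS i X).

Lemma window_incl a b i X : (a <= i <= b)%R -> HS i X -> window a b X.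
Proof. by move=> ab hX; apply: ext_incl; exists i. Qed.

Lemma window_iso a b X Y : isomorphic X Y -> window a b X -> window a b Y.
Proof.
apply: ext_closure_iso => {}X {}Y XY [i ab hX].
by exists i => //; apply: shift_class_iso hX.
Qed.

Lemma window_zero a b Z : (a <= b)%R -> is_zero_obj Z -> window a b Z.
Proof.
by move=> ab Z0; apply: (@window_incl _ _ a); [rewrite lexx | apply: shifted_zero].
Qed.

Lemma window_sub a b a' b' X :
  (a' <= a)%R -> (b <= b')%R -> window a b X -> window a' b' X.
Proof.
move=> aa' bb'; apply: ext_closure_sub => Y [i /andP[ai ib] hY].
by exists i => //; rewrite (le_trans aa') // (le_trans ib).
Qed.

Lemma window_shift a b X : window a b X -> window (a + 1) (b + 1) (shift X).
Proof.
elim=> [Y [i /andP[ai ib] hY] | X' Y Z f g h /dist_shift d _ eX _ eZ].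
  apply: (@window_incl _ _ (i + 1)); first by rewrite !lerD2r ai.
  exact: shift_class_shift.
exact: ext_dist d eX eZ.
Qed.

Lemma window_unshift a b X : window a b X -> window (a - 1) (b - 1) (unshift X).
Proof.
elim=> [Y [i /andP[ai ib] hY] | X' Y Z f g h d _ eX _ eZ].
  apply: (@window_incl _ _ (i - 1)); first by rewrite !lerD2r ai.
  exact: shift_class_unshift.
(* The cone of [unshift f], shifted, is compared with the given triangle through
   [shift (unshift _) -> _]; hence it is isomorphic to [unshift Z]. *)
have [W [k [l dW]]] := dist_cone (fmap unshift f).
apply: (ext_dist dW eX _); apply: window_iso eZ.
apply: isomorphic_trans (unshift_shift_iso W); apply: fmap_isomorphic.
have [eta [eta_i eta_n]] := unshiftK C.
apply: isomorphic_sym; move/dist_shift: dW => dW.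
apply: dist_cone_unique dW d (eta_i X') (eta_i Y) _.
exact: (eta_n _ _ f).
Qed.

Lemma window_ge_class a b X : window a b X -> ge_class a X.
Proof.
elim=> [Y [i /andP[ai ib] hY] | X' Y Z f g h d _ geX _ geZ] k W u ka hW.
  exact: shifted_orth (lt_le_trans ka ai) hW hY.
have [|v <-] := dist_lift d (u := u); first exact: geZ ka hW.
by rewrite (geX _ _ v ka hW) compc0.
Qed.

Lemma window_le_class a b X : window a b X -> le_class b X.
Proof.
elim=> [Y [i /andP[ai ib] hY] | X' Y Z f g h d _ leX _ leZ] k W u bk hW.
  exact: shifted_orth (le_lt_trans ib bk) hY hW.
have [|v <-] := dist_colift d (u := u); first exact: leX bk hW.
by rewrite (leZ _ _ v bk hW) comp0c.
Qed.

Lemma le_window_orth a b c X Y (f : hom X Y) :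
  le_class a X -> (a < b)%R -> window b c Y -> f = 0.
Proof.
move=> leX ab wY; elim: wY f => [{}Y [i /andP[bi _] hY] | X' Y' Z u v w d _ IHX _ IHZ] f.
  exact: leX (lt_le_trans ab bi) hY.
have [|l <-] := dist_lift d (u := f); first exact: IHZ.
by rewrite (IHX l) compc0.
Qed.

Lemma window_ge_orth a b c X Y (f : hom X Y) :
  window a b X -> (b < c)%R -> ge_class c Y -> f = 0.
Proof.
move=> wX bc geY; elim: wX f => [{}X [i /andP[_ ib] hX] | X' Y' Z u v w d _ IHX _ IHZ] f.
  exact: geY (le_lt_trans ib bc) hX.
have [|l <-] := dist_colift d (u := f); first exact: IHX.
by rewrite (IHZ l) comp0c.
Qed.

(** A single layer lies on one side of the cut, with zero on the other side, and [star_ext] passes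
    to extensions. The orthogonality it asks for holds because the upper window, once shifted,
    starts at [c + 2]. *)
Lemma window_filter a b c M : (a <= c)%R -> (c < b)%R -> window a b M ->
  star (window a c) (window (c + 1) b) M.
Proof.
move=> ac cb wM.
have [O O0] := zero_obj_exists C.
elim: wM => {M} [X [i /andP[ai ib] hX] | X Y Z f g h d _ sX _ sZ].
  have [ic | ci] := leP i c.
    exists X, O, (idc X), 0, 0; split; last exact: dist_id.
      by apply: window_incl hX; rewrite ai.
    by apply: window_zero => //; rewrite lezD1.
  exists O, X, 0, (idc X), 0; split; last exact: dist_zero_left.
    exact: window_zero.
  by apply: window_incl hX; rewrite lezD1 ci.
apply: star_ext => [N | N | p q u wp wq |].
- exact: ext_closure_star.
- exact: ext_closure_star.
- apply: window_ge_orth wp _ (ge_class_shift (window_ge_class wq)).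
  by rewrite -addrA ltrDl.
by exists X, Z, f, g, h.
Qed.

(** By connectivity an extension between layers of the same degree splits, and [H] is closed under
    sums up to isomorphism. *)
Lemma window_single a M : window a a M -> HS a M.
Proof.
elim=> [X [i /andP[ai ia] hX] | X Y Z f g h d _ hX _ hZ].
  by have -> : a = i by apply/eqP; rewrite eq_le ai ia.
have h0 : h = 0.
  by apply: shifted_orth hZ (shift_class_shift hX); rewrite ltrDl.
subst h; have [j [r bp]] := dist_split d.
by apply: shifted_sum hX hZ _; exists f, j, r, g.
Qed.

Lemma window_exhaust M : exists n : nat, window (- n%:Z) n%:Z M.
Proof.
move: M; apply: H_gen => [|X HX]; last first.
  by exists 0%N; apply: (@window_incl _ _ 0) => //; apply: shift_class_incl.
have ext X Y Z (f : hom X Y) (g : hom Y Z) h : dist f g h ->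
    (exists n : nat, window (- n%:Z) n%:Z X) ->
    (exists n : nat, window (- n%:Z) n%:Z Z) ->
    exists n : nat, window (- n%:Z) n%:Z Y.
  move=> d [m wX] [n wZ]; exists (m + n)%N.
  by apply: ext_dist d _ _; [apply: window_sub wX | apply: window_sub wZ]; lia.
have sh X : (exists n : nat, window (- n%:Z) n%:Z X) ->
    exists n : nat, window (- n%:Z) n%:Z (shift X).
  by move=> [n /window_shift wX]; exists n.+1; apply: window_sub wX; lia.
split=> // [X Y XY [n wX] | | X Y W | X [n wX] | X Y Z f g h d eX eY].
- by exists n; apply: window_iso wX.
- have [O O0] := zero_obj_exists C; exists O => //.
  by exists 0%N; apply: window_zero.
- by move=> [i [j [r [q /biproduct_dist d]]]]; apply: ext d.
- by exists n.+1; move/window_unshift: wX; apply: window_sub; lia.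
by apply: ext (dist_rot1 d) eY (sh _ eX).
Qed.

Definition conn_weight : weight_classes C := WeightClasses (le_class 0) (ge_class 0).

(** The classes are orthogonal to shifts of [H] only, so [Y] is cut at 0. The composite of [f] with
    the map to the upper part [R] vanishes because [X] is in [<= 0]; thus [f] factors through the
    lower part [L], and [L -> Y] vanishes because [Y] is in [>= 1]. *)
Lemma conn_weight_orth X Y (f : hom X Y) : le_class 0 X -> ge_class 1 Y -> f = 0.
Proof.
move=> leX geY; have [n wY] := window_exhaust Y.
(* The cut 0 has to lie strictly below the upper end, which could fail for [n = 0]. *)
have {}wY : window (- n.+1%:Z) n.+1%:Z Y by apply: window_sub wY; lia.
have [||L [R [u [v [w [wL wR d]]]]]] := window_filter (c := 0) _ _ wY; first by lia.
  by lia.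
have [|l <-] := dist_lift d (u := f).
  by apply: le_window_orth leX _ wR.
by rewrite (window_ge_orth u wL (ltr01) geY) comp0c.
Qed.

Lemma conn_weight_structure : is_weight_structure conn_weight.
Proof.
split=> [X Y | X Y | X leX | X geX | X Y leX geY f | M] /=.
- exact: le_class_retract.
- exact: ge_class_retract.
- apply: le_class_shift_class => k Y f k1 hY.
  by apply: (leX k) => //; apply: lt_trans k1.
- move/shift_class_ge_class: geX => geX k Y f k0 hY.
  by apply: (geX k) => //; apply: lt_trans k0 _.
- by apply: conn_weight_orth leX _; apply: shift_class_ge_class.
have [n wM] := window_exhaust M.
have {}wM : window (- n.+1%:Z) n.+1%:Z M by apply: window_sub wM; lia.
have [||L [R [u [v [w [wL wR d]]]]]] := window_filter (c := 0) _ _ wM; first by lia.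
  by lia.
exists L, R, u, v, w; split=> //; first exact: window_le_class wL.
by apply: ge_class_shift_class; apply: window_ge_class wR.
Qed.

Lemma conn_weight_bounded : w_bounded conn_weight.
Proof.
split=> X; have [n wX] := window_exhaust X.
  by exists (- n%:Z); apply/ge_class_shift_class/(window_ge_class wX).
by exists n%:Z; apply/le_class_shift_class/(window_le_class wX).
Qed.

Lemma conn_weight_heart X : H X -> heart_class conn_weight X.
Proof.
move=> HX; have wX : window 0 0 X.
  by apply: (@window_incl _ _ 0) => //; apply: shift_class_incl.
by split; [apply: window_le_class wX | apply: window_ge_class wX].
Qed.

(* The lowest layer [N] of [M] maps to [M] by zero, so [M -> M'] splits with
   complement [N[1]], which exhibits [M] as an extension of [N[2]] by [M']. *)
Lemma window_ge_step a b M : (a < 0)%R -> (a + 1 < b)%R ->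
  ge_class 0 M -> window a b M -> window (a + 1) b M.
Proof.
move=> a0 ab geM wM.
have [||N [M' [f [g [h [wN wM' d]]]]]] := window_filter (c := a) _ _ wM; first by lia.
  by lia.
have f0 : f = 0 by apply: window_ge_orth wN a0 geM.
subst f; have /= d' := dist_rot1 d; rewrite fmap0 oppr0 in d'.
have [j [r bp]] := dist_split d'.
have {}d' := dist_rot1 (biproduct_dist (is_biproductC bp)).
apply: ext_dist d' wM' _.
apply: (@window_incl _ _ (a + 1 + 1)); first by lia.
by do 2 apply: shift_class_shift; apply: window_single.
Qed.

(** The map from [M] to its highest layer [N] vanishes, so [M'] is the sum of [M] and [N[-1]]. The
    statement is shifted once because the rotated triangle splits there. *)
Lemma window_le_split a b M : (0 < b)%R -> (a < b)%R ->
  le_class 0 M -> window a b M ->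
  exists M' N, [/\ window a (b - 1) M', HS b N &
    direct_sum N (shift M) (shift M')].
Proof.
move=> b0 ab leM wM.
have [||M' [N [f [g [h [wM' wN d]]]]]] := window_filter (c := b - 1) _ _ wM; first by lia.
  by lia.
rewrite subrK in wN.
have g0 : g = 0 by apply: le_window_orth leM b0 wN.
subst g; have /= d' := dist_rot2 d; rewrite fmap0 oppr0 in d'.
have [j [r bp]] := dist_split d'.
exists M', N; split=> //; first exact: window_single.
by do 4 eexists; exact: bp.
Qed.

(** The inclusion of [M] in [M'] with complement [N[-1]] makes [M] an extension of [M'] by [N[-2]].
    This layer has degree [b - 2], which must not fall below [a]. *)
Lemma window_le_step a b M : (1 < b)%R -> (a <= b - 2)%R ->
  le_class 0 M -> window a b M -> window a (b - 1) M.
Proof.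
move=> b1 ab leM wM.
have [||M' [N [wM' hN s]]] := window_le_split _ _ leM wM; first by lia.
  by lia.
have [j [i [q [r /biproduct_dist d]]]] := direct_sumC s.
have [j' j'E] := shift_full j.
have [A [k [l d']]] := dist_cocone j'.
have hA : HS (b - 2) A.
  have -> : b - 2 = b - 1 - 1 by lia.
  do 2 apply: shift_class_shift_inv; rewrite !subrK.
  apply: shift_class_iso hN; apply: dist_cone_unique d _ (is_iso_id _) (is_iso_id _) _.
    by have /dist_shift/dist_rot1 := d'; exact.
  by rewrite comp1c compc1 j'E.
by apply: ext_dist d' _ wM'; apply: window_incl hA; lia.
Qed.

Lemma conn_weight_heart_wKar X : heart_class conn_weight X -> wKar_class H X.
Proof.
move=> [/= leX geX]; have [n wX] := window_exhaust X.
(* Layers are removed from below first; the upper end [n.+1] guarantees that the second shortening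
   can end exactly at 1. *)
have {}wX : window 0 n.+1%:Z X.
  have : window (- n%:Z) n.+1%:Z X by apply: window_sub wX; lia.
  elim: {1}n => // m IHm /window_ge_step wX'; apply: IHm.
  have -> : - m%:Z = - m.+1%:Z + 1 by lia.
  by apply: wX' => //; lia.
have {}wX : window 0 1 X.
  elim: n wX => // n IHn /window_le_step wX'; apply: IHn.
  have -> : n.+1%:Z = n.+2%:Z - 1 by lia.
  by apply: wX' => //; lia.
(* Shortening stops here, since one more step would create a layer of degree -1. The splitting
   itself is used: [X] plus [N[-1]] is [M'], where [N[-1]] and [M'] are in [H] up to isomorphism.
   This is how the weak retraction-closure enters. *)
have [||M' [N [wM' hN s]]] := window_le_split _ _ leX wX; [by []|by []|].
have [Y HY M'Y] := window_single wM'.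
have {}s := fmap_direct_sum unshift s.
have {}s := direct_sum_iso s (unshift_shift_iso M').
have {}s := direct_sumC (direct_sum_iso1 (direct_sumC s) (unshift_shift_iso X)).
have [N' HN' NN'] := shift_class_unshift hN.
apply/wKar_classP; exists N', Y; split=> //.
exact: direct_sum_iso (direct_sum_iso1 s NN') M'Y.
Qed.

(** * Uniqueness of the weight structure *)

Section Uniqueness.
Variable w : weight_classes C.
Hypothesis w_ws : is_weight_structure w.
Hypothesis H_heart : forall X, H X -> heart_class w X.

Let le0_iso X Y : isomorphic X Y -> w_le0 w Y -> w_le0 w X.
Proof. by move=> /isomorphic_retract; apply: (le0_retract w_ws). Qed.

Let ge0_iso X Y : isomorphic X Y -> w_ge0 w Y -> w_ge0 w X.
Proof. by move=> /isomorphic_retract; apply: (ge0_retract w_ws). Qed.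

Lemma shifted_w_ge0 (n : nat) X : HS n%:Z X -> w_ge0 w X.
Proof.
elim: n X => [|n IHn] X hX.
  by have [Y /H_heart[_ geY] XY] := hX; apply: ge0_iso geY.
move/shift_class_unshift: hX; rewrite -addn1 PoszD addrK => /IHn geX.
apply: (ge0_shift w_ws); exists (unshift X) => //.
exact/isomorphic_sym/shift_unshift_iso.
Qed.

Lemma shifted_w_le0 (n : nat) X : HS (- n%:Z) X -> w_le0 w X.
Proof.
elim: n X => [|n IHn] X hX.
  by have [Y /H_heart[leY _] XY] := hX; apply: le0_iso leY.
move/shift_class_shift: hX; rewrite -addn1 PoszD opprD subrK => /IHn leX.
have [Y leY XY] := le0_shift w_ws leX; apply: le0_iso leY.
by apply: ff_isomorphic_reflect XY; [apply: shift_faithful | apply: shift_full].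
Qed.

Lemma w_le0_le_class X : w_le0 w X -> le_class 0 X.
Proof.
move=> leX k Y f k0 hY; apply: (w_orth w_ws leX).
exists (unshift Y); last exact/isomorphic_sym/shift_unshift_iso.
apply: (@shifted_w_ge0 (absz (k - 1))).
by move/shift_class_unshift: hY; rewrite gez0_abs //; lia.
Qed.

Lemma w_ge0_ge_class X : w_ge0 w X -> ge_class 0 X.
Proof.
move=> geX k Y f k0 hY; apply: shift_faithful; rewrite fmap0.
apply: (w_orth w_ws _ (shift_class1 geX)).
apply: (@shifted_w_le0 (absz (k + 1))).
by move/shift_class_shift: hY; rewrite lez0_abs ?opprK //; lia.
Qed.

(** In a weight decomposition of [X] the map [X -> R] vanishes, so [X] is a retract of [L]. *)
Lemma le_class_w_le0 X : le_class 0 X -> w_le0 w X.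
Proof.
move=> leX; have [L [R [f [g [h [d leL geR]]]]]] := w_dec w_ws X.
have [|s fs] := dist_lift d (u := idc X); last first.
  by apply: (le0_retract w_ws) leL; exists s, f.
rewrite compc1; apply: conn_weight_orth leX _; apply: shift_class_ge_class.
by have [R' /w_ge0_ge_class geR' RR'] := geR; exists R'.
Qed.

(** Here [shift X] is decomposed, because the right-hand part of a decomposition lies in [w_ge0]
    shifted by 1; the resulting retraction comes back by full faithfulness of [shift]. *)
Lemma ge_class_w_ge0 X : ge_class 0 X -> w_ge0 w X.
Proof.
move=> /ge_class_shift; rewrite add0r => geX.
have [L [R [f [g [h [d leL geR]]]]]] := w_dec w_ws (shift X).
have [|p pg] := dist_colift d (u := idc (shift X)).
  by rewrite comp1c; apply: conn_weight_orth geX; apply: w_le0_le_class.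
have [R' geR' [b [b' [b'b bb']]]] := geR.
have [i iE] := shift_full (b \oc g : hom (shift X) (shift R')).
have [q qE] := shift_full (p \oc b' : hom (shift R') (shift X)).
apply: (ge0_retract w_ws) geR'; exists i, q; apply: shift_faithful.
by rewrite fmapM iE qE fmap1 !compA (comp_eql _ b'b) compc1.
Qed.

Lemma conn_weight_unique : w = conn_weight.
Proof.
rewrite /conn_weight.
have <- : w_le0 w = le_class 0.
  by apply: funext => X; apply: propext; split;
    [apply: w_le0_le_class | apply: le_class_w_le0].
have <- : w_ge0 w = ge_class 0.
  by apply: funext => X; apply: propext; split;
    [apply: w_ge0_ge_class | apply: ge_class_w_ge0].
by case: w.
Qed.

End Uniqueness.

End Connective.

(** The ambient triangulated category supplies the complement, and as a retract of [Y] it remains in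
    both classes. *)
Lemma heart_wic (C : tricat) (w : weight_classes C) :
  is_weight_structure w -> weakly_idempotent_complete (heart w).
Proof.
move=> ws; apply/wicP => X Y i p pi.
have [Z [j [q [_ bp]]]] := split_mono_biproduct (C := C) pi.
have [_ qj _ _ _] := bp.
have ZY : retract_of Z (sval Y) by exists j, q.
have hZ : heart_class w Z.
  have [leY geY] := svalP Y.
  by split; [apply: (le0_retract ws) leY | apply: (ge0_retract ws) geY].
exists (exist _ Z hZ), j, q.
by have [h1 h2 h3 h4 h5] := bp; split.
Qed.

(** * Extending functors to the weak retraction-closure *)

Section WeakKaroubiExtension.
Variables (A V : precat) (F : functor A V).
Hypotheses (F_faithful : faithful F) (F_full : full F).
Hypothesis V_wic : weakly_idempotent_complete V.

(** [Z] is the complement of a split monomorphism [i1 : X -> Y] of [A]. Weak idempotent completeness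
    of [V] gives a complement [W] of the image of [i1] under [F], and [W] is the image of the
    idempotent of [Z]. *)
Lemma wKar_idem_splits (Z : Kar A) :
  wKar_class (obj_image (kar_embed A)) Z -> idem_splits (fmap F (kar_idem Z)).
Proof.
move=> /wKar_classP[_ [_ [[X ->] [Y ->] [i1 [i2 [p1 [p2 [pi1 pi2 _ _ eY]]]]]]]].
have {}pi1 : kar_val p1 \oc kar_val i1 = idc X := congr1 (@kar_val _ _ _) pi1.
have {}pi2 : kar_val p2 \oc kar_val i2 = kar_idem Z := congr1 (@kar_val _ _ _) pi2.
have {}eY : kar_val i1 \oc kar_val p1 + kar_val i2 \oc kar_val p2 = idc Y :=
  congr1 (@kar_val _ _ _) eY.
have /andP[_ /eqP i2Z] := valP i2.
move/wicP: V_wic => wic.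
have [|W [j [q [_ qj _ _ eW]]]] := wic _ _ (fmap F (kar_val i1)) (fmap F (kar_val p1)).
  by rewrite -fmapM pi1 fmap1.
have jq : j \oc q = fmap F (kar_val i2 \oc kar_val p2).
  apply: (addrI (fmap F (kar_val i1) \oc fmap F (kar_val p1))).
  by rewrite eW -fmapM -fmapD eY fmap1.
exists W, (fmap F (kar_val p2) \oc j), (q \oc fmap F (kar_val i2)); split.
  rewrite -[LHS]compA [fmap F _ \oc (_ \oc j)]compA -fmapM -jq.
  by rewrite !compA qj comp1c qj.
rewrite -[LHS]compA [j \oc _]compA jq -!fmapM.
by rewrite !compA pi2 -[_ \oc _ \oc kar_val i2]compA pi2 kar_idemP.
Qed.

Definition wKar_image (Z : wKar A) : V := projT1 (cid (wKar_idem_splits (svalP Z))).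

Definition wKar_incl (Z : wKar A) : hom (wKar_image Z) (F (kar_obj (sval Z))) :=
  projT1 (cid (projT2 (cid (wKar_idem_splits (svalP Z))))).

Definition wKar_proj (Z : wKar A) : hom (F (kar_obj (sval Z))) (wKar_image Z) :=
  projT1 (cid (projT2 (cid (projT2 (cid (wKar_idem_splits (svalP Z))))))).

Lemma wKar_projK (Z : wKar A) : wKar_proj Z \oc wKar_incl Z = idc (wKar_image Z).
Proof.
exact: (projT2 (cid (projT2 (cid (projT2 (cid (wKar_idem_splits (svalP Z)))))))).1.
Qed.

Lemma wKar_inclK (Z : wKar A) :
  wKar_incl Z \oc wKar_proj Z = fmap F (kar_idem (sval Z)).
Proof.
exact: (projT2 (cid (projT2 (cid (projT2 (cid (wKar_idem_splits (svalP Z)))))))).2.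
Qed.

Definition wKar_ext_map (Z Z' : wKar A) (f : hom Z Z') :
    hom (wKar_image Z) (wKar_image Z') :=
  wKar_proj Z' \oc fmap F (kar_val (f : karHom _ _)) \oc wKar_incl Z.

Fact wKar_ext_map1 (Z : wKar A) : wKar_ext_map (idc Z) = idc (wKar_image Z).
Proof.
by rewrite /wKar_ext_map /= -wKar_inclK !compA wKar_projK comp1c wKar_projK.
Qed.

Fact wKar_ext_mapM (Z Z' Z'' : wKar A) (g : hom Z' Z'') (f : hom Z Z') :
  wKar_ext_map (g \oc f) = wKar_ext_map g \oc wKar_ext_map f.
Proof.
rewrite /wKar_ext_map !compA (comp_eql _ (wKar_inclK Z')) -[_ \oc _ \oc fmap F _]compA.
have /andP[/eqP fZ' _] := valP (f : karHom _ _).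
by rewrite -fmapM -[_ \oc _ \oc fmap F _]compA -fmapM fZ' fmapM !compA.
Qed.

Fact wKar_ext_mapD (Z Z' : wKar A) (f g : hom Z Z') :
  wKar_ext_map (f + g) = wKar_ext_map f + wKar_ext_map g.
Proof. by rewrite /wKar_ext_map /= fmapD compDr compDl. Qed.

Definition wKar_ext : functor (wKar A) V :=
  Functor wKar_ext_map1 wKar_ext_mapM wKar_ext_mapD.

Lemma wKar_ext_mapE (Z Z' : wKar A) (f : hom Z Z') :
  wKar_incl Z' \oc wKar_ext_map f \oc wKar_proj Z = fmap F (kar_val (f : karHom _ _)).
Proof.
have /andP[/eqP fZ' /eqP fZ] := valP (f : karHom _ _).
rewrite /wKar_ext_map !compA wKar_inclK -compA wKar_inclK -!fmapM.
by rewrite -compA fZ fZ'.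
Qed.

Lemma wKar_ext_faithful : faithful wKar_ext.
Proof.
move=> Z Z' f g /= fg; apply: val_inj; apply: F_faithful.
by rewrite /= -!wKar_ext_mapE fg.
Qed.

Lemma wKar_ext_full : full wKar_ext.
Proof.
move=> Z Z' h; have [g gE] := F_full (wKar_incl Z' \oc h \oc wKar_proj Z).
have gP : g \in @kar_pred _ (sval Z) (sval Z').
  rewrite unfold_in /kar_pred; apply/andP; split; apply/eqP/F_faithful.
    by rewrite fmapM gE -wKar_inclK !compA (comp_eql _ (wKar_projK Z')) compc1.
  by rewrite fmapM gE -wKar_inclK !compA (comp_eql _ (wKar_projK Z)) compc1.
exists (KarHom gP); rewrite /= /wKar_ext_map /= gE !compA wKar_projK comp1c.
by rewrite -compA wKar_projK compc1.
Qed.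

Lemma wKar_ext_iso (PA : forall X : A,
    wKar_class (obj_image (kar_embed A)) (kar_embed A X)) :
  nat_iso (wKar_ext \oF corestrict PA) F.
Proof.
pose Z X : wKar A := exist _ (kar_embed A X) (PA X).
have iE X : wKar_incl (Z X) \oc wKar_proj (Z X) = idc (F X).
  by have /= := wKar_inclK (Z X); rewrite fmap1.
exists (fun X : A => wKar_incl (Z X)); split=> [X | X Y f].
  by exists (wKar_proj (Z X)); split; [exact: wKar_projK | exact: iE].
transitivity (wKar_incl (Z Y) \oc (wKar_proj (Z Y) \oc fmap F f \oc wKar_incl (Z X))).
  by [].
by rewrite !compA iE comp1c.
Qed.

End WeakKaroubiExtension.

(** * The weight structure generated by a connective subcategory *)

Lemma direct_sum_unique (C : precat) (X Y W W' : C) :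
  direct_sum X Y W -> direct_sum X Y W' -> isomorphic W W'.
Proof.
move=> [i [j [r [q [ri qj rj qi eW]]]]] [i' [j' [r' [q' [ri' qj' rj' qi' eW']]]]].
exists (i' \oc r + j' \oc q), (i \oc r' + j \oc q').
rewrite !compDl !compDr !compA !(comp_eql _ ri, comp_eql _ qj, comp_eql _ rj,
  comp_eql _ qi, comp_eql _ ri', comp_eql _ qj', comp_eql _ rj', comp_eql _ qi').
by rewrite !compc0 !comp0c !compc1 !addr0 !add0r.
Qed.

Lemma nat_iso_compA (A B C D : precat) (G : functor C D) (F : functor B C)
    (E : functor A B) (K : functor A D) :
  nat_iso (G \oF (F \oF E)) K -> nat_iso (G \oF F \oF E) K.
Proof. by []. Qed.

(** The isomorphism of functors is absorbed into the other maps, so that the first injection is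
    literally [fmap F m], as the comparison of complements by [is_biproduct_unique] requires. *)
Lemma nat_iso_biproduct (A B V : precat) (E : functor B V) (j : functor A B)
    (F : functor A V) (x y : A) (m : hom x y) (n : hom y x)
    (b : B) (k : hom b (j y)) (l : hom (j y) b) :
  nat_iso (E \oF j) F -> is_biproduct (fmap j m) k (fmap j n) l ->
  exists (k' : hom (E b) (F y)) (l' : hom (F y) (E b)) (n' : hom (F y) (F x)),
    is_biproduct (fmap F m) k' n' l'.
Proof.
move=> [th [th_i th_n]] /(fmap_biproduct E) bp.
have [tx [txK Ktx]] := th_i x; have [ty [tyK Kty]] := th_i y.
have {}bp := is_biproduct_iso (is_biproduct_iso1 bp txK Ktx) tyK Kty.
have mE : th y \oc (fmap E (fmap j m) \oc tx) = fmap F m.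
  have /= e := th_n _ _ m.
  by rewrite compA e -compA Ktx compc1.
by rewrite mE in bp; do 3 eexists; exact: bp.
Qed.

Section StronglyGenerated.
Variables (A : addcat) (C : tricat) (J : functor A C).
Let D := strongly_generated (obj_image J).
Let JD : functor A D := strong_gen_embed J.
Let H : D -> Prop := obj_image JD.

Lemma sval_shiftz (i : int) (X : D) : sval (shiftz i X) = shiftz i (sval X).
Proof.
have it (n : nat) (F : functor D D) (G : functor C C) :
    (forall X, sval (F X) = G (sval X)) ->
    sval (iter n (F : D -> D) X) = iter n (G : C -> C) (sval X).
  by move=> FG; elim: n => //= n <-; apply: FG.
by case: i => n; apply: it.
Qed.

Lemma strong_gen_connective : connective (obj_image J) -> connective H.
Proof.
move=> conn _ _ [X ->] [Y ->] i i0.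
change (forall f : @hom C (J X) (sval (shiftz i (JD Y))), f = 0).
rewrite sval_shiftz => f.
by apply: (conn _ _ _ _ i i0 f); [exists X | exists Y].
Qed.

Lemma strong_gen_zero : exists2 Z : D, is_zero_obj Z & H Z.
Proof.
have [Z Z0] := (addcatP A).1; exists (JD Z); last by exists Z.
exact: (fmap_zero_obj JD Z0).
Qed.

Lemma strong_gen_sum (X Y W : D) : H X -> H Y -> direct_sum X Y W ->
  exists2 W', H W' & isomorphic W W'.
Proof.
move=> [a ->] [b ->] s; have [c sc] := (addcatP A).2 a b.
exists (JD c); first by exists c.
exact: direct_sum_unique s (fmap_direct_sum JD sc).
Qed.

(** Strong generation speaks of classes of objects of [C], whereas [P] is defined on the
    subcategory; it is applied to the objects that are generated and satisfy [P], and proof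
    irrelevance makes this meaningful. *)
Lemma strong_gen_ind (P : D -> Prop) : is_tri_sub P ->
  (forall X, H X -> P X) -> forall X, P X.
Proof.
move=> triP HP; case=> X gX.
suff [gX' PX] : exists gX', P (exist _ X gX').
  by have -> : gX = gX' by apply: Prop_irrelevance.
pose triG := strong_gen_tri_sub (obj_image J).
apply: (gX (fun Z => exists gZ, P (exist _ Z gZ))) => [|_ [a ->]]; last first.
  by exists (@strong_gen_image A C J a); apply: HP; exists a.
split.
- move=> Y Z YZ [gY PY]; exists (tri_sub_iso triG YZ gY).
  exact: (@tri_sub_iso _ _ triP (exist _ Y gY) (exist _ Z _) YZ PY).
- have [[Z gZ] Z0 PZ] := tri_sub_zero triP.
  by exists Z; [apply: (sub_zero Z0) | exists gZ].
- move=> Y Z W s [gY PY] [gZ PZ]; exists (tri_sub_sum triG s gY gZ).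
  exact: (@tri_sub_sum _ _ triP (exist _ Y gY) (exist _ Z gZ) (exist _ W _) s PY PZ).
- move=> Y [gY PY]; eexists.
  exact: (@tri_sub_shift _ _ triP (exist _ Y gY) PY).
- move=> Y [gY PY]; eexists.
  exact: (@tri_sub_unshift _ _ triP (exist _ Y gY) PY).
move=> Y Z W f g h d [gY PY] [gZ PZ]; exists (tri_sub_cone triG d gY gZ).
exact: (@tri_sub_cone _ _ triP (exist _ Y gY) (exist _ Z gZ) (exist _ W _) f g h d PY PZ).
Qed.

Hypothesis J_emb : full_embedding J.
Hypothesis J_conn : connective (obj_image J).
Let H_conn := strong_gen_connective J_conn.

Lemma strong_gen_weight : is_weight_structure (conn_weight H).
Proof.
exact: (conn_weight_structure H_conn strong_gen_zero strong_gen_ind).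
Qed.

Lemma strong_gen_weight_bounded : w_bounded (conn_weight H).
Proof. exact: (conn_weight_bounded H_conn strong_gen_zero strong_gen_ind). Qed.

Lemma strong_gen_heart (X : A) : heart_class (conn_weight H) (strong_gen_embed J X).
Proof. by apply: (conn_weight_heart H_conn); exists X. Qed.

(** The heart is weakly idempotent complete, so [F] extends to [wKar A], and [E] is this extension
    after [e]. For essential surjectivity, an object [X] of the heart is a complement of some [F m]
    with [m] a split monomorphism of [A]; a complement of [j m] exists in [B], and [E] sends it to
    another complement of [F m]. *)
Lemma wic_strong_gen_equivalence (B : addcat) (j : functor A B)
    (e : functor B (wKar A)) :
  weakly_idempotent_complete B -> fully_faithful e ->
  nat_iso (e \oF j) (wKar_embed A) ->
  exists E : functor B (heart (conn_weight H)), is_equivalence E /\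
    nat_iso (E \oF j) (corestrict (F := strong_gen_embed J) strong_gen_heart).
Proof.
move=> B_wic /fully_faithfulP[fa_e fu_e] ej.
pose F := corestrict (F := strong_gen_embed J) strong_gen_heart.
have [/fully_faithfulP[fa_J fu_J] _] := J_emb.
have fa_F : faithful F := fa_J.
have fu_F : full F := fu_J.
have V_wic : weakly_idempotent_complete (heart (conn_weight H)).
  exact: heart_wic strong_gen_weight.
pose E0 := wKar_ext F V_wic.
have Ej : nat_iso (E0 \oF e \oF j) F.
  apply: nat_iso_compA.
  exact: nat_iso_trans (nat_iso_comp E0 ej) (wKar_ext_iso F V_wic (@kar_embed_wKar A)).
exists (E0 \oF e); split=> //; apply/is_equivalenceP; split.
- by apply: functor_comp_faithful fa_e; apply: wKar_ext_faithful.
- by apply: functor_comp_full fu_e; apply: wKar_ext_full.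
move=> X.
have /wKar_classP[_ [_ [[x ->] [y ->] [i [k [r [q bp]]]]]]] :=
  conn_weight_heart_wKar H_conn strong_gen_zero strong_gen_sum strong_gen_ind (svalP X).
have [m mE] := fu_F x y i; have [n nE] := fu_F y x r.
have nm : n \oc m = idc x.
  by apply: fa_F; rewrite fmapM mE nE fmap1; case: bp.
move/wicP: B_wic => B_wic.
have [|b [kb [qb bpB]]] := B_wic _ _ (fmap j m) (fmap j n).
  by rewrite -fmapM nm fmap1.
exists b; have [k' [l' [n' {}bpB]]] := nat_iso_biproduct Ej bpB.
have bpX : @is_biproduct (heart (conn_weight H)) (F x) X (F y) (fmap F m) k r q.
  by have [h1 h2 h3 h4 h5] := bp; rewrite mE; split.
exact: is_biproduct_unique bpB bpX.
Qed.

End StronglyGenerated.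

(** * Quotients of preadditive categories *)

Record hom_ideal (P : precat) := HomIdeal {
  ideal_mem : forall X Y : P, hom X Y -> Prop;
  ideal_mem0 : forall X Y, ideal_mem (0 : hom X Y);
  ideal_memB : forall X Y (f g : hom X Y),
    ideal_mem f -> ideal_mem g -> ideal_mem (f - g);
  ideal_memMl : forall X Y Z (g : hom Y Z) (f : hom X Y),
    ideal_mem f -> ideal_mem (g \oc f);
  ideal_memMr : forall X Y Z (g : hom Y Z) (f : hom X Y),
    ideal_mem g -> ideal_mem (g \oc f)
}.

Section Quotient.
Variables (P : precat) (I : hom_ideal P).

Section QuotientHom.
Variables X Y : P.

Definition ideal_pred : {pred hom X Y} := fun f => `[< ideal_mem I f >].

Fact ideal_pred_zmod : zmod_closed ideal_pred.
Proof.
split=> [|f g]; first by apply/asboolP; apply: ideal_mem0.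
by move=> /asboolP If /asboolP Ig; apply/asboolP; apply: ideal_memB.
Qed.
HB.instance Definition _ :=
  GRing.isZmodClosed.Build _ ideal_pred ideal_pred_zmod.

Definition quot_hom := {ideal_quot ideal_pred}.
HB.instance Definition _ := GRing.Zmodule.on quot_hom.

Definition quot_class (f : hom X Y) : quot_hom := \pi_quot_hom f.

Lemma quot_classP (f g : hom X Y) :
  quot_class f = quot_class g <-> ideal_mem I (f - g).
Proof.
rewrite /quot_class; split.
  by move/eqP; rewrite -Quotient.idealrBE => /asboolP.
by move=> Ifg; apply/eqP; rewrite -Quotient.idealrBE; apply/asboolP.
Qed.

Lemma quot_classD (f g : hom X Y) :
  quot_class (f + g) = quot_class f + quot_class g.
Proof. by rewrite /quot_class raddfD. Qed.

Lemma quot_classN (f : hom X Y) : quot_class (- f) = - quot_class f.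
Proof. by rewrite /quot_class raddfN. Qed.

Lemma quot_class0P (f : hom X Y) : quot_class f = 0 <-> ideal_mem I f.
Proof.
by rewrite -{2}[f]subr0 -quot_classP; split=> ->; rewrite /quot_class raddf0.
Qed.

Lemma quot_class_surj (u : quot_hom) : exists f, quot_class f = u.
Proof. by exists (repr u); apply: reprK. Qed.

End QuotientHom.

Definition quot_comp X Y Z (g : quot_hom Y Z) (f : quot_hom X Y) : quot_hom X Z :=
  quot_class (repr g \oc repr f).

Lemma quot_compE X Y Z (g : hom Y Z) (f : hom X Y) :
  quot_comp (quot_class g) (quot_class f) = quot_class (g \oc f).
Proof.
apply/quot_classP; set g' := repr _; set f' := repr _.
have Ig : ideal_mem I (g' - g) by apply/quot_classP/reprK.
have If : ideal_mem I (f' - f) by apply/quot_classP/reprK.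
have -> : g' \oc f' - g \oc f = (g' - g) \oc f' - (g \oc (- (f' - f))).
  by rewrite compBl compNr compBr; zmod_eq.
apply: ideal_memB; [exact: ideal_memMr | apply: ideal_memMl; rewrite -sub0r].
by apply: ideal_memB => //; apply: ideal_mem0.
Qed.

Fact quot_comp1c X Y (f : quot_hom X Y) : quot_comp (quot_class (idc Y)) f = f.
Proof. by have [f' <-] := quot_class_surj f; rewrite quot_compE comp1c. Qed.

Fact quot_compc1 X Y (f : quot_hom X Y) : quot_comp f (quot_class (idc X)) = f.
Proof. by have [f' <-] := quot_class_surj f; rewrite quot_compE compc1. Qed.

Fact quot_compA X Y Z T (h : quot_hom Z T) (g : quot_hom Y Z) (f : quot_hom X Y) :
  quot_comp h (quot_comp g f) = quot_comp (quot_comp h g) f.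
Proof.
have [f' <-] := quot_class_surj f; have [g' <-] := quot_class_surj g.
by have [h' <-] := quot_class_surj h; rewrite !quot_compE compA.
Qed.

Fact quot_compDl X Y Z (g g' : quot_hom Y Z) (f : quot_hom X Y) :
  quot_comp (g + g') f = quot_comp g f + quot_comp g' f.
Proof.
have [f1 <-] := quot_class_surj f; have [g1 <-] := quot_class_surj g.
have [g2 <-] := quot_class_surj g'.
by rewrite -quot_classD !quot_compE compDl quot_classD.
Qed.

Fact quot_compDr X Y Z (g : quot_hom Y Z) (f f' : quot_hom X Y) :
  quot_comp g (f + f') = quot_comp g f + quot_comp g f'.
Proof.
have [f1 <-] := quot_class_surj f; have [g1 <-] := quot_class_surj g.
have [f2 <-] := quot_class_surj f'.
by rewrite -quot_classD !quot_compE compDr quot_classD.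
Qed.

Definition quot : precat :=
  @Precat P (fun X Y => quot_hom X Y) (fun X => quot_class (idc X)) quot_comp
    quot_comp1c quot_compc1 quot_compA quot_compDl quot_compDr.

Definition quot_functor : functor P quot :=
  @Functor P quot id (fun X Y f => quot_class f) (fun _ => erefl)
    (fun X Y Z g f => esym (quot_compE g f)) (fun X Y f g => quot_classD f g).

End Quotient.

Section QuotientFunctor.
Variables (P Q : precat) (I : hom_ideal P) (K : hom_ideal Q) (F : functor P Q).
Hypothesis FI : forall (X Y : P) (f : hom X Y),
  ideal_mem I f -> ideal_mem K (fmap F f).

Definition quot_map_hom (X Y : P) (u : quot_hom I X Y) : quot_hom K (F X) (F Y) :=
  quot_class K (fmap F (repr u)).

Lemma quot_map_homE (X Y : P) (f : hom X Y) :
  quot_map_hom (quot_class I f) = quot_class K (fmap F f).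
Proof.
apply/quot_classP; rewrite -fmapB; apply: FI.
by apply/quot_classP/reprK.
Qed.

Fact quot_map1 (X : P) : quot_map_hom (quot_class I (idc X)) = quot_class K (idc (F X)).
Proof. by rewrite quot_map_homE fmap1. Qed.

Fact quot_mapM (X Y Z : P) (v : quot_hom I Y Z) (u : quot_hom I X Y) :
  quot_map_hom (quot_comp v u) = quot_comp (quot_map_hom v) (quot_map_hom u).
Proof.
have [f <-] := quot_class_surj u; have [g <-] := quot_class_surj v.
by rewrite quot_compE !quot_map_homE quot_compE fmapM.
Qed.

Fact quot_mapD (X Y : P) (u v : quot_hom I X Y) :
  quot_map_hom (u + v) = quot_map_hom u + quot_map_hom v.
Proof.
have [f <-] := quot_class_surj u; have [g <-] := quot_class_surj v.
by rewrite -quot_classD !quot_map_homE fmapD quot_classD.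
Qed.

Definition quot_map : functor (quot I) (quot K) :=
  @Functor (quot I) (quot K) F quot_map_hom quot_map1 quot_mapM quot_mapD.

End QuotientFunctor.

(** * Graded complexes *)

(* A complex is modelled by its total object [gob] in [B], with a family [ge] of
   endomorphisms playing the role of the projectors onto the graded pieces; a
   morphism [f] has degree [k] when [f \oc ge n = ge (n + k) \oc f].  Nothing is
   required of [ge], so that shifts, cones and homotopies involve no dependent
   types. *)
Section GradedComplexes.
Variable B : addcat.

Record gcx := Gcx {
  gob : B;
  ge : int -> hom gob gob;
  gd : hom gob gob;
  gde : forall n, gd \oc ge n = ge (n + 1) \oc gd;
  gdd : gd \oc gd = 0
}.

Section GradedHom.
Variables X Y : gcx.

Definition gc_pred : {pred hom (gob X) (gob Y)} := fun f =>
  `[< (forall n, f \oc ge X n = ge Y n \oc f) /\ f \oc gd X = gd Y \oc f >].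

Fact gc_pred_zmod : zmod_closed gc_pred.
Proof.
split=> [|f g]; first by apply/asboolP; split=> [n|]; rewrite compc0 comp0c.
move=> /asboolP[fe fd] /asboolP[ge' gd']; apply/asboolP.
by split=> [n|]; rewrite compBl compBr ?fe ?ge' ?fd ?gd'.
Qed.
HB.instance Definition _ := GRing.isZmodClosed.Build _ gc_pred gc_pred_zmod.

Record gchom := GcHom {
  gc_val :> hom (gob X) (gob Y);
  _ : gc_val \in gc_pred
}.
HB.instance Definition _ := [isSub for gc_val].
HB.instance Definition _ := [Choice of gchom by <:].
HB.instance Definition _ := [SubChoice_isSubZmodule of gchom by <:].

Fact gc_mkP (f : hom (gob X) (gob Y)) :
  (forall n, f \oc ge X n = ge Y n \oc f) -> f \oc gd X = gd Y \oc f ->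
  f \in gc_pred.
Proof. by move=> fe fd; apply/asboolP. Qed.

Definition gc_mk f fe fd : gchom := GcHom (@gc_mkP f fe fd).

Lemma gc_e (f : gchom) n : gc_val f \oc ge X n = ge Y n \oc gc_val f.
Proof. by have /asboolP[] := valP f. Qed.

Lemma gc_d (f : gchom) : gc_val f \oc gd X = gd Y \oc gc_val f.
Proof. by have /asboolP[] := valP f. Qed.

End GradedHom.

Definition gc_id (X : gcx) : gchom X X :=
  gc_mk (fun n => etrans (comp1c _) (esym (compc1 _)))
        (etrans (comp1c _) (esym (compc1 _))).

Fact gc_comp_e (X Y Z : gcx) (g : gchom Y Z) (f : gchom X Y) n :
  gc_val g \oc gc_val f \oc ge X n = ge Z n \oc (gc_val g \oc gc_val f).
Proof. by rewrite -compA gc_e compA gc_e compA. Qed.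

Fact gc_comp_d (X Y Z : gcx) (g : gchom Y Z) (f : gchom X Y) :
  gc_val g \oc gc_val f \oc gd X = gd Z \oc (gc_val g \oc gc_val f).
Proof. by rewrite -compA gc_d compA gc_d compA. Qed.

Definition gc_comp (X Y Z : gcx) (g : gchom Y Z) (f : gchom X Y) : gchom X Z :=
  gc_mk (gc_comp_e g f) (gc_comp_d g f).

Fact gc_comp1c X Y (f : gchom X Y) : gc_comp (gc_id Y) f = f.
Proof. by apply: val_inj; apply: comp1c. Qed.

Fact gc_compc1 X Y (f : gchom X Y) : gc_comp f (gc_id X) = f.
Proof. by apply: val_inj; apply: compc1. Qed.

Fact gc_compA X Y Z T (h : gchom Z T) (g : gchom Y Z) (f : gchom X Y) :
  gc_comp h (gc_comp g f) = gc_comp (gc_comp h g) f.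
Proof. by apply: val_inj; apply: compA. Qed.

Fact gc_compDl X Y Z (g g' : gchom Y Z) (f : gchom X Y) :
  gc_comp (g + g') f = gc_comp g f + gc_comp g' f.
Proof. by apply: val_inj; apply: compDl. Qed.

Fact gc_compDr X Y Z (g : gchom Y Z) (f f' : gchom X Y) :
  gc_comp g (f + f') = gc_comp g f + gc_comp g f'.
Proof. by apply: val_inj; apply: compDr. Qed.

Definition GC : precat :=
  @Precat gcx (fun X Y => gchom X Y) gc_id gc_comp
    gc_comp1c gc_compc1 gc_compA gc_compDl gc_compDr.

Definition gc_homotopy (X Y : GC) (f s : hom (gob X) (gob Y)) : Prop :=
  (forall n, s \oc ge X (n + 1) = ge Y n \oc s) /\
  f = gd Y \oc s + s \oc gd X.

Definition gc_null (X Y : GC) (f : hom X Y) : Prop :=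
  exists s, gc_homotopy (gc_val f) s.

Fact gc_null0 (X Y : GC) : gc_null (0 : hom X Y).
Proof.
exists 0; split=> [n|]; first by rewrite compc0 comp0c.
by rewrite compc0 comp0c addr0.
Qed.

Fact gc_nullB (X Y : GC) (f g : hom X Y) : gc_null f -> gc_null g -> gc_null (f - g).
Proof.
move=> [s [se fs]] [t [te gt]]; exists (s - t).
split=> [n|]; first by rewrite compBl compBr se te.
by rewrite /= fs gt compBl compBr; zmod_eq.
Qed.

Fact gc_nullMl (X Y Z : GC) (g : hom Y Z) (f : hom X Y) :
  gc_null f -> gc_null (g \oc f).
Proof.
move=> [s [se fs]]; exists (gc_val g \oc s); split=> [n|].
  by rewrite -compA se compA gc_e compA.
by rewrite /= fs compDr !compA gc_d.
Qed.

Fact gc_nullMr (X Y Z : GC) (g : hom Y Z) (f : hom X Y) :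
  gc_null g -> gc_null (g \oc f).
Proof.
move=> [s [se gs]]; exists (s \oc gc_val f); split=> [n|].
  by rewrite -compA gc_e compA se compA.
by rewrite /= gs compDl -!compA gc_d.
Qed.

Definition gc_ideal : hom_ideal GC :=
  HomIdeal gc_null0 gc_nullB gc_nullMl gc_nullMr.

Definition GK : precat := quot gc_ideal.

End GradedComplexes.

(** * Shifts and mapping cones of graded complexes *)

Section GradedCone.
Variable B : addcat.

Fact gc_shift_e (X : gcx B) n :
  - gd X \oc ge X (n + 1) = ge X (n + 1 + 1) \oc - gd X.
Proof. by rewrite compNl compNr gde. Qed.

Fact gc_shift_d (X : gcx B) : - gd X \oc - gd X = 0.
Proof. by rewrite compNl compNr gdd !oppr0. Qed.

(** The operators are read off from the two proofs: [ge] is taken at [n + 1] and the differential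
    changes sign. *)
Definition gc_shift (X : GC B) : GC B := Gcx (gc_shift_e X) (gc_shift_d X).

Fact gc_unshift_e (X : gcx B) n :
  - gd X \oc ge X (n - 1) = ge X (n + 1 - 1) \oc - gd X.
Proof. by rewrite compNl compNr gde addrAC. Qed.

Definition gc_unshift (X : GC B) : GC B := Gcx (gc_unshift_e X) (gc_shift_d X).

Fact gc_shift_mapP (X Y : GC B) (f : hom X Y) :
  gc_val f \oc gd (gc_shift X) = gd (gc_shift Y) \oc gc_val f.
Proof. by rewrite /= compNl compNr gc_d. Qed.

Definition gc_shift_map (X Y : GC B) (f : hom X Y) :
    hom (gc_shift X) (gc_shift Y) :=
  @gc_mk _ (gc_shift X) (gc_shift Y) (gc_val f) (fun n => gc_e f (n + 1))
    (gc_shift_mapP f).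

Definition gc_unshift_map (X Y : GC B) (f : hom X Y) :
    hom (gc_unshift X) (gc_unshift Y) :=
  @gc_mk _ (gc_unshift X) (gc_unshift Y) (gc_val f) (fun n => gc_e f (n - 1))
    (gc_shift_mapP f).

Fact gc_shift_map1 X : gc_shift_map (idc X) = idc (gc_shift X).
Proof. exact: val_inj. Qed.
Fact gc_shift_mapM X Y Z (g : hom Y Z) (f : hom X Y) :
  gc_shift_map (g \oc f) = gc_shift_map g \oc gc_shift_map f.
Proof. exact: val_inj. Qed.
Fact gc_shift_mapD X Y (f g : hom X Y) :
  gc_shift_map (f + g) = gc_shift_map f + gc_shift_map g.
Proof. exact: val_inj. Qed.

Definition gc_shift_functor : functor (GC B) (GC B) :=
  Functor gc_shift_map1 gc_shift_mapM gc_shift_mapD.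

Fact gc_unshift_map1 X : gc_unshift_map (idc X) = idc (gc_unshift X).
Proof. exact: val_inj. Qed.
Fact gc_unshift_mapM X Y Z (g : hom Y Z) (f : hom X Y) :
  gc_unshift_map (g \oc f) = gc_unshift_map g \oc gc_unshift_map f.
Proof. exact: val_inj. Qed.
Fact gc_unshift_mapD X Y (f g : hom X Y) :
  gc_unshift_map (f + g) = gc_unshift_map f + gc_unshift_map g.
Proof. exact: val_inj. Qed.

Definition gc_unshift_functor : functor (GC B) (GC B) :=
  Functor gc_unshift_map1 gc_unshift_mapM gc_unshift_mapD.

Fact gc_shift_null (X Y : GC B) (f : hom X Y) :
  ideal_mem (gc_ideal B) f -> ideal_mem (gc_ideal B) (fmap gc_shift_functor f).
Proof.
move=> [s [se fs]]; exists (- s); split=> [n|] /=.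
  by rewrite compNl compNr se.
by rewrite !compNl !compNr !opprK.
Qed.

Fact gc_unshift_null (X Y : GC B) (f : hom X Y) :
  ideal_mem (gc_ideal B) f -> ideal_mem (gc_ideal B) (fmap gc_unshift_functor f).
Proof.
move=> [s [se fs]]; exists (- s); split=> [n|] /=.
  by rewrite compNl compNr -se addrAC.
by rewrite !compNl !compNr !opprK.
Qed.

Definition gk_shift : functor (GK B) (GK B) := quot_map gc_shift_null.
Definition gk_unshift : functor (GK B) (GK B) := quot_map gc_unshift_null.

Notation cl := (quot_class (gc_ideal B)).

Lemma cl_iso (X Y : GC B) (f : hom X Y) : is_iso f -> @is_iso (GK B) X Y (cl f).
Proof. exact: (@fmap_iso _ _ (quot_functor (gc_ideal B))). Qed.

Lemma cl_comp (X Y Z : GC B) (g : hom Y Z) (f : hom X Y) :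
  @comp (GK B) X Y Z (cl g) (cl f) = cl (g \oc f).
Proof. exact: quot_compE. Qed.

Lemma cl_id (X : GC B) : @idc (GK B) X = cl (idc X).
Proof. by []. Qed.

Lemma cl_eq (X Y : GC B) (f g : hom X Y) (s : hom (gob X) (gob Y)) :
  gc_homotopy (gc_val f - gc_val g) s -> cl f = cl g.
Proof. by move=> h; apply/quot_classP; exists s. Qed.

Lemma gk_shiftE (X Y : GC B) (f : hom X Y) :
  fmap gk_shift (cl f : @hom (GK B) X Y) = cl (gc_shift_map f).
Proof. exact: (quot_map_homE gc_shift_null f). Qed.

Lemma gk_nat_iso (F G : functor (GC B) (GC B))
    (HF : forall (X Y : GC B) (f : hom X Y),
      ideal_mem (gc_ideal B) f -> ideal_mem (gc_ideal B) (fmap F f))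
    (HG : forall (X Y : GC B) (f : hom X Y),
      ideal_mem (gc_ideal B) f -> ideal_mem (gc_ideal B) (fmap G f)) :
  nat_iso (G \oF F) (functor_id _) ->
  nat_iso (quot_map HG \oF quot_map HF) (functor_id (GK B)).
Proof.
move=> [eta [eta_i eta_n]]; exists (fun X => cl (eta X)); split=> [X | X Y u].
  by apply: cl_iso; apply: eta_i.
have [f <-] := quot_class_surj u.
rewrite /= (quot_map_homE HF) (quot_map_homE HG).
have := congr1 (@quot_class _ (gc_ideal B) _ _) (eta_n _ _ f).
by move=> e; apply: etrans (etrans e _); [|symmetry]; apply: quot_compE.
Qed.

Fact gk_shiftK : nat_iso (gk_unshift \oF gk_shift) (functor_id (GK B)).
Proof.
apply: gk_nat_iso; pose S (X : GC B) : GC B := gc_unshift (gc_shift X).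
have eta_e (X : GC B) n : idc (gob X) \oc ge (S X) n = ge X n \oc idc (gob X).
  by rewrite /= subrK comp1c compc1.
have eta_d (X : GC B) : idc (gob X) \oc gd (S X) = gd X \oc idc (gob X).
  by rewrite /= opprK comp1c compc1.
exists (fun X => @gc_mk _ (S X) X (idc (gob X)) (eta_e X) (eta_d X)).
split=> [X | X Y f]; last first.
  by apply: val_inj; rewrite /= comp1c compc1.
have eta'_e n : idc (gob X) \oc ge X n = ge (S X) n \oc idc (gob X).
  by rewrite /= subrK comp1c compc1.
have eta'_d : idc (gob X) \oc gd X = gd (S X) \oc idc (gob X).
  by rewrite /= opprK comp1c compc1.
exists (@gc_mk _ X (S X) (idc (gob X)) eta'_e eta'_d).
by split; apply: val_inj; rewrite /= comp1c.
Qed.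

Fact gk_unshiftK : nat_iso (gk_shift \oF gk_unshift) (functor_id (GK B)).
Proof.
apply: gk_nat_iso; pose S (X : GC B) : GC B := gc_shift (gc_unshift X).
have eta_e (X : GC B) n : idc (gob X) \oc ge (S X) n = ge X n \oc idc (gob X).
  by rewrite /= addrK comp1c compc1.
have eta_d (X : GC B) : idc (gob X) \oc gd (S X) = gd X \oc idc (gob X).
  by rewrite /= opprK comp1c compc1.
exists (fun X => @gc_mk _ (S X) X (idc (gob X)) (eta_e X) (eta_d X)).
split=> [X | X Y f]; last first.
  by apply: val_inj; rewrite /= comp1c compc1.
have eta'_e n : idc (gob X) \oc ge X n = ge (S X) n \oc idc (gob X).
  by rewrite /= addrK comp1c compc1.
have eta'_d : idc (gob X) \oc gd X = gd (S X) \oc idc (gob X).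
  by rewrite /= opprK comp1c compc1.
exists (@gc_mk _ X (S X) (idc (gob X)) eta'_e eta'_d).
by split; apply: val_inj; rewrite /= comp1c.
Qed.

Section Cone.
Variables (X Y : GC B) (f : hom X Y).

(* The cone of [f] is [X[1] (+) Y]; its maps [j] from and [p] to [X] have degrees
   -1 and 1. *)
Record cone_data := ConeData {
  cone_ob : GC B;
  cone_inj1 : hom (gob X) (gob cone_ob);
  cone_inj2 : hom (gob Y) (gob cone_ob);
  cone_proj1 : hom (gob cone_ob) (gob X);
  cone_proj2 : hom (gob cone_ob) (gob Y);
  cone_biproduct : is_biproduct cone_inj1 cone_inj2 cone_proj1 cone_proj2;
  cone_geE : forall n, ge cone_ob n =
    cone_inj1 \oc ge X (n + 1) \oc cone_proj1 + cone_inj2 \oc ge Y n \oc cone_proj2;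
  cone_gdE : gd cone_ob =
    cone_inj2 \oc gd Y \oc cone_proj2 - cone_inj1 \oc gd X \oc cone_proj1
    + cone_inj2 \oc gc_val f \oc cone_proj1
}.

(** Biproducts of [B] merely exist, so the cone is first obtained as a proposition and then chosen.
    Afterwards only the equations recorded in [cone_data] are used. *)
Lemma cone_exists : exists _ : cone_data, True.
Proof.
have [W [j [i [p [q bp]]]]] := (addcatP B).2 (gob X) (gob Y).
have [pj qi pi qj _] := bp.
pose piE := (compA, compDl, compDr, compNl, compNr, compc0, comp0c, compc1, comp1c,
  pj, comp_eqlr pj, qi, comp_eqlr qi, pi, comp_eqlr pi, qj, comp_eqlr qj).
pose e n := j \oc ge X (n + 1) \oc p + i \oc ge Y n \oc q.
pose d := i \oc gd Y \oc q - j \oc gd X \oc p + i \oc gc_val f \oc p.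
have de n : d \oc e n = e (n + 1) \oc d.
  rewrite /d /e !piE !(comp_eql _ (gde _ _)) (comp_eql _ (gc_e f _)) !piE.
  by zmod_eq.
have dd : d \oc d = 0.
  rewrite /d !piE !(comp_eql _ (gdd _)) (comp_eql _ (gc_d f)) !piE.
  by zmod_eq.
by exists (@ConeData (Gcx de dd) j i p q bp (fun=> erefl) erefl).
Qed.

Definition the_cone : cone_data := projT1 (cid cone_exists).
Definition cone : GC B := cone_ob the_cone.
Definition cone_j : hom (gob X) (gob cone) := cone_inj1 the_cone.
Definition cone_i : hom (gob Y) (gob cone) := cone_inj2 the_cone.
Definition cone_p : hom (gob cone) (gob X) := cone_proj1 the_cone.
Definition cone_q : hom (gob cone) (gob Y) := cone_proj2 the_cone.

Lemma cone_pj : cone_p \oc cone_j = idc _. Proof. by case: (cone_biproduct the_cone). Qed.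
Lemma cone_qi : cone_q \oc cone_i = idc _. Proof. by case: (cone_biproduct the_cone). Qed.
Lemma cone_pi : cone_p \oc cone_i = 0. Proof. by case: (cone_biproduct the_cone). Qed.
Lemma cone_qj : cone_q \oc cone_j = 0. Proof. by case: (cone_biproduct the_cone). Qed.
Lemma cone_1 : cone_j \oc cone_p + cone_i \oc cone_q = idc _.
Proof. by case: (cone_biproduct the_cone). Qed.

Let geE n : ge cone n = cone_j \oc ge X (n + 1) \oc cone_p + cone_i \oc ge Y n \oc cone_q.
Proof. exact: cone_geE. Qed.
Let gdE : gd cone = cone_i \oc gd Y \oc cone_q - cone_j \oc gd X \oc cone_p
  + cone_i \oc gc_val f \oc cone_p.
Proof. exact: cone_gdE. Qed.
Let piE := (geE, gdE, compA, compDl, compDr, compNl, compNr, compc0, comp0c,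
  compc1, comp1c, cone_pj, comp_eqlr cone_pj, cone_qi, comp_eqlr cone_qi,
  cone_pi, comp_eqlr cone_pi, cone_qj, comp_eqlr cone_qj).

Lemma cone_dj : gd cone \oc cone_j = cone_i \oc gc_val f - cone_j \oc gd X.
Proof. by rewrite !piE; zmod_eq. Qed.
Lemma cone_di : gd cone \oc cone_i = cone_i \oc gd Y.
Proof. by rewrite !piE; zmod_eq. Qed.
Lemma cone_pd : cone_p \oc gd cone = - (gd X \oc cone_p).
Proof. by rewrite !piE; zmod_eq. Qed.
Lemma cone_qd : cone_q \oc gd cone = gd Y \oc cone_q + gc_val f \oc cone_p.
Proof. by rewrite !piE; zmod_eq. Qed.
Lemma cone_ej n : cone_j \oc ge X (n + 1) = ge cone n \oc cone_j.
Proof. by rewrite !piE; zmod_eq. Qed.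
Lemma cone_ei n : cone_i \oc ge Y n = ge cone n \oc cone_i.
Proof. by rewrite !piE; zmod_eq. Qed.
Lemma cone_pe n : cone_p \oc ge cone n = ge X (n + 1) \oc cone_p.
Proof. by rewrite !piE; zmod_eq. Qed.
Lemma cone_qe n : cone_q \oc ge cone n = ge Y n \oc cone_q.
Proof. by rewrite !piE; zmod_eq. Qed.

Lemma cone_ext (V : B) (u v : hom (gob cone) V) :
  u \oc cone_j = v \oc cone_j -> u \oc cone_i = v \oc cone_i -> u = v.
Proof.
by move=> uj ui; rewrite -[u]compc1 -[v]compc1 -cone_1 !compDr !compA uj ui.
Qed.

Definition cone_in : hom Y cone := gc_mk (fun n => cone_ei n) (esym cone_di).
Definition cone_out : hom cone (gc_shift X) :=
  @gc_mk _ cone (gc_shift X) cone_p (fun n => cone_pe n)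
    (etrans cone_pd (esym (compNl _ _))).

End Cone.

End GradedCone.

(** * The triangulated category of graded complexes *)

(** Rewriting systems for the computations below: composites are expanded and associated to the
    left, and each relation also appears in its [comp_eqlr] form. The differentials of cones are
    eliminated and the operators [ge] are moved to the left; the linear identity that remains is
    left to [zmod_eq]. *)
Definition addE := (compA, compDl, compDr, compNl, compNr, compc0, comp0c, compc1,
  comp1c).
Definition coneE (B : addcat) (X Y : GC B) (f : hom X Y) :=
  (cone_pj f, comp_eqlr (cone_pj f), cone_qi f, comp_eqlr (cone_qi f),
   cone_pi f, comp_eqlr (cone_pi f), cone_qj f, comp_eqlr (cone_qj f),
   cone_dj f, comp_eqlr (cone_dj f), cone_di f, comp_eqlr (cone_di f),
   cone_pd f, comp_eqlr (cone_pd f), cone_qd f, comp_eqlr (cone_qd f)).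
Definition coneEe (B : addcat) (X Y : GC B) (f : hom X Y) :=
  (cone_ej f, fun n => comp_eqlr (cone_ej f n),
   cone_ei f, fun n => comp_eqlr (cone_ei f n),
   cone_pe f, fun n => comp_eqlr (cone_pe f n),
   cone_qe f, fun n => comp_eqlr (cone_qe f n)).
Definition gcE (B : addcat) (X Y : GC B) (f : hom X Y) :=
  (gc_d f, comp_eqlr (gc_d f)).
Definition gcEe (B : addcat) (X Y : GC B) (f : hom X Y) :=
  (gc_e f, fun n => comp_eqlr (gc_e f n)).

Section GradedTriangles.
Variable B : addcat.
Local Notation GC := (GC B).
Local Notation GK := (GK B).
Local Notation cl := (quot_class (gc_ideal B)).

(** The map of cones is a triangular matrix with [a] and [b] on the diagonal and the homotopy [s]
    from [b \oc f] to [f' \oc a] off it. Its two squares commute strictly. *)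
Lemma std_morph (X Y X' Y' : GC) (f : hom X Y) (f' : hom X' Y')
    (a : hom X X') (b : hom Y Y') :
  ideal_mem (gc_ideal B) (b \oc f - f' \oc a) ->
  exists c : hom (cone f) (cone f'),
    c \oc cone_in f = cone_in f' \oc b /\
    cone_out f' \oc c = gc_shift_map a \oc cone_out f.
Proof.
move=> [s [se]] /= bfa.
have {}bfa : gc_val b \oc gc_val f =
    gc_val f' \oc gc_val a + (gd Y' \oc s + s \oc gd X).
  by rewrite -bfa addrC subrK.
pose c := cone_j f' \oc gc_val a \oc cone_p f + cone_i f' \oc gc_val b \oc cone_q f
  + cone_i f' \oc s \oc cone_p f.
have ce n : c \oc ge (cone f) n = ge (cone f') n \oc c.
  by rewrite /c !(addE, coneEe f, coneEe f', gcEe a, gcEe b, fun n => comp_eqlr (se n)).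
have cd : c \oc gd (cone f) = gd (cone f') \oc c.
  rewrite /c !addE; rewrite !(coneE f, coneE f', addE, gcE a, gcE b, comp_eqlr bfa).
  by zmod_eq.
exists (gc_mk ce cd); split; apply: val_inj => /=; rewrite /c.
  by rewrite !(coneE f, addE); zmod_eq.
by rewrite !(coneE f', addE); zmod_eq.
Qed.

(** Extended by zero to the cone, [s] is a homotopy from [t] to a map that vanishes on [Y]; [v] is
    the restriction of that map to [X[1]]. *)
Lemma std_colift (X Y W : GC) (f : hom X Y) (t : hom (cone f) W) :
  ideal_mem (gc_ideal B) (t \oc cone_in f) ->
  exists v : hom (gc_shift X) W, ideal_mem (gc_ideal B) (t - v \oc cone_out f).
Proof.
move=> [s [se]] /= ti.
pose v := gc_val t \oc cone_j f - s \oc gc_val f.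
have ve n : v \oc ge (gc_shift X) n = ge W n \oc v.
  by rewrite /v /= !(addE, coneEe f, gcEe t, gcEe f, fun n => comp_eqlr (se n), se).
have vd : v \oc gd (gc_shift X) = gd W \oc v.
  rewrite /v /= !(addE, gcE f) -(gc_d t).
  rewrite !(addE, coneE f, gcE f, ti); zmod_eq.
exists (@gc_mk _ (gc_shift X) W v ve vd); exists (s \oc cone_q f).
split=> [n|] /=.
  by rewrite !(addE, coneEe f, fun n => comp_eqlr (se n), se).
rewrite -[X in X - _]compc1 -cone_1 /v.
by rewrite !(addE, coneE f, ti); zmod_eq.
Qed.

(** Only the third vertex is compared with a standard cone. Isomorphisms on the first two are
    absorbed in [gk_dist_iso] by a new representative [k] and [gk_iso3]. *)
Definition gk_dist (X Y Z : GK) (f : hom X Y) (g : hom Y Z)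
    (h : hom Z (gk_shift B X)) : Prop :=
  exists (k : @hom GC X Y) (c : @hom GK Z (cone k)),
    [/\ cl k = f, is_iso c, @comp GK _ _ _ c g = cl (cone_in k)
      & h = @comp GK _ _ _ (cl (cone_out k)) c].

Lemma gk_dist_std (X Y : GC) (f : hom X Y) :
  @gk_dist X Y (cone f) (cl f) (cl (cone_in f)) (cl (cone_out f)).
Proof.
exists f, (@idc GK (cone f)); split=> //; first exact: is_iso_id.
  exact: (@comp1c GK).
by rewrite (@compc1 GK).
Qed.

Lemma gk_std_morph (X Y X' Y' : GC) (f : hom X Y) (f' : hom X' Y')
    (a : @hom GK X X') (b : @hom GK Y Y') :
  @comp GK _ _ _ b (cl f) = @comp GK _ _ _ (cl f') a ->
  exists c : @hom GK (cone f) (cone f'),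
    @comp GK _ _ _ c (cl (cone_in f)) = @comp GK _ _ _ (cl (cone_in f')) b /\
    @comp GK _ _ _ (fmap (gk_shift B) a) (cl (cone_out f)) =
    @comp GK _ _ _ (cl (cone_out f')) c.
Proof.
have [al <-] := quot_class_surj a; have [be <-] := quot_class_surj b.
move=> e; have : cl (be \oc f) = cl (f' \oc al) by rewrite -!cl_comp.
move=> /quot_classP/std_morph[c [ci co]].
by exists (cl c); rewrite gk_shiftE !cl_comp ci co.
Qed.

Lemma gk_dist_morph (X Y Z X' Y' Z' : GK)
    (f : hom X Y) (g : hom Y Z) (h : hom Z (gk_shift B X))
    (f' : hom X' Y') (g' : hom Y' Z') (h' : hom Z' (gk_shift B X'))
    (a : hom X X') (b : hom Y Y') :
  gk_dist f g h -> gk_dist f' g' h' -> b \oc f = f' \oc a ->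
  exists c : hom Z Z', c \oc g = g' \oc b /\
    fmap (gk_shift B) a \oc h = h' \oc c.
Proof.
move=> [k [c [<- ci cg ->]]] [k' [c' [<- [d [dc' c'd]] cg' ->]]].
move=> /gk_std_morph[l [l1 l2]]; exists (d \oc l \oc c); split.
  rewrite -!compA cg l1 !compA -cg' compA dc'; by rewrite comp1c.
by rewrite !compA l2 (comp_eql _ c'd) compc1.
Qed.

Lemma gk_dist_colift (X Y Z W : GK) (f : hom X Y) (g : hom Y Z)
    (h : hom Z (gk_shift B X)) (u : hom Z W) :
  gk_dist f g h -> u \oc g = 0 -> exists v, v \oc h = u.
Proof.
move=> [k [c [_ [d [dc cd]] cg ->]]] ug.
have [t tE] := quot_class_surj (u \oc d : @hom GK (cone k) W).
have : @comp GK _ _ _ (u \oc d) (cl (cone_in k)) = 0.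
  by rewrite -cg compA (comp_eql _ dc) compc1.
rewrite -tE cl_comp => /quot_class0P/std_colift[v].
move=> /quot_classP; rewrite -cl_comp tE => e; exists (cl v).
by rewrite compA -e (comp_eql _ dc) compc1.
Qed.

Definition gk_iso3 := tri_iso3 gk_dist_morph gk_dist_colift.

Lemma gk_dist_iso (X Y Z X' Y' Z' : GK)
    (f : hom X Y) (g : hom Y Z) (h : hom Z (gk_shift B X))
    (f' : hom X' Y') (g' : hom Y' Z') (h' : hom Z' (gk_shift B X'))
    (a : hom X X') (b : hom Y Y') (c : hom Z Z') :
  is_iso a -> is_iso b -> is_iso c ->
  b \oc f = f' \oc a -> c \oc g = g' \oc b ->
  fmap (gk_shift B) a \oc h = h' \oc c ->
  gk_dist f g h -> gk_dist f' g' h'.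
Proof.
move=> ai bi ci e1 e2 e3 d.
have [k' kE] := quot_class_surj f'.
rewrite -kE in e1 *.
have [c1 [c1i c1g c1h]] := gk_iso3 d (gk_dist_std k') ai bi e1.
have [b' [b'b bb']] := bi; have [c' [c'c cc']] := ci.
exists k', (c1 \oc c'); split=> //.
- by apply: is_iso_comp => //; exists c.
- rewrite -[LHS]compc1 -bb' !compA -[c1 \oc c' \oc g' \oc b]compA -e2 !compA.
  by rewrite (comp_eql _ c'c) compc1 c1g (comp_eql _ bb') compc1.
by rewrite compA -c1h e3 -compA cc' compc1.
Qed.

Lemma gk_cone_id_zero (X : GC) : @is_zero_obj GK (cone (idc X)).
Proof.
apply/zero_objP; apply/quot_class0P.
exists (cone_j (idc X) \oc cone_q (idc X)); split=> [n|] /=.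
  by rewrite !(addE, coneEe (idc X)).
by rewrite -(cone_1 (idc X)) !(addE, coneE (idc X)) /= ?addE; zmod_eq.
Qed.

Lemma gk_dist_id (X Z : GK) : is_zero_obj Z ->
  gk_dist (idc X) (0 : hom X Z) (0 : hom Z (gk_shift B X)).
Proof.
move=> Z0; have C0 := gk_cone_id_zero X.
exists (@idc GC X), (0 : @hom GK Z (cone (@idc GC X))); split=> //.
- exists 0; rewrite compc0 compc0.
  by move/zero_objP: Z0 => ->; move/zero_objP: C0 => ->.
- by rewrite compc0; case: C0 => C0 _; rewrite [RHS]C0.
by rewrite (@compc0 GK).
Qed.

Lemma gk_dist_cone (X Y : GK) (f : hom X Y) :
  exists Z (g : hom Y Z) (h : hom Z (gk_shift B X)), gk_dist f g h.
Proof.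
have [k <-] := quot_class_surj f.
by exists (cone k), (cl (cone_in k)), (cl (cone_out k)); apply: gk_dist_std.
Qed.

(** The cone of [cone_in f] is the sum of [Y[1]], [X[1]] and [Y], and the two copies of [Y] cancel
    up to homotopy. The component [- f] of [k] in [Y[1]] makes it a chain map; [l] is the projection
    to [X[1]], with [l \oc k] the identity on the nose. *)
Lemma gk_rot_std (X Y : GC) (f : hom X Y) :
  @gk_dist Y (cone f) (gc_shift X) (cl (cone_in f)) (cl (cone_out f))
    (- fmap (gk_shift B) (cl f : @hom GK X Y)).
Proof.
pose g := cone_in f.
pose k := cone_i g \oc cone_j f - cone_j g \oc gc_val f.
have ke n : k \oc ge (gc_shift X) n = ge (cone g) n \oc k.
  by rewrite /k /= ?(addE, coneEe f, coneEe g, gcEe f).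
have kd : k \oc gd (gc_shift X) = gd (cone g) \oc k.
  by rewrite /k /= ?(addE, coneE f, coneE g, gcE f) /=; zmod_eq.
pose l := cone_p f \oc cone_q g.
have le n : l \oc ge (cone g) n = ge (gc_shift X) n \oc l.
  by rewrite /l /= ?(addE, coneEe f, coneEe g).
have ld : l \oc gd (cone g) = gd (gc_shift X) \oc l.
  by rewrite /l /= ?(addE, coneE f, coneE g) /= ?(addE, coneE f); zmod_eq.
pose kk : hom (gc_shift X) (cone g) := @gc_mk _ (gc_shift X) (cone g) k ke kd.
pose ll : hom (cone g) (gc_shift X) := @gc_mk _ (cone g) (gc_shift X) l le ld.
exists g, (cl kk); split=> //.
- exists (cl ll); rewrite !cl_comp; split.
    congr quot_class; apply: val_inj; rewrite /= /l /k.
    by rewrite ?(addE, coneE f, coneE g); zmod_eq.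
  apply: (@cl_eq _ _ _ _ _ (- (cone_j g \oc cone_q f \oc cone_q g))); split=> [n|] /=.
    by rewrite ?(addE, coneEe f, coneEe g).
  apply: cone_ext; rewrite /l /k ?(addE, coneE f, coneE g, gcE f) /=.
    by zmod_eq.
  apply: cone_ext; rewrite ?(addE, coneE f, coneE g, gcE f) /=; zmod_eq.
- rewrite cl_comp.
  apply: (@cl_eq _ _ _ _ _ (- (cone_j g \oc cone_q f))); split=> [n|] /=.
    by rewrite ?(addE, coneEe f, coneEe g).
  apply: cone_ext; rewrite /k ?(addE, coneE f, coneE g, gcE f) /=; zmod_eq.
rewrite gk_shiftE cl_comp -quot_classN; congr quot_class; apply: val_inj => /=.
by rewrite /k ?(addE, coneE g); zmod_eq.
Qed.

Lemma gk_dist_rot1 (X Y Z : GK) (f : hom X Y) (g : hom Y Z)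
    (h : hom Z (gk_shift B X)) :
  gk_dist f g h -> gk_dist g h (- fmap (gk_shift B) f).
Proof.
move=> [k [c [<- [c' [c'c cc']] cg ->]]].
apply: gk_dist_iso (gk_rot_std k).
- exact: is_iso_id.
- by exists c; split; [exact: cc' | exact: c'c].
- exact: is_iso_id.
- by rewrite -cg compA c'c comp1c compc1.
- by rewrite comp1c -compA [c \oc c']cc' compc1.
by rewrite fmap1 comp1c compc1.
Qed.

Lemma gk_shift_equivalence : is_equivalence (gk_shift B).
Proof. by exists (gk_unshift B); split; [apply: gk_shiftK | apply: gk_unshiftK]. Qed.

(** For the backward direction one keeps rotating forward: three rotations of the cone triangle of
    [f] start with the same map as two more rotations of the given triangle. The comparison of third
    vertices is the shift of an isomorphism. *)
Lemma gk_dist_rot (X Y Z : GK) (f : hom X Y) (g : hom Y Z)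
    (h : hom Z (gk_shift B X)) :
  gk_dist f g h <-> gk_dist g h (- fmap (gk_shift B) f).
Proof.
split=> [|/gk_dist_rot1/gk_dist_rot1 d]; first exact: gk_dist_rot1.
have /is_equivalenceP[fa fu _] := gk_shift_equivalence.
have [Z' [g' [h' d0]]] := gk_dist_cone f.
have d' := gk_dist_rot1 (gk_dist_rot1 (gk_dist_rot1 d0)).
have [|c [ci c1 c2]] := gk_iso3 d' d (is_iso_id _) (is_iso_id _).
  by rewrite comp1c compc1.
have [c0 c0E] := fu _ _ c; subst c.
have c0i := ff_iso_reflect fa fu ci.
apply: gk_dist_iso (is_iso_id _) (is_iso_id _) c0i _ _ _ d0.
- by rewrite comp1c compc1.
- apply: fa; move: c1; rewrite !compc1 compNr => /oppr_inj.
  by rewrite fmapM.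
move: c2; rewrite !fmap1 !comp1c compNl => /oppr_inj.
by rewrite -fmapM => /fa.
Qed.

(** All four commutations hold strictly, with [u] and [v] diagonal in the summands of the cones. In
    the cone of [u], the sum of [X[2]], [Y[1]], [X[1]] and [Z], the two copies of [X] cancel by a
    homotopy, leaving the cone of [g]; [k] and [l] are the inverse equivalences. *)
Lemma gk_octa_std (X Y Z : GC) (f : hom X Y) (g : hom Y Z) :
  exists (u : @hom GK (cone f) (cone (g \oc f)))
         (v : @hom GK (cone (g \oc f)) (cone g)),
  [/\ gk_dist u v (fmap (gk_shift B) (cl (cone_in f) : @hom GK Y (cone f)) \oc
        (cl (cone_out g) : @hom GK (cone g) (gk_shift B Y))),
      @comp GK _ _ _ u (cl (cone_in f)) = @comp GK _ _ _ (cl (cone_in (g \oc f))) (cl g),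
      @comp GK _ _ _ (cl (cone_out (g \oc f))) u = cl (cone_out f),
      @comp GK _ _ _ v (cl (cone_in (g \oc f))) = cl (cone_in g)
    & @comp GK _ _ _ (cl (cone_out g)) v =
      @comp GK _ _ _ (fmap (gk_shift B) (cl f : @hom GK X Y)) (cl (cone_out (g \oc f)))].
Proof.
set gf := g \oc f.
pose u := cone_j gf \oc cone_p f + cone_i gf \oc gc_val g \oc cone_q f.
pose v := cone_j g \oc gc_val f \oc cone_p gf + cone_i g \oc cone_q gf.
have ue n : u \oc ge (cone f) n = ge (cone gf) n \oc u.
  by rewrite /u ?(addE, coneEe f, coneEe gf, gcEe g).
have ud : u \oc gd (cone f) = gd (cone gf) \oc u.
  by rewrite /u ?(addE, coneE f, coneE gf, gcE g) /= ?addE; zmod_eq.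
have ve n : v \oc ge (cone gf) n = ge (cone g) n \oc v.
  by rewrite /v ?(addE, coneEe g, coneEe gf, gcEe f).
have vd : v \oc gd (cone gf) = gd (cone g) \oc v.
  by rewrite /v ?(addE, coneE g, coneE gf, gcE f) /= ?addE; zmod_eq.
pose uu : hom (cone f) (cone gf) := gc_mk ue ud.
pose vv : hom (cone gf) (cone g) := gc_mk ve vd.
pose k := cone_j uu \oc cone_i f \oc cone_p g + cone_i uu \oc cone_i gf \oc cone_q g.
pose l := v \oc cone_q uu + cone_j g \oc cone_q f \oc cone_p uu.
have ke n : k \oc ge (cone g) n = ge (cone uu) n \oc k.
  by rewrite /k ?(addE, coneEe g, coneEe f, coneEe gf, coneEe uu).
have kd : k \oc gd (cone g) = gd (cone uu) \oc k.
  rewrite /k ?(addE, coneE g, coneE f, coneE gf, coneE uu) /= /u.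
  by rewrite ?(addE, coneE f); zmod_eq.
have le n : l \oc ge (cone uu) n = ge (cone g) n \oc l.
  by rewrite /l ?(addE, coneEe g, coneEe f, coneEe gf, coneEe uu, ve,
    fun n => comp_eqlr (ve n)).
have ld : l \oc gd (cone uu) = gd (cone g) \oc l.
  rewrite /l ?(addE, coneE uu) /= /u /v.
  by rewrite ?(addE, coneE f, coneE g, coneE gf, gcE f) /= ?addE; zmod_eq.
pose kk : hom (cone g) (cone uu) := gc_mk ke kd.
pose ll : hom (cone uu) (cone g) := gc_mk le ld.
exists (cl uu), (cl vv); split.
- exists uu, (cl kk); split=> //.
  + exists (cl ll); rewrite !cl_comp; split.
      congr quot_class; apply: val_inj; rewrite /= /l /k /v.
      by apply: cone_ext; rewrite ?(addE, coneE f, coneE g, coneE gf, coneE uu); zmod_eq.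
    apply: (@cl_eq _ _ _ _ _ (- (cone_j uu \oc cone_j f \oc cone_p gf \oc cone_q uu))).
    split=> [n|] /=.
      by rewrite ?(addE, coneEe f, coneEe g, coneEe gf, coneEe uu).
    apply: cone_ext; rewrite /l /k /v ?(addE, coneE f, coneE g, coneE gf, coneE uu) /=.
      apply: cone_ext; rewrite /u ?(addE, coneE f, coneE gf); zmod_eq.
    apply: cone_ext; rewrite /u ?(addE, coneE f, coneE gf); zmod_eq.
  + rewrite cl_comp.
    apply: (@cl_eq _ _ _ _ _ (- (cone_j uu \oc cone_j f \oc cone_p gf))).
    split=> [n|] /=.
      by rewrite ?(addE, coneEe f, coneEe g, coneEe gf, coneEe uu).
    apply: cone_ext; rewrite /k /v ?(addE, coneE f, coneE g, coneE gf, coneE uu) /=;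
      rewrite /u ?(addE, coneE f, coneE gf); zmod_eq.
  rewrite gk_shiftE !cl_comp; congr quot_class; apply: val_inj => /=.
  by rewrite /k ?(addE, coneE uu); zmod_eq.
- rewrite !cl_comp; congr quot_class; apply: val_inj => /=.
  by rewrite /u ?(addE, coneE f); zmod_eq.
- rewrite !cl_comp; congr quot_class; apply: val_inj => /=.
  by rewrite /u ?(addE, coneE gf); zmod_eq.
- rewrite !cl_comp; congr quot_class; apply: val_inj => /=.
  by rewrite /v ?(addE, coneE gf); zmod_eq.
rewrite gk_shiftE !cl_comp; congr quot_class; apply: val_inj => /=.
by rewrite /v ?(addE, coneE g); zmod_eq.
Qed.

End GradedTriangles.

(** * The octahedral axiom and the embedding of [B] in degree zero *)

Section GradedTriangulated.
Variable B : addcat.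
Local Notation GC := (GC B).
Local Notation GK := (GK B).
Local Notation cl := (quot_class (gc_ideal B)).

Lemma gk_dist_octa (X Y Z X' Y' Z' : GK)
    (f : hom X Y) (f' : hom Y Z') (f'' : hom Z' (gk_shift B X))
    (g : hom Y Z) (g' : hom Z X') (g'' : hom X' (gk_shift B Y))
    (h' : hom Z Y') (h'' : hom Y' (gk_shift B X)) :
  gk_dist f f' f'' -> gk_dist g g' g'' -> gk_dist (g \oc f) h' h'' ->
  exists (u : hom Z' Y') (v : hom Y' X'),
    [/\ gk_dist u v (fmap (gk_shift B) f' \oc g''),
        u \oc f' = h' \oc g, h'' \oc u = f'',
        v \oc h' = g' & g'' \oc v = fmap (gk_shift B) f \oc h''].
Proof.
move=> [k1 [c1 [<- c1i ce1 ->]]] [k2 [c2 [<- c2i ce2 ->]]] d3.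
have [d1 [d1c1 c1d1]] := c1i; have [d2 [d2c2 c2d2]] := c2i.
have e12 : @idc GK Z \oc @comp GK _ _ _ (cl k2) (cl k1) =
    @comp GK _ _ _ (cl (k2 \oc k1)) (@idc GK X).
  by rewrite comp1c compc1 cl_comp.
(* The triangle [d3] carries its own representative of [g \oc f], homotopic but perhaps not equal to
   [k2 \oc k1], so the two cones must be compared. *)
have [c3 [c3i ce3 ch3]] := gk_iso3 d3 (gk_dist_std (k2 \oc k1))
  (is_iso_id _) (is_iso_id _) e12.
have [d3' [d3c3 c3d3]] := c3i.
rewrite compc1 in ce3; rewrite fmap1 comp1c in ch3.
have [u [v [duv uf hu vh gv]]] := gk_octa_std k1 k2.
have f'E : f' = d1 \oc cl (cone_in k1) by rewrite -ce1 compA d1c1 comp1c.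
have g'E : g' = d2 \oc cl (cone_in k2) by rewrite -ce2 compA d2c2 comp1c.
have h'E : h' = d3' \oc cl (cone_in (k2 \oc k1)) by rewrite -ce3 compA d3c3 comp1c.
exists (d3' \oc u \oc c1), (d2 \oc v \oc c3); split.
- apply: (gk_dist_iso (a := d1) (b := d3') (c := d2)) duv.
  + by exists c1.
  + by exists c3.
  + by exists c2.
  + by rewrite (comp_eql _ c1d1) compc1.
  + by rewrite (comp_eql _ c3d3) compc1.
  by rewrite f'E fmapM !compA (comp_eql _ c2d2) compc1.
- by rewrite f'E !compA (comp_eql _ c1d1) compc1 -compA uf compA -h'E.
- by rewrite ch3 !compA (comp_eql _ c3d3) compc1 hu.
- by rewrite h'E !compA (comp_eql _ c3d3) compc1 -compA vh -g'E.
by rewrite ch3 !compA (comp_eql _ c2d2) compc1 gv.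
Qed.

Lemma gk_additive : is_additive GK.
Proof.
split=> [|X Y].
  have [Z /zero_objP Z0] := (addcatP B).1.
  have z0 : (0 : hom Z Z) \oc (0 : hom Z Z) = 0 := comp0c _ _.
  exists (@Gcx B Z (fun=> 0) 0 (fun=> etrans z0 (esym z0)) z0).
  apply/zero_objP; apply/quot_class0P; exists 0; split=> [n|] /=.
    by rewrite !comp0c.
  by rewrite comp0c addr0.
have [W [i [j [p [q bp]]]]] := (addcatP B).2 (gob X) (gob Y).
have [pi qj pj qi eW] := bp.
pose bpE := (compA, compDl, compDr, compc0, comp0c, compc1, comp1c,
  pi, comp_eqlr pi, qj, comp_eqlr qj, qi, comp_eqlr qi, pj, comp_eqlr pj).
pose e n := i \oc ge X n \oc p + j \oc ge Y n \oc q.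
pose d := i \oc gd X \oc p + j \oc gd Y \oc q.
have de n : d \oc e n = e (n + 1) \oc d.
  by rewrite /d /e !bpE !(comp_eql _ (gde _ _)) !bpE; zmod_eq.
have dd : d \oc d = 0.
  by rewrite /d !bpE !(comp_eql _ (gdd _)) !bpE; zmod_eq.
pose V : GC := Gcx de dd.
have ie n : i \oc ge X n = e n \oc i by rewrite /e !bpE; zmod_eq.
have id' : i \oc gd X = d \oc i by rewrite /d !bpE; zmod_eq.
have je n : j \oc ge Y n = e n \oc j by rewrite /e !bpE; zmod_eq.
have jd : j \oc gd Y = d \oc j by rewrite /d !bpE; zmod_eq.
have pe n : p \oc e n = ge X n \oc p by rewrite /e !bpE; zmod_eq.
have pd : p \oc d = gd X \oc p by rewrite /d !bpE; zmod_eq.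
have qe n : q \oc e n = ge Y n \oc q by rewrite /e !bpE; zmod_eq.
have qd : q \oc d = gd Y \oc q by rewrite /d !bpE; zmod_eq.
exists V; apply: (fmap_direct_sum (quot_functor (gc_ideal B))).
exists (@gc_mk _ X V i ie id'), (@gc_mk _ Y V j je jd), (@gc_mk _ V X p pe pd),
  (@gc_mk _ V Y q qe qd).
by split; apply: val_inj.
Qed.

Definition gk_tricat : tricat :=
  @Tricat (Addcat gk_additive) (gk_shift B) (gk_unshift B)
    (gk_shiftK B) (gk_unshiftK B) (@gk_dist B) (@gk_dist_iso B) (@gk_dist_id B)
    (@gk_dist_cone B) (@gk_dist_rot B) (@gk_dist_morph B) gk_dist_octa.

Definition gc_single_ge (b : B) (n : int) : hom b b := if n == 0 then idc b else 0.

Fact gc_single_gde (b : B) n :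
  0 \oc gc_single_ge b n = gc_single_ge b (n + 1) \oc 0.
Proof. by rewrite comp0c compc0. Qed.

Fact gc_single_gdd (b : B) : (0 : hom b b) \oc (0 : hom b b) = 0.
Proof. exact: comp0c. Qed.

Definition gc_single (b : B) : GC := Gcx (gc_single_gde b) (gc_single_gdd b).

Fact gc_single_map_e (b c : B) (f : hom b c) n :
  f \oc ge (gc_single b) n = ge (gc_single c) n \oc f.
Proof.
by rewrite /= /gc_single_ge; case: eqP => _; rewrite ?comp1c ?compc1 ?comp0c ?compc0.
Qed.

Fact gc_single_map_d (b c : B) (f : hom b c) :
  f \oc gd (gc_single b) = gd (gc_single c) \oc f.
Proof. by rewrite /= comp0c compc0. Qed.

Definition gk_single_map (b c : B) (f : hom b c) :
    @hom GK (gc_single b) (gc_single c) :=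
  cl (@gc_mk _ (gc_single b) (gc_single c) f (gc_single_map_e f) (gc_single_map_d f)).

Fact gk_single_map1 (b : B) : gk_single_map (idc b) = idc (gc_single b : GK).
Proof. by rewrite [RHS]cl_id; congr quot_class; apply: val_inj. Qed.

Fact gk_single_mapM (a b c : B) (g : hom b c) (f : hom a b) :
  gk_single_map (g \oc f) = gk_single_map g \oc gk_single_map f.
Proof. by rewrite [RHS]cl_comp; congr quot_class; apply: val_inj. Qed.

Fact gk_single_mapD (b c : B) (f g : hom b c) :
  gk_single_map (f + g) = gk_single_map f + gk_single_map g.
Proof. by rewrite -quot_classD; congr quot_class; apply: val_inj. Qed.

Definition gk_single : functor B gk_tricat :=
  @Functor B gk_tricat gc_single gk_single_map gk_single_map1 gk_single_mapM
    gk_single_mapD.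

Lemma gk_single_faithful : faithful gk_single.
Proof.
move=> b c f g /quot_classP[s [_ /=]].
by rewrite comp0c compc0 addr0 => /eqP; rewrite subr_eq0 => /eqP.
Qed.

Lemma gk_single_full : full gk_single.
Proof.
move=> b c u; have [f <-] := quot_class_surj u.
by exists (gc_val f); congr quot_class; apply: val_inj.
Qed.

(** The operators [ge] play the role of the grading here: [ge 0] is the identity on the source and
    zero on a target shifted by [n > 0], so already the chain maps vanish. *)
Lemma gk_single_connective : connective (obj_image gk_single).
Proof.
move=> _ _ [b ->] [c ->] [n|//] n0 u.
have supp (m : nat) k : k != - m%:Z ->
    ge (iter m (gk_shift B : GK -> GK) (gc_single c)) k = 0.
  elim: m k => [|m IHm] k km /=; last by apply: IHm; lia.
  by rewrite /gc_single_ge ifN.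
have [f <-] := quot_class_surj u.
have -> : f = 0; last by rewrite /quot_class raddf0.
apply: val_inj; have /= := gc_e f 0.
rewrite /gc_single_ge eqxx compc1 => ->.
by rewrite supp ?comp0c //; lia.
Qed.

End GradedTriangulated.

(** * Transport of a triangulated structure along an equivalence *)

Section Transport.
Variables (T : tricat) (D : precat) (F : functor D T) (G : functor T D).
Hypothesis GF : nat_iso (G \oF F) (functor_id D).
Hypothesis FG : nat_iso (F \oF G) (functor_id T).

Let F_faithful : faithful F.
Proof. by have /is_equivalenceP[] : is_equivalence F by exists G. Qed.
Let F_full : full F.
Proof. by have /is_equivalenceP[] : is_equivalence F by exists G. Qed.
Let F_surj : essentially_surjective F.
Proof. by have /is_equivalenceP[] : is_equivalence F by exists G. Qed.

Let eps (X : T) : hom (F (G X)) X := projT1 (cid FG) X.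
Let eps_iso X : is_iso (eps X). Proof. exact: (projT2 (cid FG)).1. Qed.
Let eps_nat X Y (f : hom X Y) : eps Y \oc fmap F (fmap G f) = f \oc eps X.
Proof. exact: (projT2 (cid FG)).2. Qed.

Lemma transport_additive : is_additive D.
Proof.
split=> [|X Y].
  have [Z Z0] := (addcatP T).1; exists (G Z); exact: fmap_zero_obj.
have [W sW] := (addcatP T).2 (F X) (F Y); exists (G W).
have {}sW := fmap_direct_sum G sW.
have {}sW := direct_sum_iso1 sW (nat_iso_isomorphic X GF).
exact: direct_sumC (direct_sum_iso1 (direct_sumC sW) (nat_iso_isomorphic Y GF)).
Qed.

Definition transport_endo (S : functor T T) : functor D D := G \oF S \oF F.

Let transport_inverse (S U : functor T T) : nat_iso (U \oF S) (functor_id T) ->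
  nat_iso (transport_endo U \oF transport_endo S) (functor_id D).
Proof.
move=> [eta [eta_i eta_n]]; have [th [th_i th_n]] := GF.
exists (fun X => th X \oc fmap G (eta (F X)) \oc fmap G (fmap U (eps (S (F X))))).
split=> [X | X Y f] /=.
  apply: is_iso_comp; last by do 2 apply: fmap_iso; apply: eps_iso.
  by apply: is_iso_comp; [apply: th_i | apply: fmap_iso; apply: eta_i].
have e : fmap G (fmap U (eps (S (F Y)))) \oc
    fmap G (fmap U (fmap F (fmap G (fmap S (fmap F f))))) =
    fmap G (fmap U (fmap S (fmap F f))) \oc fmap G (fmap U (eps (S (F X)))).
  by rewrite -!fmapM eps_nat.
have e1 : fmap G (eta (F Y)) \oc fmap G (fmap U (fmap S (fmap F f))) =
    fmap G (fmap F f) \oc fmap G (eta (F X)).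
  by rewrite -!fmapM; congr (fmap G _); apply: eta_n.
have e2 : th Y \oc fmap G (fmap F f) = f \oc th X := th_n _ _ f.
by rewrite (comp_eql _ e) !compA (comp_eql _ e1) compA e2.
Qed.

(** The image of [h] ends in [F (G (shift (F X)))]; composing with [eps] makes it end in
    [shift (F X)]. *)
Definition transport_dist (X Y Z : D) (f : hom X Y) (g : hom Y Z)
    (h : hom Z (transport_endo (@shift T) X)) : Prop :=
  dist (fmap F f) (fmap F g) (eps (shift (F X)) \oc fmap F h).

Let shiftE (X Y : D) (f : hom X Y) :
  eps (shift (F Y)) \oc fmap F (fmap (transport_endo (@shift T)) f) =
  fmap shift (fmap F f) \oc eps (shift (F X)).
Proof. exact: eps_nat. Qed.

Let eps_inj X Y (f g : hom Y (transport_endo (@shift T) X)) :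
  eps (shift (F X)) \oc fmap F f = eps (shift (F X)) \oc fmap F g -> f = g.
Proof.
have [e [eK _]] := eps_iso (shift (F X)).
move=> fg; apply: F_faithful.
by rewrite -[LHS]comp1c -[RHS]comp1c -eK -!compA fg.
Qed.

Definition transport_tricat : tricat.
Proof.
refine (@Tricat (Addcat transport_additive) (transport_endo (@shift T))
  (transport_endo (@unshift T)) (transport_inverse (shiftK T))
  (transport_inverse (unshiftK T)) transport_dist _ _ _ _ _ _).
- move=> X Y Z X' Y' Z' f g h f' g' h' a b c ai bi ci e1 e2 e3.
  apply: dist_iso (fmap_iso F ai) (fmap_iso F bi) (fmap_iso F ci) _ _ _.
  + by rewrite -!fmapM e1.
  + by rewrite -!fmapM e2.
  by rewrite compA -shiftE -!compA -!fmapM e3.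
- move=> X Z Z0; rewrite /transport_dist fmap1 !fmap0 compc0.
  by apply: dist_id; apply: fmap_zero_obj.
- move=> X Y f; have [Z [g [h d]]] := dist_cone (fmap F f).
  have [Z' [b [b' [b'b bb']]]] := F_surj Z.
  have [e [eK Ke]] := eps_iso (shift (F X)).
  have [g' g'E] := F_full (b' \oc g); have [h' h'E] := F_full (e \oc h \oc b).
  exists Z', g', h'; rewrite /transport_dist g'E h'E.
  apply: dist_iso (is_iso_id _) (is_iso_id _) _ _ _ _ d.
  + by exists b; split; [exact: bb' | exact: b'b].
  + by rewrite comp1c compc1.
  + by rewrite compc1.
  by rewrite fmap1 comp1c !compA Ke comp1c -compA bb' compc1.
- move=> X Y Z f g h; rewrite /transport_dist.
  have [e [eK Ke]] := eps_iso (shift (F X)).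
  rewrite dist_rot fmapN compNr shiftE; split.
  + apply: dist_iso (is_iso_id _) (is_iso_id _) _ _ _ _.
    * by exists (eps (shift (F X))); split; [exact: Ke | exact: eK].
    * by rewrite comp1c compc1.
    * by rewrite compc1 compA eK comp1c.
    by rewrite fmap1 comp1c compNl -compA Ke compc1.
  apply: dist_iso (is_iso_id _) (is_iso_id _) (eps_iso (shift (F X))) _ _ _.
  + by rewrite comp1c compc1.
  + by rewrite compc1.
  by rewrite fmap1 comp1c compNl.
- move=> X Y Z X' Y' Z' f g h f' g' h' a b d d' e.
  have [|c [c1 c2]] := dist_morph (a := fmap F a) (b := fmap F b) d d'.
    by rewrite -!fmapM e.
  have [c' c'E] := F_full c; exists c'; split.
    by apply: F_faithful; rewrite !fmapM c'E.
  by apply: eps_inj; rewrite !fmapM compA shiftE -compA c2 c'E compA.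
move=> X Y Z X' Y' Z' f f' f'' g g' g'' h' h'' d1 d2 d3.
rewrite /transport_dist fmapM in d3.
have [u [v [d uf hu vh gv]]] := dist_octa d1 d2 d3.
have [u' u'E] := F_full u; have [v' v'E] := F_full v.
exists u', v'; split.
- rewrite /transport_dist u'E v'E fmapM compA shiftE.
  by rewrite compA in d.
- by apply: F_faithful; rewrite !fmapM u'E.
- by apply: eps_inj; rewrite fmapM compA u'E.
- by apply: F_faithful; rewrite !fmapM v'E.
by apply: eps_inj; rewrite !fmapM !compA shiftE v'E gv compA.
Defined.

Lemma transport_shiftz (i : nat) (X : transport_tricat) :
  isomorphic (F (shiftz i%:Z X)) (shiftz i%:Z (F X)).
Proof.
elim: i => [|i IHi]; first exact: isomorphic_refl.
apply: isomorphic_trans (fmap_isomorphic shift IHi).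
by exists (eps (shift (F (shiftz i%:Z X)))); apply: eps_iso.
Qed.

End Transport.

(** * Complexes over a weakly idempotent complete category *)

Section IntPredecessor.
Variables (P : int -> Type) (H : forall n, P (n + 1)).

(** Homotopies relate degrees [n] and [n + 1], so their equations determine a family only in degrees
    of the form [n + 1]. This reaches every degree with a single cast, which disappears at
    [n + 1]. *)
Definition int_pred_rect (m : int) : P m := eq_rect _ P (H (m - 1)) _ (subrK 1 m).

Lemma int_pred_rectE n : int_pred_rect (n + 1) = H n.
Proof.
rewrite /int_pred_rect; move: (subrK 1 (n + 1)).
have -> : n + 1 - 1 = n by rewrite addrK.
by move=> e; rewrite (eq_irrelevance e erefl).
Qed.

End IntPredecessor.

(** * Bounded complexes contractible on one side of degree zero *)

Section Complexes.
Variable B : addcat.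
Implicit Types X Y Z : complex B.
Local Notation K := (K B).

Lemma K_comp X Y Z (g : chain_map Y Z) (f : chain_map X Y) :
  @comp K _ _ _ (htpy_class g) (htpy_class f) = htpy_class (chain_comp g f).
Proof. exact: htpy_compE. Qed.

Definition chain_mk X Y (f : graded_hom X Y)
    (fd : forall n, f (n + 1) \oc cx_d X n = cx_d Y n \oc f n) : chain_map X Y :=
  @ChainMap _ X Y f (introT (asboolP _) fd).

Lemma htpy_eq X Y (f g : chain_map X Y) (s : forall n, hom (X (n + 1)) (Y n)) :
  (forall n, chain_val f (n + 1) - chain_val g (n + 1) =
     cx_d Y n \oc s n + s (n + 1) \oc cx_d X (n + 1)) ->
  htpy_class f = htpy_class g.
Proof. by move=> h; apply/htpy_classP/asboolP; exists s. Qed.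

Lemma htpy_eq0 X Y (f : chain_map X Y) (s : forall n, hom (X (n + 1)) (Y n)) :
  (forall n, chain_val f (n + 1) =
     cx_d Y n \oc s n + s (n + 1) \oc cx_d X (n + 1)) ->
  htpy_class f = 0.
Proof.
move=> h; have -> : 0 = htpy_class (0 : chain_map X Y) by rewrite /htpy_class raddf0.
by apply: (@htpy_eq _ _ _ _ s) => n; rewrite -h; apply: subr0.
Qed.

Lemma htpy_eqP X Y (f g : chain_map X Y) : htpy_class f = htpy_class g ->
  exists s : forall n, hom (X (n + 1)) (Y n),
  forall n, chain_val f (n + 1) =
     chain_val g (n + 1) + (cx_d Y n \oc s n + s (n + 1) \oc cx_d X (n + 1)).
Proof.
move=> /htpy_classP/asboolP[s h]; exists s => n.
have e : chain_val f (n + 1) - chain_val g (n + 1) = _ := h n.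
by rewrite -e; zmod_eq.
Qed.

Lemma chain_eq X Y (f g : chain_map X Y) :
  (forall n, chain_val f n = chain_val g n) -> f = g.
Proof. by move=> fg; apply: val_inj; apply: functional_extensionality_dep. Qed.

(** The homotopy between the identity and [g \oc f] is a contraction in the degrees where [Y], and
    with it [g \oc f], vanishes. *)
Lemma partial_contraction X Y (Q : pred int) : @isomorphic K X Y ->
  (forall n, Q n -> is_zero_obj (Y n)) ->
  exists s : forall n, hom (X (n + 1)) (X n), forall n, Q (n + 1) ->
    cx_d X n \oc s n + s (n + 1) \oc cx_d X (n + 1) = idc (X (n + 1)).
Proof.
move=> [f [g [gf _]]] Y0.
rewrite -[f]htpy_reprK -[g]htpy_reprK K_comp in gf.
have [s sE] := htpy_eqP (esym gf); exists s => n Qn.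
have := sE n; rewrite /= => ->.
have [_ z] := Y0 _ Qn.
by rewrite (z _ (chain_val (repr g) (n + 1))) comp0c add0r.
Qed.

(** The endomorphism [u = id - (d h + h d)] of the complex is homotopic to the identity. If it is a
    split idempotent in each degree, its image is a complex homotopy equivalent to [X]. *)
Lemma homotopy_image X (h : forall n, hom (X (n + 1)) (X n)) :
  (forall n, idem_splits
     (idc (X (n + 1)) - (cx_d X n \oc h n + h (n + 1) \oc cx_d X (n + 1)))) ->
  exists X' : complex B, @isomorphic K X X' /\
  exists (i : forall n, hom (X' n) (X n)) (p : forall n, hom (X n) (X' n)),
    (forall n, p n \oc i n = idc (X' n)) /\
    (forall n, i (n + 1) \oc p (n + 1) =
      idc (X (n + 1)) - (cx_d X n \oc h n + h (n + 1) \oc cx_d X (n + 1))).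
Proof.
move=> splits.
pose u := int_pred_rect (P := fun m => hom (X m) (X m)) (fun n =>
  idc (X (n + 1)) - (cx_d X n \oc h n + h (n + 1) \oc cx_d X (n + 1))).
have uE n : u (n + 1) = _ := int_pred_rectE _ n.
have u_splits : forall n, idem_splits (u n).
  by apply: int_pred_rect => n; rewrite uE.
pose W n := projT1 (cid (u_splits n)).
pose i n : hom (W n) (X n) := projT1 (cid (projT2 (cid (u_splits n)))).
pose p n : hom (X n) (W n) := projT1 (cid (projT2 (cid (projT2 (cid (u_splits n)))))).
have pi n : p n \oc i n = idc (W n).
  exact: (projT2 (cid (projT2 (cid (projT2 (cid (u_splits n))))))).1.
have ip n : i n \oc p n = u n.
  exact: (projT2 (cid (projT2 (cid (projT2 (cid (u_splits n))))))).2.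
have ud : forall n, u (n + 1) \oc cx_d X n = cx_d X n \oc u n.
  apply: int_pred_rect => n; rewrite !uE.
  rewrite !(compA, compDl, compDr, compNl, compNr, comp1c, compc1, cx_dd, comp0c).
  by rewrite (comp_eql _ (cx_dd _ _)) compc0; zmod_eq.
have dd n : (p (n + 1 + 1) \oc cx_d X (n + 1) \oc i (n + 1)) \oc
    (p (n + 1) \oc cx_d X n \oc i n) = 0.
  rewrite !compA (comp_eql _ (ip (n + 1))) -[_ \oc u _ \oc _]compA ud.
  by rewrite !compA (comp_eql _ (cx_dd _ _)) compc0 !comp0c.
pose X' := Complex dd.
have pd n : p (n + 1) \oc cx_d X n = cx_d X' n \oc p n.
  rewrite /= -[RHS]compA ip -[RHS]compA -ud -ip !compA pi.
  by rewrite comp1c.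
have id' n : i (n + 1) \oc cx_d X' n = cx_d X n \oc i n.
  rewrite /= !compA ip ud -ip -[LHS]compA.
  by rewrite -compA pi compc1.
exists X'; split; last by exists i, p; split=> // n; rewrite ip uE.
exists (htpy_class (@chain_mk X X' p pd)), (htpy_class (@chain_mk X' X i id')).
rewrite !K_comp; split; last first.
  by congr htpy_class; apply: chain_eq => n; apply: pi.
apply: esym; apply: (@htpy_eq _ _ _ _ h) => n /=.
by rewrite ip uE; zmod_eq.
Qed.

Hypothesis B_wic : weakly_idempotent_complete B.

(** In negative degrees [d s + s d = id]. Starting where [X] is zero and moving right, [d s] splits,
    hence so does its complement [s d] on the same object, hence [d s] on the next one. The last
    conclusion preserves boundedness and allows the two truncations to be composed. *)
Lemma left_truncation X Y (a : int) : @isomorphic K X Y ->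
  (forall n, n < 0 -> is_zero_obj (Y n)) ->
  (forall n, n < a -> is_zero_obj (X n)) ->
  exists X', [/\ @isomorphic K X X', forall n, n < 0 -> is_zero_obj (X' n)
    & forall n, is_zero_obj (X n) -> is_zero_obj (X' n)].
Proof.
move=> XY Y0 Xa.
have [s sE] := partial_contraction (Q := fun n => n < 0) XY Y0.
have splits : forall (k : nat) n, n < a - 1 + k%:Z -> n < 0 ->
    idem_splits (cx_d X n \oc s n).
  elim=> [|k IHk] n nk n0.
    have [_ z] : is_zero_obj (X (n + 1)) by apply: Xa; lia.
    by rewrite (z _ (cx_d X n \oc s n)); apply: idem_splits0; apply: addcatP.
  move: n nk n0; apply: int_pred_rect => n nk n0.
  have e := sE n n0.
  apply: idem_splits_swap.
    have -> : s (n + 1) \oc cx_d X (n + 1) =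
        idc (X (n + 1)) - cx_d X n \oc s n by rewrite -e; zmod_eq.
    by apply: idem_splits_compl => //; apply: IHk; lia.
  have -> : cx_d X (n + 1) \oc s (n + 1) \oc cx_d X (n + 1) \oc s (n + 1) =
    cx_d X (n + 1) \oc (cx_d X n \oc s n + s (n + 1) \oc cx_d X (n + 1)) \oc s (n + 1).
    by rewrite compDr compDl !compA cx_dd !comp0c add0r.
  by rewrite e compc1.
have {}splits n : n < 0 -> idem_splits (cx_d X n \oc s n).
  by move=> n0; apply: (splits (absz (n - a + 2))) => //; lia.
(* With this cut, [id - (d h + h d)] is zero in negative degrees, [id - d s] in degree 0 and the
   identity above. *)
pose h n := if n < 0 then s n else 0.
have h_splits n : idem_splits
    (idc (X (n + 1)) - (cx_d X n \oc h n + h (n + 1) \oc cx_d X (n + 1))).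
  rewrite /h; case: ifP => n0; last first.
    rewrite ifN; last by lia.
    rewrite compc0 comp0c addr0 subr0.
    by exists (X (n + 1)), (idc _), (idc _); rewrite comp1c.
  case: ifP => n1; last by rewrite comp0c addr0; apply: idem_splits_compl; auto.
  by rewrite sE // subrr; apply: idem_splits0; apply: addcatP.
have [X' [XX' [i [p [pi ip]]]]] := homotopy_image h_splits.
exists X'; split=> //; last by move=> n; apply: zero_obj_retract (pi n).
apply: int_pred_rect => n n0; apply: zero_obj_split0 (pi (n + 1)) _.
rewrite ip /h n0 ifT; last by lia.
by rewrite sE // subrr.
Qed.

(** The mirror image: the idempotents [s d] split from the right end of [X] down to degree 0, where
    the image of [id - s d] survives. *)
Lemma right_truncation X Y (b : int) : @isomorphic K X Y ->
  (forall n, 0 < n -> is_zero_obj (Y n)) ->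
  (forall n, b < n -> is_zero_obj (X n)) ->
  exists X', [/\ @isomorphic K X X', forall n, 0 < n -> is_zero_obj (X' n)
    & forall n, is_zero_obj (X n) -> is_zero_obj (X' n)].
Proof.
move=> XY Y0 Xb.
have [s sE] := partial_contraction (Q := fun n => 0 < n) XY Y0.
have splits : forall (k : nat) n, b < n + k%:Z -> 0 <= n ->
    idem_splits (s n \oc cx_d X n).
  elim=> [|k IHk] n nk n0.
    have [z _] : is_zero_obj (X n) by apply: Xb; lia.
    by rewrite (z _ (s n \oc cx_d X n)); apply: idem_splits0; apply: addcatP.
  have e : _ = idc (X (n + 1)) := sE n _.
  have {}e := e ltac:(lia).
  apply: idem_splits_swap.
    have -> : cx_d X n \oc s n =
        idc (X (n + 1)) - s (n + 1) \oc cx_d X (n + 1) by rewrite -e; zmod_eq.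
    by apply: idem_splits_compl => //; apply: IHk; lia.
  have -> : s n \oc cx_d X n \oc s n \oc cx_d X n =
    s n \oc (cx_d X n \oc s n + s (n + 1) \oc cx_d X (n + 1)) \oc cx_d X n.
    by rewrite compDr compDl !compA (comp_eql _ (cx_dd _ _)) compc0 addr0.
  by rewrite e compc1.
have {}splits n : 0 <= n -> idem_splits (s n \oc cx_d X n).
  by move=> n0; apply: (splits (absz (b + 1))) => //; lia.
pose h n := if 0 <= n then s n else 0.
have h_splits n : idem_splits
    (idc (X (n + 1)) - (cx_d X n \oc h n + h (n + 1) \oc cx_d X (n + 1))).
  rewrite /h; case: ifP => n0.
    rewrite ifT; last by lia.
    by rewrite sE ?subrr; [apply: idem_splits0; apply: addcatP | lia].
  rewrite compc0 add0r; case: ifP => n1; first by apply: idem_splits_compl; auto.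
  rewrite comp0c subr0.
  by exists (X (n + 1)), (idc _), (idc _); rewrite comp1c.
have [X' [XX' [i [p [pi ip]]]]] := homotopy_image h_splits.
exists X'; split=> //; last by move=> n; apply: zero_obj_retract (pi n).
apply: int_pred_rect => n n0; apply: zero_obj_split0 (pi (n + 1)) _.
rewrite ip /h !ifT; [|by lia|by lia].
by rewrite sE // subrr.
Qed.

End Complexes.

(** * Objects of [B] as complexes in degree zero *)

Section SingleComplex.
Variable B : addcat.
Implicit Types (b c : B).
Local Notation K := (K B).

Definition zero_ob : B := projT1 (cid (addcatP B).1).
Lemma zero_obP : is_zero_obj zero_ob. Proof. exact: (projT2 (cid (addcatP B).1)). Qed.

(** Matching on the constructor makes degree 0 reduce to [b], so maps in that degree need no
    cast. *)
Definition single_ob b (n : int) : B := if n is Posz 0 then b else zero_ob.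

Definition single b : complex B :=
  @Complex B (single_ob b) (fun=> 0) (fun=> comp0c _ _).

Lemma single_zero b n : n != 0 -> is_zero_obj (single b n).
Proof. by case: n => [[|n]|n] //= _; apply: zero_obP. Qed.

Definition single_graded b (X : complex B) (f : hom b (X 0)) :
    graded_hom (single b) X :=
  fun n => match n return hom (single_ob b n) (X n) with
           | Posz 0 => f
           | _ => 0
           end.

Fact single_mapP b c (f : hom b c) n :
  @single_graded b (single c) f (n + 1) \oc cx_d (single b) n =
  cx_d (single c) n \oc @single_graded b (single c) f n.
Proof. by rewrite /= comp0c compc0. Qed.

Definition single_map b c (f : hom b c) : chain_map (single b) (single c) :=
  chain_mk (single_mapP f).

Fact single_map1 b : htpy_class (single_map (idc b)) = @idc K (single b).
Proof.
congr htpy_class; apply: chain_eq => -[[|n]|n] //=;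
  by rewrite (proj1 zero_obP _ (idc _)).
Qed.

Fact single_mapM b c e (g : hom c e) (f : hom b c) :
  htpy_class (single_map (g \oc f)) =
  @comp K _ _ _ (htpy_class (single_map g)) (htpy_class (single_map f)).
Proof.
rewrite K_comp; congr htpy_class; apply: chain_eq => -[[|n]|n] //=;
  by rewrite comp0c.
Qed.

Fact single_mapD b c (f g : hom b c) :
  htpy_class (single_map (f + g)) =
  htpy_class (single_map f) + htpy_class (single_map g).
Proof.
rewrite -htpy_classD; congr htpy_class; apply: chain_eq => -[[|n]|n] //=;
  by symmetry; apply: (proj1 zero_obP).
Qed.

Lemma single_bounded b : @bounded_complex B (single b).
Proof. by exists 0, 0 => n n0; apply: single_zero; lia. Qed.

Definition single_Kb b : Kb B := exist _ (single b : K) (single_bounded b).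

Lemma single_heart b : heart_class (wst_b B) (single_Kb b).
Proof.
by split; exists (single b : K); do ?[exact: isomorphic_refl];
  move=> n n0; apply: single_zero; lia.
Qed.

Definition single_functor : functor B (heart (wst_b B)) :=
  @Functor B (heart (wst_b B)) (fun b => exist _ (single_Kb b) (single_heart b))
    (fun b c f => htpy_class (single_map f))
    single_map1 single_mapM single_mapD.

Lemma single_functor_faithful : faithful single_functor.
Proof.
move=> b c f g /htpy_eqP[s sE].
have {}sE : forall n, chain_val (single_map f) n = chain_val (single_map g) n.
  by apply: int_pred_rect => n; rewrite sE /= comp0c compc0 !addr0.
exact: (sE 0).
Qed.

Lemma single_functor_full : full single_functor.
Proof.
move=> b c u; rewrite -[u]htpy_reprK; set r := repr _.
exists (chain_val r 0); congr htpy_class; apply: chain_eq => -[[|n]|n] //=;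
  by symmetry; apply: (proj1 zero_obP).
Qed.

Lemma concentrated_single (X : complex B) :
  (forall n, n != 0 -> is_zero_obj (X n)) -> @isomorphic K (single (X 0)) X.
Proof.
move=> X0.
have d0 n : cx_d X n = 0.
  have [n0 | n0] := eqVneq (n + 1) 0.
    by have [_ z] := X0 n ltac:(lia); apply: z.
  by have [z _] := X0 _ n0; apply: z.
have fd n : single_graded (idc (X 0)) (n + 1) \oc cx_d (single (X 0)) n =
    cx_d X n \oc single_graded (idc (X 0)) n.
  by rewrite d0 compc0 comp0c.
pose g : graded_hom X (single (X 0)) := fun n =>
  match n return hom (X n) (single_ob (X 0) n) with
  | Posz 0 => idc (X 0)
  | _ => 0
  end.
have gd n : g (n + 1) \oc cx_d X n = cx_d (single (X 0)) n \oc g n.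
  by rewrite d0 compc0 comp0c.
exists (htpy_class (chain_mk fd)), (htpy_class (chain_mk gd)).
rewrite !K_comp; split; congr htpy_class; apply: chain_eq => -[[|n]|n] /=.
- exact: comp1c.
- by symmetry; rewrite (proj1 zero_obP _ (idc _)) comp0c.
- by symmetry; rewrite (proj1 zero_obP _ (idc _)) comp0c.
- exact: comp1c.
- by symmetry; rewrite comp0c; apply: (proj1 (X0 _ _)).
by symmetry; rewrite comp0c; apply: (proj1 (X0 _ _)).
Qed.

(** For essential surjectivity the two truncations are applied in turn. The witnesses [Y1] and [Y2]
    of the weights may be unbounded; the inductions start from the bounds of [X]. *)
Lemma wic_heart_wst_b :
  weakly_idempotent_complete B -> equivalent B (heart (wst_b B)).
Proof.
move=> B_wic; exists single_functor; apply/is_equivalenceP.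
split; [exact: single_functor_faithful | exact: single_functor_full |].
move=> [[X [a [b Xab]]] [/= [Y1 XY1 Y1z] [Y2 XY2 Y2z]]].
have [n na|X1 [XX1 X1z X1X]] := left_truncation B_wic (a := a) XY1 Y1z.
  by apply: Xab; rewrite na.
have X1Y2 : isomorphic (X1 : K) Y2.
  exact: isomorphic_trans (isomorphic_sym XX1) XY2.
have [n bn|X2 [X1X2 X2z X2X1]] := right_truncation B_wic (b := b) X1Y2 Y2z.
  by apply: X1X; apply: Xab; rewrite bn orbT.
have X2c n : n != 0 -> is_zero_obj (X2 n).
  move=> n0; have [n1 | n1] := leP n 0; last exact: X2z.
  by apply: X2X1; apply: X1z; lia.
exists (X2 0).
exact: (isomorphic_trans (concentrated_single X2c)
  (isomorphic_sym (isomorphic_trans XX1 X1X2))).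
Qed.

End SingleComplex.

(** * Complements of split monomorphisms of complexes *)

Section Complement.
Variable B : addcat.
Implicit Types X Y Z V : complex B.
Local Notation K := (K B).

Lemma biproduct_family (I : Type) (X Y : I -> B) :
  exists (W : I -> B) (i1 : forall n, hom (X n) (W n)) (i2 : forall n, hom (Y n) (W n))
    (p1 : forall n, hom (W n) (X n)) (p2 : forall n, hom (W n) (Y n)),
  forall n, is_biproduct (i1 n) (i2 n) (p1 n) (p2 n).
Proof.
pose s n := cid ((addcatP B).2 (X n) (Y n)).
pose s1 n := cid (projT2 (s n)); pose s2 n := cid (projT2 (s1 n)).
pose s3 n := cid (projT2 (s2 n)); pose s4 n := cid (projT2 (s3 n)).
exists (fun n => projT1 (s n)), (fun n => projT1 (s1 n)), (fun n => projT1 (s2 n)).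
by exists (fun n => projT1 (s3 n)), (fun n => projT1 (s4 n)) => n; case: (s4 n).
Qed.

(* The complement is the cone of [i]. *)
Lemma complex_complement_cone X Y (i : @hom K X Y) (p : @hom K Y X) :
  p \oc i = idc (X : K) ->
  exists Z (j : @hom K Z Y) (q : @hom K Y Z), is_biproduct i j p q /\
  forall n, is_zero_obj (X (n + 1)) -> is_zero_obj (Y n) -> is_zero_obj (Z n).
Proof.
rewrite -[i]htpy_reprK -[p]htpy_reprK K_comp; set f := repr i; set g := repr p.
move=> /htpy_eqP[s gf]; rewrite /= in gf.
have fd := chain_mapP f; have gd := chain_mapP g.
have [W [i1 [i2 [p1 [p2 bp]]]]] := biproduct_family (fun n => X (n + 1)) Y.
have pi11 n : p1 n \oc i1 n = idc _ by case: (bp n).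
have pi22 n : p2 n \oc i2 n = idc _ by case: (bp n).
have pi12 n : p1 n \oc i2 n = 0 by case: (bp n).
have pi21 n : p2 n \oc i1 n = 0 by case: (bp n).
have ext n (V : B) (u v : hom (W n) V) :
    u \oc i1 n = v \oc i1 n -> u \oc i2 n = v \oc i2 n -> u = v.
  move=> e1 e2; have [_ _ _ _ e] := bp n.
  by rewrite -[u]compc1 -[v]compc1 -e !compDr !compA e1 e2.
pose E := (compA, compDl, compDr, compNl, compNr, compc0, comp0c, compc1, comp1c,
  pi11, fun n => comp_eqlr (pi11 n), pi22, fun n => comp_eqlr (pi22 n),
  pi12, fun n => comp_eqlr (pi12 n), pi21, fun n => comp_eqlr (pi21 n),
  @cx_dd B, fun X n => comp_eqlr (@cx_dd B X n),
  gf, fun n => comp_eqlr (gf n)).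
pose Ed := (fd, fun n => comp_eqlr (fd n), gd, fun n => comp_eqlr (gd n)).
pose dW n : hom (W n) (W (n + 1)) :=
  i2 (n + 1) \oc (chain_val f (n + 1) \oc p1 n + cx_d Y n \oc p2 n)
  - i1 (n + 1) \oc cx_d X (n + 1) \oc p1 n.
have dWdW n : dW (n + 1) \oc dW n = 0.
  by apply: ext; rewrite /dW !(E, Ed); zmod_eq.
pose Z := Complex dWdW.
(* On [Y] this is [id - f g]; since [g f] is the identity only up to the homotopy [s], the term
   [- f s] on the summand [X[1]] is what makes it a chain map. *)
pose jg n : hom (Z n) (Y n) :=
  p2 n - chain_val f n \oc chain_val g n \oc p2 n - chain_val f n \oc s n \oc p1 n.
have jd n : jg (n + 1) \oc cx_d Z n = cx_d Y n \oc jg n.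
  by apply: ext; rewrite /jg /= /dW !(E, Ed); zmod_eq.
have qd n : i2 (n + 1) \oc cx_d Y n = cx_d Z n \oc i2 n.
  by rewrite /= /dW !(E, Ed); zmod_eq.
exists Z, (htpy_class (chain_mk jd)), (htpy_class (@chain_mk _ Y Z (fun n => i2 n) qd)).
split; last first.
  move=> n X0 Y0; apply/zero_objP; apply: ext; rewrite comp1c comp0c.
    by case: X0 => _; apply.
  by case: Y0 => _; apply.
split; rewrite ?K_comp.
- by apply: (@htpy_eq _ _ _ _ _ s) => n /=; rewrite gf; zmod_eq.
- apply: esym.
  apply: (@htpy_eq _ Z Z (chain_id Z) _ (fun n =>
    i1 n \oc (chain_val g (n + 1) \oc p2 (n + 1) + s (n + 1) \oc p1 (n + 1)))) => n /=.
  by rewrite /jg; apply: ext; rewrite /dW !(E, Ed); zmod_eq.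
- apply: (@htpy_eq0 _ Z X _ (fun n => - s n \oc
    (chain_val g (n + 1) \oc p2 (n + 1) + s (n + 1) \oc p1 (n + 1)))) => n /=.
  by rewrite /jg; apply: ext; rewrite /dW !(E, Ed); zmod_eq.
- apply: (@htpy_eq0 _ X Z _ (fun n => i1 n)) => n /=.
  by rewrite /dW !(E, Ed); zmod_eq.
rewrite -htpy_classD; congr htpy_class; apply: chain_eq => n.
transitivity (chain_val f n \oc chain_val g n + jg n \oc i2 n); first by [].
by rewrite /jg !(E, Ed); zmod_eq.
Qed.

(** A mere reindexing: the sign of the shift is put into the differential [dW] of the cocone
    instead. *)
Definition cx_shift V : complex B :=
  @Complex B (fun n => V (n + 1)) (fun n => cx_d V (n + 1)) (fun n => cx_dd V (n + 1)).

Definition cx_cast X a b (e : a = b) : hom (X a) (X b) :=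
  ecast c (hom (X a) (X c)) e (idc (X a)).

Lemma cx_cast_id X a (e : a = a) : cx_cast X e = idc (X a).
Proof. by rewrite (eq_irrelevance e erefl). Qed.

Lemma cx_cast_comp X a b c (e1 : a = b) (e2 : b = c) (e3 : a = c) :
  cx_cast X e2 \oc cx_cast X e1 = cx_cast X e3.
Proof. by case: c / e2 e3 => e3; rewrite (eq_irrelevance e3 e1) cx_cast_id comp1c. Qed.

Lemma cx_cast_d X a b (e : a = b) (e' : a + 1 = b + 1) :
  cx_d X b \oc cx_cast X e = cx_cast X e' \oc cx_d X a.
Proof. by case: b / e e' => e'; rewrite !cx_cast_id comp1c compc1. Qed.

(** The shifted cone of [p] has [X] moved one degree up. Writing [X] as a reindexed [V] confines the
    casts to this lemma. *)
Lemma cx_unshift X : exists V, @isomorphic K X (cx_shift V) /\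
  forall n, is_zero_obj (X n) -> is_zero_obj (V (n + 1)).
Proof.
have e (n : int) : n - 1 + 1 = n + 1 - 1 by rewrite addrAC.
pose dV n : hom (X (n - 1)) (X (n + 1 - 1)) := cx_cast X (e n) \oc cx_d X (n - 1).
have dVdV n : dV (n + 1) \oc dV n = 0.
  rewrite /dV !compA -[_ \oc cx_d X _ \oc cx_cast X _]compA.
  rewrite (cx_cast_d X (e n) (congr1 (+%R^~ 1) (e n))) !compA.
  by rewrite (comp_eql _ (cx_dd _ _)) compc0.
pose V : complex B := @Complex B (fun n => X (n - 1)) dV dVdV.
have k (n : int) : n = n + 1 - 1 by rewrite addrK.
have fd n : cx_cast X (k (n + 1)) \oc cx_d X n = cx_d (cx_shift V) n \oc cx_cast X (k n).
  rewrite /= /dV -[RHS]compA (cx_cast_d X (k n) (congr1 (+%R^~ 1) (k n))) compA.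
  by rewrite (cx_cast_comp X _ _ (k (n + 1))).
have gd n : cx_cast X (esym (k (n + 1))) \oc cx_d (cx_shift V) n =
    cx_d X n \oc cx_cast X (esym (k n)).
  rewrite /= /dV compA (cx_cast_d X (esym (k n)) (congr1 (+%R^~ 1) (esym (k n)))).
  by rewrite (cx_cast_comp X _ _ (congr1 (+%R^~ 1) (esym (k n)))).
exists V; split=> [|n X0]; last by rewrite /= -(k n).
exists (htpy_class (@chain_mk _ X (cx_shift V) (fun n => cx_cast X (k n)) fd)).
exists (htpy_class (@chain_mk _ (cx_shift V) X (fun n => cx_cast X (esym (k n))) gd)).
rewrite !K_comp; split; congr htpy_class; apply: chain_eq => n /=.
  by rewrite (cx_cast_comp X _ _ erefl).
by rewrite (cx_cast_comp X _ _ erefl).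
Qed.

(* The complement is the cone of the retraction [p], shifted by [-1]. *)
Lemma complex_complement_cocone V Y (i : @hom K (cx_shift V) Y)
    (p : @hom K Y (cx_shift V)) :
  p \oc i = idc (cx_shift V : K) ->
  exists Z (j : @hom K Z Y) (q : @hom K Y Z), is_biproduct i j p q /\
  forall n, is_zero_obj (V n) -> is_zero_obj (Y n) -> is_zero_obj (Z n).
Proof.
rewrite -[i]htpy_reprK -[p]htpy_reprK K_comp; set f := repr i; set g := repr p.
move=> /htpy_eqP[s]; set X := cx_shift V; rewrite /= => gf0.
pose fv n : hom (V (n + 1)) (Y n) := chain_val f n.
pose gv n : hom (Y n) (V (n + 1)) := chain_val g n.
have fd n : fv (n + 1) \oc cx_d V (n + 1) = cx_d Y n \oc fv n := chain_mapP f n.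
have gd n : gv (n + 1) \oc cx_d Y n = cx_d V (n + 1) \oc gv n := chain_mapP g n.
(* In terms of [V], [s n] goes from degree [n + 2] to degree [n + 1]; [t] is the same homotopy with
   the index of its target in [V]. *)
pose t := int_pred_rect (P := fun n => hom (V (n + 1)) (V n)) s.
have tE n : t (n + 1) = s n := int_pred_rectE _ n.
have gf : forall n, gv n \oc fv n =
    idc (V (n + 1)) + (cx_d V n \oc t n + t (n + 1) \oc cx_d V (n + 1)).
  by apply: int_pred_rect => n; rewrite !tE; apply: gf0.
have [W [i1 [i2 [p1 [p2 bp]]]]] := biproduct_family V Y.
have pi11 n : p1 n \oc i1 n = idc _ by case: (bp n).
have pi22 n : p2 n \oc i2 n = idc _ by case: (bp n).
have pi12 n : p1 n \oc i2 n = 0 by case: (bp n).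
have pi21 n : p2 n \oc i1 n = 0 by case: (bp n).
have ext n (U : B) (u v : hom (W n) U) :
    u \oc i1 n = v \oc i1 n -> u \oc i2 n = v \oc i2 n -> u = v.
  move=> e1 e2; have [_ _ _ _ e] := bp n.
  by rewrite -[u]compc1 -[v]compc1 -e !compDr !compA e1 e2.
pose E := (compA, compDl, compDr, compNl, compNr, compc0, comp0c, compc1, comp1c,
  pi11, fun n => comp_eqlr (pi11 n), pi22, fun n => comp_eqlr (pi22 n),
  pi12, fun n => comp_eqlr (pi12 n), pi21, fun n => comp_eqlr (pi21 n),
  @cx_dd B, fun X n => comp_eqlr (@cx_dd B X n),
  gf, fun n => comp_eqlr (gf n)).
pose Ed := (fd, fun n => comp_eqlr (fd n), gd, fun n => comp_eqlr (gd n)).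
pose dW n : hom (W n) (W (n + 1)) :=
  i1 (n + 1) \oc (gv n \oc p2 n - cx_d V n \oc p1 n)
  + i2 (n + 1) \oc cx_d Y n \oc p2 n.
have dWdW n : dW (n + 1) \oc dW n = 0.
  by apply: ext; rewrite /dW !(E, Ed); zmod_eq.
pose Z := Complex dWdW.
have jd n : p2 (n + 1) \oc cx_d Z n = cx_d Y n \oc p2 n.
  by rewrite /= /dW !(E, Ed); zmod_eq.
pose qg n : hom (Y n) (Z n) :=
  i2 n - i2 n \oc fv n \oc gv n - i1 n \oc t n \oc gv n.
have qd n : qg (n + 1) \oc cx_d Y n = cx_d Z n \oc qg n.
  by rewrite /qg /= /dW !(E, Ed); zmod_eq.
exists Z, (htpy_class (@chain_mk _ Z Y (fun n => p2 n) jd)), (htpy_class (chain_mk qd)).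
split; last first.
  move=> n V0 Y0; apply/zero_objP; apply: ext; rewrite comp1c comp0c.
    by case: V0 => _; apply.
  by case: Y0 => _; apply.
split; rewrite ?K_comp.
- by apply: (@htpy_eq _ _ _ _ _ s) => n /=; rewrite gf0; zmod_eq.
- apply: esym.
  apply: (@htpy_eq _ Z Z (chain_id Z) _ (fun n =>
    i1 n \oc t n \oc p1 (n + 1) + i2 n \oc fv n \oc p1 (n + 1))) => n /=.
  by rewrite /qg; apply: ext; rewrite /dW !(E, Ed); zmod_eq.
- apply: (@htpy_eq0 _ Z X _ (fun n => p1 (n + 1))) => n.
  transitivity (gv (n + 1) \oc p2 (n + 1)); first by [].
  transitivity (cx_d V (n + 1) \oc p1 (n + 1) + p1 (n + 1 + 1) \oc dW (n + 1));
    last by [].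
  by rewrite /dW !(E, Ed); zmod_eq.
- apply: (@htpy_eq0 _ X Z _ (fun n =>
    - (i1 n \oc t n \oc t (n + 1) + i2 n \oc fv n \oc t (n + 1)))) => n.
  transitivity (qg (n + 1) \oc fv (n + 1)); first by [].
  transitivity (dW n \oc - (i1 n \oc t n \oc t (n + 1) + i2 n \oc fv n \oc t (n + 1))
    - (i1 (n + 1) \oc t (n + 1) \oc t (n + 1 + 1)
       + i2 (n + 1) \oc fv (n + 1) \oc t (n + 1 + 1))
      \oc cx_d V (n + 1 + 1)); last by rewrite -compNl.
  by rewrite /qg /dW !(E, Ed); zmod_eq.
rewrite -htpy_classD; congr htpy_class; apply: chain_eq => n.
transitivity (fv n \oc gv n + p2 n \oc qg n); first by [].
by rewrite /qg !(E, Ed); zmod_eq.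
Qed.

(** The cone of [i] has [X (n + 1)] in degree [n], so it stays in degrees [<= 0] but may reach -1
    when [X] starts in degree 0. It therefore serves for [w_ge0] and for the bounds, while [w_le0]
    is read off from the cocone, isomorphic to it by uniqueness of complements. *)
Lemma heart_wst_b_wic : weakly_idempotent_complete (heart (wst_b B)).
Proof.
apply/wicP => -[[X [a [b Xab]]] [/= [X1 XX1 X1z] [X2 XX2 X2z]]].
move=> [[Y [a' [b' Yab]]] [/= [Y1 YY1 Y1z] [Y2 YY2 Y2z]]] /= i p pi.
have [Z [j [q [bp Zz]]]] := complex_complement_cone pi.
have Zbd : bounded_complex Z.
  exists (Num.min (a - 1) a'), (Num.max b b') => n n0.
  by apply: Zz; [apply: Xab | apply: Yab]; lia.
have Zle : w_le0 (wst B) Z.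
  have [V [X1V Vz]] := cx_unshift X1.
  have [u [u' [u'u uu']]] := isomorphic_trans XX1 X1V.
  have [v [v' [v'v vv']]] := YY1.
  have bp' := is_biproduct_iso (is_biproduct_iso1 bp u'u uu') v'v vv'.
  have [Z1 [j1 [q1 [bp1 Z1z]]]] : exists Z1 (j1 : @hom K Z1 Y1) (q1 : @hom K Y1 Z1), _ :=
    complex_complement_cocone (let: And5 pi' _ _ _ _ := bp' in pi').
  exists Z1; first exact: is_biproduct_unique bp' bp1.
  apply: int_pred_rect => n n0; apply: Z1z; last exact: Y1z.
  by apply: Vz; apply: X1z; lia.
have Zge : w_ge0 (wst B) Z.
  have [u [u' [u'u uu']]] := XX2; have [v [v' [v'v vv']]] := YY2.
  have bp' := is_biproduct_iso (is_biproduct_iso1 bp u'u uu') v'v vv'.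
  have [Z1 [j1 [q1 [bp1 Z1z]]]] : exists Z1 (j1 : @hom K Z1 Y2) (q1 : @hom K Y2 Z1), _ :=
    complex_complement_cone (let: And5 pi' _ _ _ _ := bp' in pi').
  exists Z1; first exact: is_biproduct_unique bp' bp1.
  move=> n n0; apply: Z1z; last exact: Y2z.
  by apply: X2z; lia.
exists (exist _ (exist _ (Z : K) Zbd) (conj Zle Zge)), j, q.
by have [h1 h2 h3 h4 h5] := bp; split.
Qed.

End Complement.

(** * Strictly full embeddings *)

Section Strictification.
Variables (B : addcat) (T : tricat) (J : functor B T).
Hypotheses (J_faithful : faithful J) (J_full : full J).

(* The objects of [T] isomorphic to an object of [B] are replaced by the objects of
   [B], so that [B] becomes closed under isomorphisms. *)
Definition strict_obj : Type := (B + {X : T | ~ exists b, isomorphic (J b) X})%type.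

Definition strict_val (s : strict_obj) : T :=
  match s with inl b => J b | inr X => sval X end.

Definition strict_precat : precat :=
  @Precat strict_obj (fun s t => hom (strict_val s) (strict_val t))
    (fun s => idc (strict_val s)) (fun r s t g f => g \oc f)
    (fun s t f => comp1c f) (fun s t f => compc1 f)
    (fun q r s t h g f => compA h g f)
    (fun r s t g g' f => compDl g g' f) (fun r s t g f f' => compDr g f f').

Definition strict_functor : functor strict_precat T :=
  @Functor strict_precat T strict_val (fun s t f => f) (fun _ => erefl)
    (fun _ _ _ _ _ => erefl) (fun _ _ _ _ => erefl).

Lemma strict_functor_equivalence : is_equivalence strict_functor.
Proof.
apply/is_equivalenceP; split=> [s t f g //|s t f|X]; first by exists f.
have [[b bX] | nX] := pselect (exists b, isomorphic (J b) X).
  by exists (inl b).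
by exists (inr (exist _ X nX)); apply: isomorphic_refl.
Qed.

(** Injectivity on objects is that of [inl]; closure under isomorphism holds because the second
    summand of [strict_obj] excludes every object isomorphic to some [J b]. *)
Lemma strict_embedding : exists (C : tricat) (J' : functor B C),
  [/\ full_embedding J',
      forall b X, isomorphic (J' b) X -> obj_image J' X
    & connective (obj_image J) -> connective (obj_image J')].
Proof.
have [G [GF FG]] := strict_functor_equivalence.
pose C := transport_tricat GF FG.
pose J' : functor B C := @Functor B C (fun b => inl b) (fun b c f => fmap J f)
  (fun b => fmap1 J b) (fun _ _ _ g f => fmapM J g f) (fun _ _ f g => fmapD J f g).
exists C, J'; split.
- split; first by apply/fully_faithfulP; split; [exact: J_faithful|exact: J_full].
  by move=> b c [].
- move=> b [c | [X nX]] bX; first by exists c.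
  by case: (nX); exists b; apply: bX.
move=> conn _ _ [b ->] [c ->] [n|//] n0 f.
have [a [a' [a'a _]]] := transport_shiftz n (J' c : transport_tricat GF FG).
rewrite -[f](@comp1c T) -a'a -compA.
have -> : a \oc (f : @hom T (J b) (strict_functor (shiftz n%:Z (J' c)))) = 0.
  by apply: (conn _ _ _ _ n%:Z n0); [exists b | exists c].
by rewrite compc0.
Qed.

End Strictification.

Lemma connective_embedding (B : addcat) : exists (C : tricat) (J : functor B C),
  [/\ full_embedding J, forall b X, isomorphic (J b) X -> obj_image J X
    & connective (obj_image J)].
Proof.
have [C [J [Je Ji Jc]]] :=
  strict_embedding (@gk_single_faithful B) (@gk_single_full B).
by exists C, J; split=> //; apply: Jc; apply: gk_single_connective.
Qed.

Lemma wKar_embed_fully_faithful (A : addcat) : fully_faithful (wKar_embed A).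
Proof.
apply/fully_faithfulP; split=> [X Y f g fg | X Y g].
  exact: (congr1 (fun h : karHom _ _ => kar_val h) fg).
by exists (kar_val (g : karHom _ _)); apply: val_inj.
Qed.

Lemma nat_iso_refl (A C : precat) (F : functor A C) : nat_iso F F.
Proof.
by exists (fun X => idc (F X)); split=> [X | X Y f];
  [apply: is_iso_id | rewrite comp1c compc1].
Qed.

(** * The equivalences *)

Section Equivalences.
Variable B : addcat.

Lemma wic_of_weakly_retraction_closed :
  (exists (C : tricat) (J : functor B C),
     full_embedding J /\ weakly_retraction_closed (obj_image J)) ->
  weakly_idempotent_complete B.
Proof.
move=> [C [J [[/fully_faithfulP[fa fu] _] J_closed]]]; apply/wicP => X Y i p pi.
have [|Z' [j' [q' [_ bp]]]] := split_mono_biproduct (i := fmap J i) (p := fmap J p).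
  by rewrite -fmapM pi fmap1.
have /J_closed[Z ZE] : wKar_class (obj_image J) Z'.
  apply/wKar_classP; exists (J X), (J Y); split; [by exists X | by exists Y |].
  by exists (fmap J i), j', (fmap J p), q'.
subst Z'; have [j jE] := fu _ _ j'; have [q qE] := fu _ _ q'.
rewrite -{}jE -{}qE in bp; have [_ qj pj qi eY] := bp.
exists Z, j, q; split=> //; apply: fa; rewrite ?fmapD !fmapM ?fmap1 ?fmap0 //.
Qed.

Lemma wic_weakly_retraction_closed :
  weakly_idempotent_complete B ->
  exists (C : tricat) (J : functor B C),
    full_embedding J /\ weakly_retraction_closed (obj_image J).
Proof.
move=> /wicP B_wic; have [C [J [J_emb J_iso _]]] := connective_embedding B.
exists C, J; split=> // Z; split=> [|[z ->]]; last first.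
  have [O O0] := (addcatP B).1; apply/wKar_classP; exists (J O), (J z).
  split; [by exists O | by exists z |].
  have /zero_objP JO0 := fmap_zero_obj J O0.
  exists 0, (idc _), 0, (idc _).
  by split; rewrite ?comp1c ?compc1 ?comp0c ?add0r.
move=> /wKar_classP[_ [_ [[x ->] [y ->] [i [k [r [q bp]]]]]]].
have [/fully_faithfulP[fa fu] _] := J_emb.
have [m mE] := fu _ _ i; have [n nE] := fu _ _ r.
have nm : n \oc m = idc x.
  by apply: fa; rewrite fmapM mE nE fmap1; case: bp.
have [b [kb [qb /(fmap_biproduct J) bpB]]] := B_wic _ _ m n nm.
rewrite mE in bpB; exact: J_iso (is_biproduct_unique bpB bp).
Qed.

(** The case [A = B], with [j] the identity and [e] the canonical embedding of [B] in [wKar B]. *)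
Lemma wic_bounded_heart :
  weakly_idempotent_complete B ->
  exists (C : tricat) (w : weight_classes C),
    [/\ is_weight_structure w, w_bounded w & equivalent B (heart w)].
Proof.
move=> B_wic; have [C [J [J_emb _ J_conn]]] := connective_embedding B.
have [E [E_eq _]] := wic_strong_gen_equivalence J_emb J_conn B_wic
  (@wKar_embed_fully_faithful B)
  (nat_iso_refl (wKar_embed B) : nat_iso (wKar_embed B \oF functor_id B) _).
exists (strongly_generated (obj_image J)), (conn_weight (obj_image (strong_gen_embed J))).
split; [exact: strong_gen_weight | exact: strong_gen_weight_bounded |].
by exists E.
Qed.

Lemma wic_of_heart :
  (exists (C : tricat) (w : weight_classes C),
    is_weight_structure w /\ equivalent B (heart w)) ->
  weakly_idempotent_complete B.
Proof.
by move=> [C [w [ws /wic_equivalent Bw]]]; apply: Bw; apply: heart_wic.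
Qed.

Lemma wic_of_heart_wst_b :
  equivalent B (heart (wst_b B)) -> weakly_idempotent_complete B.
Proof. by move=> /wic_equivalent Bw; apply/Bw/heart_wst_b_wic. Qed.

Definition universal_weight : Prop :=
  forall (A : addcat) (j : functor A B) (e : functor B (wKar A)),
    fully_faithful e -> nat_iso (e \oF j) (wKar_embed A) ->
  forall (C : tricat) (J : functor A C),
    full_embedding J -> connective (obj_image J) ->
  exists! w : weight_classes (strongly_generated (obj_image J)),
    is_weight_structure w /\
    exists (hJ : forall X : A, heart_class w (strong_gen_embed J X))
           (E : functor B (heart w)),
      is_equivalence E /\
      nat_iso (E \oF j) (corestrict (F := strong_gen_embed J) hJ).

Lemma wic_universal_weight : weakly_idempotent_complete B -> universal_weight.
Proof.
move=> B_wic A j e e_ff ej C J J_emb J_conn.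
exists (conn_weight (obj_image (strong_gen_embed J))); split.
  split; first exact: strong_gen_weight.
  exists (strong_gen_heart J_conn).
  exact: wic_strong_gen_equivalence B_wic e_ff ej.
move=> w [ws [hJ _]]; apply: esym; apply: conn_weight_unique ws _.
- exact: strong_gen_connective.
- exact: strong_gen_zero.
- exact: strong_gen_ind.
by move=> _ [X ->]; apply: hJ.
Qed.

(** Tested on [A = B] inside a triangulated category where [B] is connective, the property exhibits
    [B] as a heart. *)
Lemma wic_of_universal_weight :
  universal_weight -> weakly_idempotent_complete B.
Proof.
have [C [J [J_emb _ J_conn]]] := connective_embedding B.
move=> /(_ B (functor_id B) (wKar_embed B) (@wKar_embed_fully_faithful B)
  (nat_iso_refl _) C J J_emb J_conn)[w [[ws [hJ [E [E_eq _]]]] _]].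
by apply: wic_of_heart; exists (strongly_generated (obj_image J)), w;
  split=> //; exists E.
Qed.

End Equivalences.

Theorem theorem4p1 (B : addcat) :
  [<->
    weakly_idempotent_complete B;
    exists (C : tricat) (J : functor B C),
      full_embedding J /\ weakly_retraction_closed (obj_image J);
    exists (C : tricat) (w : weight_classes C),
      is_weight_structure w /\ equivalent B (heart w);
    exists (C : tricat) (w : weight_classes C),
      [/\ is_weight_structure w, w_bounded w & equivalent B (heart w)];
    equivalent B (heart (wst_b B));
    forall (A : addcat) (j : functor A B) (e : functor B (wKar A)),
      fully_faithful e -> nat_iso (e \oF j) (wKar_embed A) ->
    forall (C : tricat) (J : functor A C),
      full_embedding J -> connective (obj_image J) ->
    exists! w : weight_classes (strongly_generated (obj_image J)),
      is_weight_structure w /\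
      exists (hJ : forall X : A, heart_class w (strong_gen_embed J X))
             (E : functor B (heart w)),
        is_equivalence E /\
        nat_iso (E \oF j) (corestrict (F := strong_gen_embed J) hJ)
  ].
Proof.
(* Every implication of the cycle starts from, ends in or passes through weak idempotent
   completeness. *)
tfae.
- exact: wic_weakly_retraction_closed.
- move=> /wic_of_weakly_retraction_closed/wic_bounded_heart[C [w [ws _ Bw]]].
  by exists C, w.
- by move=> /wic_of_heart/wic_bounded_heart.
- move=> [C [w [ws _ Bw]]]; apply: wic_heart_wst_b.
  by apply: wic_of_heart; exists C, w.
- by move=> /wic_of_heart_wst_b/wic_universal_weight.
exact: wic_of_universal_weight.
Qed.
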